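(* Let $(\Sigma,m)$ be a weighted simplicial complex with locally summable weight, let $\circ\in\{+,-,H\}$, and let $d^\circ$ be an intrinsic metric for $b^\circ$ with finite jump size $s>0$. If $c^\circ/m$ is form bounded and the graph $b^\circ$ has uniform subexponential volume growth with respect to $d^\circ$, then for all $1\le p\le\infty$ $$\sigma(\Delta_2^\circ)=\sigma(\Delta_p^\circ).$$
   Context: Simplicial complex: a family $\hat\Sigma$ of finite subsets of a countable set $V$, closed under taking subsets; $\hat\Sigma_k$ are its elements of cardinality $k+1$. Given $m:\hat\Sigma\to(0,\infty)$, put $\Sigma=\hat\Sigma$ if $\sum_{v\in\hat\Sigma_0}m(v)<\infty$ and $\Sigma=\hat\Sigma\setminus\{\varnothing\}$ otherwise; $(\Sigma,m)$ is a weighted simplicial complex. Write $\tau\prec\sigma$ if $\tau\subset\sigma$, $|\sigma\setminus\tau|=1$, $\tau,\sigma\in\Sigma$. Local summability: $\sum_{\sigma\succ\tau}m(\sigma)<\infty$ for all $\tau\in\Sigma$. $C(\Sigma)$, $C_c(\Sigma)$: complex functions, resp. finitely supported ones; $\ell^p=\ell^p(\Sigma,m)$. A coboundary operator is fixed: $\delta\omega(\sigma)=\sum_{\tau\prec\sigma}\theta(\tau,\sigma)\omega(\tau)$ with $\theta(\tau,\sigma)\in\{\pm1\}$ for $\tau\prec\sigma$, such that $\delta\delta=0$. Boundary operator: $\partial\omega(\rho)=\frac1{m(\rho)}\sum_{\tau\succ\rho}m(\tau)\omega(\tau)\theta(\rho,\tau)$ (where absolutely convergent for all $\rho$). The forms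 $Q^+(\omega)=\|\delta\omega\|_2^2$, $Q^-(\omega)=\|\partial\omega\|_2^2$, $Q^H(\omega)=\|\delta\omega+\partial\omega\|_2^2$ on $C_c(\Sigma)$ are closable in $\ell^2$; $\Delta_2^\circ$ is the positive self-adjoint operator associated with the closure of $Q^\circ$ and $S_2^\circ(t)=e^{-t\Delta_2^\circ}$. On $C_c(\Sigma)$, $Q^\circ$ is a signed Schrödinger form with edge weight $b^\circ(\tau,\tau')=|Q^\circ(1_{\tau'},1_\tau)|$ for $\tau\ne\tau'$, $b^\circ(\tau,\tau)=0$ (with $Q^\circ(\cdot,\cdot)$ the sesquilinear form of $Q^\circ$), and potential $c^\circ(\tau)=Q^\circ(1_\tau)-\sum_{\tau'}b^\circ(\tau,\tau')$. $c^\circ/m$ is form bounded if there are $M,C\ge0$ such that $\|\sqrt{c^\circ_-/m}\,\omega\|_2^2\le MQ^\circ(\omega)+C\|\omega\|_2^2$ for all $\omega\in C_c(\Sigma)$, $c^\circ_-=-(c^\circ\wedge0)$. An intrinsic metric for $b^\circ$ is a pseudo metric $d^\circ$ on $\Sigma$ with $\frac1{m(\tau)}\sum_{\tau'}b^\circ(\tau,\tau')d^\circ(\tau,\tau')^2\le1$ for all $\tau$; its jump size is $s=\sup\{d^\circ(\tau,\tau'):b^\circ(\tau,\tau')>0\}$. Uniform subexponential volume growth: for all $\varepsilon>0$ there is $C_\varepsilon>0$ with $m(B_r(\tau))<C_\varepsilon e^{\varepsilon r}m(\tau)$ for all $\tau\in\Sigma$, $r>0$, where $B_r(\tau)=\{\tau':d^\circ(\tau,\tau')\le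 r\}$. Under this growth assumption $S_2^\circ$ extends consistently (agreeing on $\ell^2\cap\ell^p$) to strongly continuous semigroups $S_p^\circ$ on $\ell^p$, $1\le p<\infty$; $-\Delta_p^\circ$ is the generator of $S_p^\circ$ and $\Delta_\infty^\circ=(\Delta_1^\circ)^*$ with respect to the dual pairing $\sum_\Sigma mf\overline g$ of $\ell^1$ and $\ell^\infty$. $\sigma(\cdot)$ is the spectrum. *)

(* Defs.v *)
From mathcomp Require Import all_boot all_order all_algebra finmap.
From mathcomp Require Import complex.
From mathcomp Require Import all_classical all_reals all_analysis.

Set Implicit Arguments.
Unset Strict Implicit.
Unset Printing Implicit Defensive.

Import Order.TTheory GRing.Theory Num.Theory numFieldNormedType.Exports.

Local Open Scope classical_set_scope.
Local Open Scope ring_scope.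
Local Open Scope complex_scope.


(* Convention: a possibly unbounded operator in l^p(X, m) is its graph, a
   relation on functions X -> R[i]; a bounded operator on l^p(X, m) is a
   function on X -> R[i] whose values off l^p are irrelevant. *)

(* Unordered sums of absolutely summable families (junk values otherwise). *)
Definition rsum (R : realType) (X : choiceType) (D : set X) (f : X -> R) : R :=
  fine (\esum_(x in D) (Num.max (f x) 0)%:E)
  - fine (\esum_(x in D) (Num.max (- f x) 0)%:E).

Definition csum (R : realType) (X : choiceType) (D : set X) (f : X -> R[i]) :
    R[i] :=
  rsum D (fun x => complex.Re (f x)) +i* rsum D (fun x => complex.Im (f x)).

Definition finsupp_fun (R : realType) (X : choiceType) (f : X -> R[i]) : Prop :=
  finite_set [set x | f x != 0].

Definition ind1 (R : realType) (X : choiceType) (t : X) : X -> R[i] :=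
  fun x => (x == t)%:R.

(* Meaningful for 1 <= p <= +oo. *)
Definition lpnorm (R : realType) (X : choiceType) (m : X -> R) (p : \bar R)
    (f : X -> R[i]) : \bar R :=
  if p is r%:E
  then ((\esum_(x in [set: X]) (m x * Normc.normc (f x) `^ r)%:E) `^ r^-1)%E
  else ereal_sup (0%E |` range (fun x => (Normc.normc (f x))%:E)).

Definition lp (R : realType) (X : choiceType) (m : X -> R) (p : \bar R) :
    set (X -> R[i]) :=
  [set f | (lpnorm m p f < +oo)%E].

Definition pairing (R : realType) (X : choiceType) (m : X -> R)
    (f g : X -> R[i]) : R[i] :=
  csum [set: X] (fun x => (m x)%:C * f x * conjc (g x)).

Definition bounded_op (R : realType) (X : choiceType) (m : X -> R) (p : \bar R)
    (T : (X -> R[i]) -> X -> R[i]) : Prop :=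
  [/\ forall f, lp m p f -> lp m p (T f),
      forall (a : R[i]) f g, lp m p f -> lp m p g ->
        T (fun x => a * f x + g x) = (fun x => a * T f x + T g x)
    & exists M : R, 0 <= M /\
        forall f, lp m p f -> (lpnorm m p (T f) <= M%:E * lpnorm m p f)%E].

Definition graph (R : realType) (X : choiceType) : Type :=
  (X -> R[i]) -> (X -> R[i]) -> Prop.

(* T = (z - A)^-1 as a bounded operator on l^p. *)
Definition resolvent_at (R : realType) (X : choiceType) (m : X -> R)
    (p : \bar R) (A : graph R X) (z : R[i]) (T : (X -> R[i]) -> X -> R[i]) :
    Prop :=
  [/\ bounded_op m p T,
      forall g, lp m p g -> A (T g) (fun x => z * T g x - g x)
    & forall f h, A f h -> T (fun x => z * f x - h x) = f].

Definition spectrum (R : realType) (X : choiceType) (m : X -> R) (p : \bar R)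
    (A : graph R X) : set R[i] :=
  [set z | ~ exists T, resolvent_at m p A z T].

Definition opp_graph (R : realType) (X : choiceType) (A : graph R X) :
    graph R X :=
  fun f g => A f (fun x => - g x).

Definition C0_semigroup (R : realType) (X : choiceType) (m : X -> R)
    (p : \bar R) (S : R -> (X -> R[i]) -> X -> R[i]) : Prop :=
  [/\ forall t, 0 <= t -> bounded_op m p (S t),
      forall f, lp m p f -> S 0 f = f,
      forall t u f, 0 <= t -> 0 <= u -> lp m p f -> S (t + u) f = S t (S u f)
    & forall f, lp m p f ->
        lpnorm m p (S t f \- f) @[t --> 0^'+] --> 0%E].

Definition generator (R : realType) (X : choiceType) (m : X -> R) (p : \bar R)
    (S : R -> (X -> R[i]) -> X -> R[i]) : graph R X :=
  fun f g => [/\ lp m p f, lp m p g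
    & lpnorm m p (fun x => (t^-1)%:C * (S t f x - f x) - g x)
        @[t --> 0^'+] --> 0%E].

(* Adjoint, in l^oo, of a densely defined operator A in l^1. *)
Definition adjoint_l1 (R : realType) (X : choiceType) (m : X -> R)
    (A : graph R X) : graph R X :=
  fun f g => [/\ lp m +oo%E f, lp m +oo%E g
    & forall u v, A u v -> pairing m v f = pairing m u g].

(* The values of [weight] off [hatfaces] are irrelevant. *)
Record weightedComplex (R : realType) (V : countType) := WeightedComplex {
  hatfaces : set {fset V};
  hatfaces_sub : forall s t : {fset V},
    hatfaces s -> (t `<=` s)%fset -> hatfaces t;
  weight : {fset V} -> R;
  weight_gt0 : forall s, hatfaces s -> 0 < weight s }.

Definition faces (R : realType) (V : countType) (K : weightedComplex R V) :
    set {fset V} :=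
  if `[< ((\esum_(s in [set s | hatfaces K s /\ #|` s| = 1%N])
             (weight K s)%:E) < +oo)%E >]
  then hatfaces K else hatfaces K `\ fset0.

Definition simplex (R : realType) (V : countType) (K : weightedComplex R V) :
    choiceType :=
  set_type (faces K).

Definition verts (R : realType) (V : countType) (K : weightedComplex R V)
    (s : simplex K) : {fset V} := sval s.

Definition mass (R : realType) (V : countType) (K : weightedComplex R V)
    (s : simplex K) : R := weight K (verts s).

Definition prec (R : realType) (V : countType) (K : weightedComplex R V)
    (t s : simplex K) : Prop :=
  (verts t `<=` verts s)%fset /\ #|` (verts s `\` verts t)%fset| = 1%N.

Definition locally_summable (R : realType) (V : countType)
    (K : weightedComplex R V) : Prop :=
  forall t : simplex K,
    ((\esum_(s in [set s | prec t s]) (mass s)%:E) < +oo)%E.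

Definition coboundary (R : realType) (V : countType) (K : weightedComplex R V)
    (theta : simplex K -> simplex K -> R[i]) (w : simplex K -> R[i]) :
    simplex K -> R[i] :=
  fun s => \sum_(t \in [set t | prec t s]) theta t s * w t.

Definition coboundary_signs (R : realType) (V : countType)
    (K : weightedComplex R V) (theta : simplex K -> simplex K -> R[i]) : Prop :=
  (forall t s, prec t s -> theta t s = 1 \/ theta t s = - 1) /\
  (forall w, coboundary theta (coboundary theta w) = (fun=> 0)).

Definition boundary (R : realType) (V : countType) (K : weightedComplex R V)
    (theta : simplex K -> simplex K -> R[i]) (w : simplex K -> R[i]) :
    simplex K -> R[i] :=
  fun r => ((mass r)^-1)%:C *
    csum [set t | prec r t] (fun t => (mass t)%:C * w t * theta r t).

Inductive laplacian_kind := UpperLap | LowerLap | HodgeLap.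

Definition form_map (R : realType) (V : countType) (K : weightedComplex R V)
    (theta : simplex K -> simplex K -> R[i]) (o : laplacian_kind)
    (w : simplex K -> R[i]) : simplex K -> R[i] :=
  match o with
  | UpperLap => coboundary theta w
  | LowerLap => boundary theta w
  | HodgeLap => coboundary theta w \+ boundary theta w
  end.

Definition qform (R : realType) (V : countType) (K : weightedComplex R V)
    (theta : simplex K -> simplex K -> R[i]) (o : laplacian_kind)
    (w : simplex K -> R[i]) : \bar R :=
  (lpnorm (@mass R V K) 2%:E (form_map theta o w) ^+ 2)%E.

Definition sesqform (R : realType) (V : countType) (K : weightedComplex R V)
    (theta : simplex K -> simplex K -> R[i]) (o : laplacian_kind)
    (w v : simplex K -> R[i]) : R[i] :=
  pairing (@mass R V K) (form_map theta o w) (form_map theta o v).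

(* (wn) is a form-Cauchy sequence of finitely supported functions converging
   to w in l^2: w lies in the domain of the closure of the form. *)
Definition form_approx (R : realType) (V : countType) (K : weightedComplex R V)
    (theta : simplex K -> simplex K -> R[i]) (o : laplacian_kind)
    (w : simplex K -> R[i]) (wn : nat -> simplex K -> R[i]) : Prop :=
  [/\ forall n, finsupp_fun (wn n),
      lpnorm (@mass R V K) 2%:E (wn n \- w) @[n --> \oo] --> 0%E
    & forall e : R, 0 < e -> exists N : nat, forall n k : nat,
        (N <= n)%N -> (N <= k)%N ->
        (qform theta o (wn n \- wn k)%R < e%:E)%E].

Definition closure_dom (R : realType) (V : countType) (K : weightedComplex R V)
    (theta : simplex K -> simplex K -> R[i]) (o : laplacian_kind) :
    set (simplex K -> R[i]) :=
  [set w | lp (@mass R V K) 2%:E w /\ exists wn, form_approx theta o w wn].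

(* The closure of the form takes the value z at (w, v). *)
Definition closure_val (R : realType) (V : countType) (K : weightedComplex R V)
    (theta : simplex K -> simplex K -> R[i]) (o : laplacian_kind)
    (w v : simplex K -> R[i]) (z : R[i]) : Prop :=
  forall wn vn, form_approx theta o w wn -> form_approx theta o v vn ->
    Normc.normc (sesqform theta o (wn n) (vn n) - z) @[n --> \oo] --> (0 : R).

(* Delta2 w f: w is in the form domain and the closed form sends (w, v) to
   the inner product of f and v, for every v in the form domain. *)
Definition Delta2 (R : realType) (V : countType) (K : weightedComplex R V)
    (theta : simplex K -> simplex K -> R[i]) (o : laplacian_kind) :
    graph R (simplex K) :=
  fun w f => [/\ closure_dom theta o w, lp (@mass R V K) 2%:E f
    & forall v, closure_dom theta o v ->
        closure_val theta o w v (pairing (@mass R V K) f v)].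

(* [S p] is the semigroup on l^p, 1 <= p < +oo; [S 2] is exp (- t Delta2). *)
Definition heat_semigroups (R : realType) (V : countType)
    (K : weightedComplex R V) (theta : simplex K -> simplex K -> R[i])
    (o : laplacian_kind)
    (S : \bar R -> R -> (simplex K -> R[i]) -> simplex K -> R[i]) : Prop :=
  [/\ forall p : \bar R, (1 <= p)%E -> (p < +oo)%E ->
        C0_semigroup (@mass R V K) p (S p),
      forall f g, generator (@mass R V K) 2%:E (S 2%:E) f g <->
        opp_graph (Delta2 theta o) f g
    & forall (p : \bar R) (t : R) f, (1 <= p)%E -> (p < +oo)%E -> 0 <= t ->
        lp (@mass R V K) 2%:E f -> lp (@mass R V K) p f ->
        S p t f = S 2%:E t f].

Definition Delta (R : realType) (V : countType) (K : weightedComplex R V)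
    (S : \bar R -> R -> (simplex K -> R[i]) -> simplex K -> R[i])
    (p : \bar R) : graph R (simplex K) :=
  if p == +oo%E
  then adjoint_l1 (@mass R V K)
         (opp_graph (generator (@mass R V K) 1%E (S 1%E)))
  else opp_graph (generator (@mass R V K) p (S p)).

Definition edge_weight (R : realType) (V : countType) (K : weightedComplex R V)
    (theta : simplex K -> simplex K -> R[i]) (o : laplacian_kind)
    (t t' : simplex K) : R :=
  if t == t' then 0
  else Normc.normc (sesqform theta o (ind1 R t') (ind1 R t)).

Definition potential (R : realType) (V : countType) (K : weightedComplex R V)
    (theta : simplex K -> simplex K -> R[i]) (o : laplacian_kind)
    (t : simplex K) : R :=
  fine (qform theta o (ind1 R t))
  - fine (\esum_(t' in [set: simplex K]) (edge_weight theta o t t')%:E).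

Definition form_bounded (R : realType) (V : countType) (K : weightedComplex R V)
    (theta : simplex K -> simplex K -> R[i]) (o : laplacian_kind) : Prop :=
  exists M C : R, [/\ 0 <= M, 0 <= C
    & forall w : simplex K -> R[i], finsupp_fun w ->
      (lpnorm (@mass R V K) 2%:E
         (fun t => (Num.sqrt (- Num.min (potential theta o t) 0 / mass t))%:C
                   * w t)%R ^+ 2
       <= M%:E * qform theta o w
          + C%:E * lpnorm (@mass R V K) 2%:E w ^+ 2)%E].

Definition pseudo_metric (R : realType) (X : Type) (d : X -> X -> R) : Prop :=
  [/\ forall x y, 0 <= d x y, forall x, d x x = 0,
      forall x y, d x y = d y x
    & forall x y z, d x z <= d x y + d y z].

Definition intrinsic_metric (R : realType) (X : choiceType) (m : X -> R)
    (b d : X -> X -> R) : Prop :=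
  pseudo_metric d /\
  forall x, (((m x)^-1)%:E * (\esum_(y in [set: X]) (b x y * d x y ^+ 2)%:E)
             <= 1)%E.

Definition jump_size (R : realType) (X : Type) (b d : X -> X -> R) : \bar R :=
  ereal_sup [set z | exists x y, 0 < b x y /\ z = (d x y)%:E].

Definition uniform_subexp_growth (R : realType) (X : choiceType) (m : X -> R)
    (d : X -> X -> R) : Prop :=
  forall e : R, 0 < e -> exists2 C : R, 0 < C &
    forall (x : X) (r : R), 0 < r ->
      ((\esum_(y in [set y | (d x y <= r)%R]) (m y)%:E)
       < (C * expR (e * r) * m x)%:E)%E.

(* Main.v *)
(** Let Delta be the operator of Q.  Conjugating Q by e^phi with
    phi = eps * min (d y, r), a function that is constant off a finite ball,
    the intrinsic metric and the form bound make the conjugated form a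
    relatively small perturbation of Q for small eps.  Hence, for z in the
    resolvent set of Delta_2, the kernel of (z - Delta_2)^-1 satisfies
      |K(x, y)| <= C e^(- eps d(x, y)) (m y / m x)^(1/2),
    and subexponential volume growth turns this into a Schur bound on every
    l^p.  Since the semigroups are consistent, the bounded operator obtained in
    this way is the resolvent of Delta_p (by duality for p = oo).

    Conversely, non-real z always lie in the resolvent set of Delta_2.  If a
    real z lies in the resolvent set of Delta_p, the resolvents at
    z +- i/n are bounded on l^p uniformly in n; for such an operator T the
    log-convexity of k |-> <(T* T)^k f, f> yields the same bound on l^2, and a
    Neumann series around z + i/n reaches z. *)
Require Import Defs.
From HB Require Import structures.
From mathcomp Require Import all_boot all_order all_algebra finmap.
From mathcomp Require Import complex.
From mathcomp Require Import all_classical all_reals all_analysis.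
From mathcomp Require Import ring lra.

Set Implicit Arguments.
Unset Strict Implicit.
Unset Printing Implicit Defensive.

Import Order.TTheory GRing.Theory Num.Theory numFieldNormedType.Exports.

Local Open Scope classical_set_scope.
Local Open Scope ring_scope.
Local Open Scope complex_scope.

(** Both the coboundary and the boundary have values <w, G x> with [G x] in l^2, so all three forms
    are w -> |D w|^2 with D defined and pointwise continuous on l^2. Closability is then automatic,
    and the analysis runs on an abstract weighted set; the complex returns only at the end, where
    delta delta = 0 makes the degrees of the Hodge graph finite. The signs of the form are arbitrary
    phases, so the first-order term of the conjugated form does not cancel. It is absorbed by the
    edge energy, which Q and the form-bounded negative part of the potential control. A point z of
    the resolvent set may lie in a spectral gap, where the form is not coercive. The weak equation
    is therefore tested twice: against the solution, and against the resolvent at conj z applied to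
    it. The generator on l^p is linked to Q only through consistency with the l^2 semigroup. Its
    domain is reached by Riemann sums in l^2, whose l^p bounds survive pointwise limits; for this
    the semigroups must be locally bounded, which is where uniform boundedness enters. *)

Ltac leq_eq := rewrite le_eqVlt; apply/orP; left; apply/eqP.
Ltac leq_ring := leq_eq; ring.

Local Notation normc := Normc.normc.
Arguments Normc.normc : simpl never.

(** * Modulus and components of complex numbers *)

Section ComplexModulus.
Variable R : rcfType.
Implicit Types z w : R[i].

Lemma normc_ge0 z : 0 <= normc z.
Proof. by case: z => a b; exact: sqrtr_ge0. Qed.

Lemma normcR (r : R) : normc r%:C = `|r|.
Proof. by rewrite /normc /= expr0n addr0 sqrtr_sqr. Qed.

Lemma normc0 : normc (0 : R[i]) = 0.
Proof. by rewrite (normcR 0) normr0. Qed.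

Lemma normc1 : normc (1 : R[i]) = 1.
Proof. by rewrite (normcR 1) normr1. Qed.

Lemma normc_eq0 z : (normc z == 0) = (z == 0).
Proof.
by apply/eqP/eqP => [/Normc.eq0_normc //|->]; exact: normc0.
Qed.

Lemma normcN z : normc (- z) = normc z.
Proof. by case: z => a b; rewrite /normc /= !sqrrN. Qed.

Lemma normcB z w : normc (z - w) = normc (w - z).
Proof. by rewrite -normcN opprB. Qed.

Lemma normcM z w : normc (z * w) = normc z * normc w.
Proof. exact: Normc.normcM. Qed.

Lemma normc_conjc z : normc (conjc z) = normc z.
Proof. by case: z => a b; rewrite /normc /= sqrrN. Qed.

Lemma sqr_normcE z : normc z ^+ 2 = complex.Re z ^+ 2 + complex.Im z ^+ 2.
Proof. by case: z => a b; rewrite /normc /= sqr_sqrtr // addr_ge0 ?sqr_ge0. Qed.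

Lemma mulc_conj z : z * conjc z = (normc z ^+ 2)%:C.
Proof.
rewrite sqr_normcE; case: z => a b; apply/eqP; rewrite eq_complex /=.
by apply/andP; split; apply/eqP; ring.
Qed.

Lemma normc_ge_abs_Re z : `|complex.Re z| <= normc z.
Proof.
rewrite -(ler_pXn2r (n := 2)) ?nnegrE ?normc_ge0 //.
by rewrite sqr_normcE real_normK ?num_real // lerDl sqr_ge0.
Qed.

Lemma normc_ge_abs_Im z : `|complex.Im z| <= normc z.
Proof.
rewrite -(ler_pXn2r (n := 2)) ?nnegrE ?normc_ge0 //.
by rewrite sqr_normcE real_normK ?num_real // lerDr sqr_ge0.
Qed.

Lemma normc_le_ReIm z : normc z <= `|complex.Re z| + `|complex.Im z|.
Proof.
rewrite -(ler_pXn2r (n := 2)) ?nnegrE ?normc_ge0 ?addr_ge0 //.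
rewrite sqr_normcE sqrrD !real_normK ?num_real //.
by rewrite -addrA lerD2l lerDr mulrn_wge0 // mulr_ge0.
Qed.

Lemma ler_normcD z w : normc (z + w) <= normc z + normc w.
Proof. by have := ler_normD z w; rewrite !normc_def -!rmorphD /= lecR; case: z w => ? ? [? ?]. Qed.

Lemma ler_normcB z w : normc (z - w) <= normc z + normc w.
Proof. by rewrite -(normcN w); exact: ler_normcD. Qed.

Lemma ler_normc_sum (I : Type) (r : seq I) (P : pred I) (f : I -> R[i]) :
  normc (\sum_(i <- r | P i) f i) <= \sum_(i <- r | P i) normc (f i).
Proof.
elim/big_rec2 : _ => [|i y1 y2 _ le]; first by rewrite normc0.
by apply: (le_trans (ler_normcD _ _)); rewrite lerD2l.
Qed.

Lemma normc_small z : (forall e, 0 < e -> normc z <= e) -> z = 0.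
Proof.
move=> h; apply/eqP; rewrite -normc_eq0 eq_le normc_ge0 andbT.
by apply/ler_addgt0Pr => e e0; rewrite add0r; exact: h.
Qed.

Lemma Re_sum (I : Type) (r : seq I) (P : pred I) (f : I -> R[i]) :
  complex.Re (\sum_(i <- r | P i) f i) = \sum_(i <- r | P i) complex.Re (f i).
Proof. by elim/big_rec2 : _ => // i y1 y2 _ <-; case: y2 (f i) => ? ? []. Qed.

Lemma Im_sum (I : Type) (r : seq I) (P : pred I) (f : I -> R[i]) :
  complex.Im (\sum_(i <- r | P i) f i) = \sum_(i <- r | P i) complex.Im (f i).
Proof. by elim/big_rec2 : _ => // i y1 y2 _ <-; case: y2 (f i) => ? ? []. Qed.

Lemma cReD z w : complex.Re (z + w) = complex.Re z + complex.Re w.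
Proof. by case: z w => ? ? []. Qed.

Lemma cImD z w : complex.Im (z + w) = complex.Im z + complex.Im w.
Proof. by case: z w => ? ? []. Qed.

Lemma cReN z : complex.Re (- z) = - complex.Re z.
Proof. by case: z. Qed.

Lemma cImN z : complex.Im (- z) = - complex.Im z.
Proof. by case: z. Qed.

Lemma cReJ z : complex.Re (conjc z) = complex.Re z.
Proof. by case: z. Qed.

Lemma cImJ z : complex.Im (conjc z) = - complex.Im z.
Proof. by case: z. Qed.

Lemma cReZ (r : R) z : complex.Re (r%:C * z) = r * complex.Re z.
Proof. by case: z => a b /=; rewrite mul0r subr0. Qed.

Lemma cImZ (r : R) z : complex.Im (r%:C * z) = r * complex.Im z.
Proof. by case: z => a b /=; rewrite mul0r addr0. Qed.

Lemma conjc_mul z w : conjc (z * w) = conjc z * conjc w.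
Proof. exact: rmorphM. Qed.

Lemma conjc_add z w : conjc (z + w) = conjc z + conjc w.
Proof. exact: rmorphD. Qed.

Lemma conjc_opp z : conjc (- z) = - conjc z.
Proof. exact: rmorphN. Qed.

Lemma conjc_sum (I : Type) (r : seq I) (P : pred I) (f : I -> R[i]) :
  conjc (\sum_(i <- r | P i) f i) = \sum_(i <- r | P i) conjc (f i).
Proof. exact: rmorph_sum. Qed.

End ComplexModulus.

(** * Unordered sums as limits over finite sets *)

Section UnorderedSums.
Variables (R : realType) (X : choiceType).
Implicit Types (F : {fset X}) (g : X -> R) (f : X -> R[i]).

(** For nonnegative terms [\esum] is a supremum over finite sets. Through this equivalence the
    estimates below are made on sums over an [{fset X}]. *)
Lemma esum_le_fsetP g (M : R) : (forall x, 0 <= g x) ->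
  ((\esum_(x in [set: X]) (g x)%:E <= M%:E)%E <->
   forall F, \sum_(x <- F) g x <= M).
Proof.
move=> g0; split => [h F|h].
  rewrite -lee_fin -sumEFin fsbig_seq; last exact: fset_uniq.
  apply: le_trans h; apply: ereal_sup_ubound => /=.
  by exists [set` F].
apply: ge_ereal_sup => _ [A [finA _] <-].
by rewrite fsbig_finite //= sumEFin lee_fin.
Qed.

Lemma ler_sum_fsub F F' g : (forall x, 0 <= g x) -> (F `<=` F')%fset ->
  \sum_(x <- F) g x <= \sum_(x <- F') g x.
Proof.
move=> g0 sub; rewrite [leRHS](big_fsetID _ (mem F)) /=.
have -> : [fset x | x in F' & x \in F]%fset = F.
  apply/fsetP => x; rewrite !inE /=; apply/andP/idP => [[]//|xF].
  by split=> //; exact: (fsubsetP sub).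
by rewrite lerDl sumr_ge0.
Qed.

Definition has_bounded_sums g := exists M : R, forall F, \sum_(x <- F) g x <= M.

Lemma esum_fin_approx g : (forall x, 0 <= g x) -> has_bounded_sums g ->
  forall e, 0 < e -> exists F0 : {fset X}, forall F, (F0 `<=` F)%fset ->
    `|fine (\esum_(x in [set: X]) (g x)%:E) - \sum_(x <- F) g x| <= e.
Proof.
move=> g0 [M hM] e e0.
set S := (\esum_(x in [set: X]) (g x)%:E)%E.
have S0 : (0 <= S)%E by apply: esum_ge0 => x _; rewrite lee_fin.
have Sfin : S \is a fin_num.
  rewrite ge0_fin_numE //; apply: le_lt_trans (ltry M).
  by apply/esum_le_fsetP.
have [_ [A [finA _] <-] hA] := ub_ereal_sup_adherent e0 Sfin.
move: hA; rewrite fsbig_finite //= sumEFin -[ereal_sup _]/S -(fineK Sfin) -EFinB lte_fin => hA.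
exists (fset_set A) => F sub.

have hF : \sum_(x <- F) g x <= fine S.
  by move: F {sub}; apply/esum_le_fsetP => //; rewrite fineK.
rewrite /= ger0_norm ?subr_ge0 //.
have := ler_sum_fsub g0 sub; lra.
Qed.

Definition abs_summable f := has_bounded_sums (fun x => normc (f x)).

Lemma ler_has_bounded_sums g g' : (forall x, g x <= g' x) ->
  has_bounded_sums g' -> has_bounded_sums g.
Proof.
by move=> le [M hM]; exists M => F; apply: le_trans (hM F); exact: ler_sum.
Qed.

(** Positive and negative parts are dominated by [|g|], so neither [fine] in [rsum] hits its junk
    value at infinity. *)
Lemma rsum_approx g : has_bounded_sums (fun x => `|g x|) ->
  forall e, 0 < e -> exists F0 : {fset X}, forall F, (F0 `<=` F)%fset ->
    `|rsum [set: X] g - \sum_(x <- F) g x| <= e.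
Proof.
move=> hg e e0.
have e2 : 0 < e / 2 by lra.
have posb : has_bounded_sums (fun x => Num.max (g x) 0).
  by apply: ler_has_bounded_sums hg => x; rewrite ge_max ler_norm normr_ge0.
have negb : has_bounded_sums (fun x => Num.max (- g x) 0).
  apply: ler_has_bounded_sums hg => x.
  by rewrite ge_max normr_ge0 andbT -normrN ler_norm.
have p0 x : 0 <= Num.max (g x) 0 by rewrite le_max lexx orbT.
have n0 x : 0 <= Num.max (- g x) 0 by rewrite le_max lexx orbT.
have [F1 h1] := esum_fin_approx p0 posb e2.
have [F2 h2] := esum_fin_approx n0 negb e2.
exists (F1 `|` F2)%fset => F; rewrite fsubUset => /andP[/h1 {}h1 /h2 {}h2].
have -> : \sum_(x <- F) g x
    = \sum_(x <- F) Num.max (g x) 0 - \sum_(x <- F) Num.max (- g x) 0.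
  rewrite -sumrB; apply: eq_bigr => x _.
  by case: (leP (g x) 0) => ?; case: (leP (- g x) 0) => ?; lra.
rewrite /rsum; move: h1 h2; rewrite !ler_norml; lra.
Qed.

Lemma csum_approx f : abs_summable f ->
  forall e, 0 < e -> exists F0 : {fset X}, forall F, (F0 `<=` F)%fset ->
    normc (csum [set: X] f - \sum_(x <- F) f x) <= e.
Proof.
move=> hf e e0; have e2 : 0 < e / 2 by lra.
have [] := @rsum_approx (fun x => complex.Re (f x)) _ _ e2.
  by apply: ler_has_bounded_sums hf => x; exact: normc_ge_abs_Re.
move=> F1 h1.
have [] := @rsum_approx (fun x => complex.Im (f x)) _ _ e2.
  by apply: ler_has_bounded_sums hf => x; exact: normc_ge_abs_Im.
move=> F2 h2.
exists (F1 `|` F2)%fset => F; rewrite fsubUset => /andP[/h1 {}h1 /h2 {}h2].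
apply: le_trans (normc_le_ReIm _) _.
rewrite cReD cImD cReN cImN Re_sum Im_sum /csum /=; lra.
Qed.

(** Limits along the directed family of finite sets are unique. Linearity, conjugation and finite
    support identify [csum] through this lemma instead of through its four positive parts. *)
Lemma csum_unique f l : abs_summable f ->
  (forall e, 0 < e -> exists F0 : {fset X}, forall F, (F0 `<=` F)%fset ->
    normc (l - \sum_(x <- F) f x) <= e) -> csum [set: X] f = l.
Proof.
move=> sf hl; apply/eqP; rewrite -subr_eq0; apply/eqP; apply: normc_small => e e0.
have e2 : 0 < e / 2 by lra.
have [F1 h1] := csum_approx sf e2; have [F2 h2] := hl _ e2.
have := h1 (F1 `|` F2)%fset (fsubsetUl _ _).
have := h2 (F1 `|` F2)%fset (fsubsetUr _ _).
set s := \sum_(_ <- _) _ => a b.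
have -> : csum [set: X] f - l = (csum [set: X] f - s) - (l - s) by ring.
have := ler_normcB (csum [set: X] f - s) (l - s); lra.
Qed.

Lemma normc_csum_le f (M : R) :
  (forall F, \sum_(x <- F) normc (f x) <= M) -> normc (csum [set: X] f) <= M.
Proof.
move=> hM; apply/ler_addgt0Pr => e e0.
have [F h] := csum_approx (ex_intro _ M hM) e0.
have := h F (fsubset_refl _); set s := \sum_(_ <- _) _ => hs.
have -> : csum [set: X] f = s + (csum [set: X] f - s) by ring.
apply: le_trans (ler_normcD _ _) _.
by apply: lerD => //; apply: le_trans (ler_normc_sum _ _ _) _.
Qed.

Lemma abs_summableD a f1 f2 : abs_summable f1 -> abs_summable f2 ->
  abs_summable (fun x => a * f1 x + f2 x).
Proof.
move=> [M1 h1] [M2 h2]; exists (normc a * M1 + M2) => F.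
apply: (@le_trans _ _ (\sum_(x <- F) (normc a * normc (f1 x) + normc (f2 x)))).
  by apply: ler_sum => x _; rewrite -normcM; exact: ler_normcD.
rewrite big_split /= -mulr_sumr lerD //.
by rewrite ler_wpM2l ?normc_ge0.
Qed.

Lemma csum_linear a f1 f2 : abs_summable f1 -> abs_summable f2 ->
  csum [set: X] (fun x => a * f1 x + f2 x)
  = a * csum [set: X] f1 + csum [set: X] f2.
Proof.
move=> s1 s2; apply: csum_unique; first exact: abs_summableD.
(* The added 1 keeps the divisor positive when [a] is 0; the same device recurs with norms and
   operator bounds. *)
move=> e e0; have c0 : 0 < normc a + 1 by have := normc_ge0 a; lra.
have e1 : 0 < e / (normc a + 1) / 2 by rewrite !divr_gt0.
have e2 : 0 < e / 2 by lra.
have [F1 h1] := csum_approx s1 e1; have [F2 h2] := csum_approx s2 e2.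
exists (F1 `|` F2)%fset => F; rewrite fsubUset => /andP[/h1 {}h1 /h2 {}h2].
rewrite big_split /= -mulr_sumr; move: h1 h2.
set t1 := \sum_(_ <- _) _; set t2 := \sum_(_ <- _) _ => h1 h2.
have -> : a * csum [set: X] f1 + csum [set: X] f2 - (a * t1 + t2)
  = a * (csum [set: X] f1 - t1) + (csum [set: X] f2 - t2) by ring.
apply: le_trans (ler_normcD _ _) _; rewrite normcM.
have : normc a * normc (csum [set: X] f1 - t1) <= e / 2.
  apply: (@le_trans _ _ ((normc a + 1) * (e / (normc a + 1) / 2))).
    by apply: ler_pM => //; rewrite ?normc_ge0 // lerDl.
  by leq_eq; field; rewrite gt_eqF.
lra.
Qed.

Lemma sum_fset_supp (f : X -> R[i]) (F0 F : {fset X}) :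
  (forall x, x \notin F0 -> f x = 0) -> (F0 `<=` F)%fset ->
  \sum_(x <- F) f x = \sum_(x <- F0) f x.
Proof. by move=> h sub; symmetry; apply: big_fset_incl => // x _ /h. Qed.

Lemma abs_summable_fin f F0 : (forall x, x \notin F0 -> f x = 0) ->
  abs_summable f.
Proof.
move=> h; exists (\sum_(x <- F0) normc (f x)) => F.
apply: (@le_trans _ _ (\sum_(x <- (F `|` F0)%fset) normc (f x))).
  by apply: ler_sum_fsub; [move=> x; exact: normc_ge0|exact: fsubsetUl].
rewrite (big_fsetID _ (mem F0)) /=.
rewrite [X in _ + X]big_seq_cond [X in _ + X]big1 ?addr0; last first.
  by move=> x; rewrite !inE /= andbT => /andP[_ /h ->]; rewrite normc0.
apply: ler_sum_fsub; first by move=> x; exact: normc_ge0.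
by apply/fsubsetP => x; rewrite !inE /= => /andP[].
Qed.

Lemma csum_fin f F0 : (forall x, x \notin F0 -> f x = 0) ->
  csum [set: X] f = \sum_(x <- F0) f x.
Proof.
move=> h; apply: csum_unique; first exact: abs_summable_fin h.
move=> e e0; exists F0 => F sub.
by rewrite (sum_fset_supp h sub) subrr normc0 ltW.
Qed.

Lemma csum_conj f : abs_summable f ->
  csum [set: X] (fun x => conjc (f x)) = conjc (csum [set: X] f).
Proof.
move=> sf; apply: csum_unique.
  by case: sf => M h; exists M => F; under eq_bigr do rewrite normc_conjc.
move=> e e0; have [F0 h] := csum_approx sf e0; exists F0 => F /h {}h.
by rewrite -rmorph_sum -rmorphB normc_conjc.
Qed.

Lemma csum_mkcond (D : set X) f :
  csum D f = csum [set: X] (fun x => if x \in D then f x else 0).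
Proof.
rewrite /csum /rsum; congr (_ +i* _); congr (fine _ - fine _);
  rewrite esum_mkcond; apply: eq_esum => x _;
  by case: ifP => //= _; rewrite ?oppr0 maxxx.
Qed.

End UnorderedSums.

Lemma ler_mul_div1 (R : realFieldType) (a x e : R) : 0 <= a -> 0 <= x ->
  x <= e / (a + 1) -> a * x <= e.
Proof.
by move=> a0 x0; rewrite ler_pdivlMr => [|]; lra.
Qed.

(** * Convexity of powers *)

Section PowerInequalities.
Variable R : realType.
Implicit Types r s t : R.

(* The tangent of the convex function t^r at s; this is Young's inequality. *)
Lemma powR_tangent r s t : 1 <= r -> 0 <= s -> 0 <= t ->
  r * s `^ (r - 1) * t <= t `^ r + (r - 1) * s `^ r.
Proof.
rewrite le_eqVlt => /orP[/eqP <-|r1] s0 t0.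
  by rewrite subrr powRr0 powRr1 // mul0r addr0 !mul1r.
have q0 : 0 < r / (r - 1) by rewrite divr_gt0 //; lra.
have := @conjugate_powR R t (s `^ (r - 1)) r (r / (r - 1)) t0 (powR_ge0 _ _).
have -> : r^-1 + (r / (r - 1))^-1 = 1 by field; rewrite !gt_eqF; lra.
move=> /(_ ltac:(lra) q0 erefl).
rewrite -powRrM (_ : (r - 1) * (r / (r - 1)) = r); last first.
  by field; rewrite gt_eqF; lra.
have r0 : 0 < r by lra.
rewrite -(ler_pM2l r0) => h.
have -> : r * s `^ (r - 1) * t = r * (t * s `^ (r - 1)) by ring.
apply: (le_trans h); leq_eq.
by field; rewrite !gt_eqF; lra.
Qed.

(** Jensen's inequality for weights that are not normalised. With two weights it yields Minkowski's
    inequality, with the row of a kernel one half of the Schur test. *)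
Lemma jensen_powR (I : Type) (F : seq I) r (C : R) (a t : I -> R) : 1 <= r ->
  (forall i, 0 <= a i) -> (forall i, 0 <= t i) -> \sum_(i <- F) a i <= C ->
  (\sum_(i <- F) a i * t i) `^ r <= C `^ (r - 1) * \sum_(i <- F) a i * t i `^ r.
Proof.
move=> r1 a0 t0 hC; set A := \sum_(i <- F) a i in hC *.
have A0 : 0 <= A by apply: sumr_ge0.
set B := \sum_(i <- F) a i * t i; set D := \sum_(i <- F) _ * _ `^ _.
have D0 : 0 <= D by apply: sumr_ge0 => i _; rewrite mulr_ge0 ?powR_ge0.
suff : B `^ r <= A `^ (r - 1) * D.
  move=> /le_trans; apply; apply: ler_wpM2r => //.
  by apply: ge0_ler_powR; rewrite ?nnegrE //; lra.
have B0 : 0 <= B by apply: sumr_ge0 => i _; rewrite mulr_ge0.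
move: A0; rewrite le_eqVlt => /orP[/eqP A0|A0].
  have -> : B = 0.
    rewrite /B; have : \sum_(i <- F) a i = 0 by rewrite -[LHS]/A -A0.
    elim: F {A hC B D D0 B0 A0} => [|i F IH]; rewrite ?big_nil // !big_cons.
    move=> /eqP; rewrite paddr_eq0 ?sumr_ge0 // => /andP[/eqP -> /eqP /IH ->].
    by rewrite mul0r addr0.
  rewrite powR0; first by rewrite mulr_ge0 ?powR_ge0.
  by rewrite gt_eqF; lra.
(* [s] is the weighted mean. Summing the tangent inequality at [s] against the weights and using
   [B = s * A] leaves s^r A <= D. *)
set s := B / A; have s0 : 0 <= s by rewrite divr_ge0 // ltW.
have BsA : B = s * A by rewrite /s divfK // gt_eqF.
have : r * s `^ (r - 1) * B <= D + (r - 1) * s `^ r * A.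
  rewrite /B /D /A !mulr_sumr -big_split /=; apply: ler_sum => i _.
  have := ler_wpM2l (a0 i) (powR_tangent r1 s0 (t0 i)); lra.
have r0 : 0 < r by lra.
have sr : s `^ r = s * s `^ (r - 1) by rewrite mulr_powRB1.
rewrite BsA => h.
rewrite powRM ?(ltW A0) // -(mulr_powRB1 (ltW A0) r0).
rewrite [leLHS](_ : _ = A `^ (r - 1) * (s `^ r * A)); last by ring.
apply: ler_wpM2l; first exact: powR_ge0.
rewrite sr; move: h; rewrite sr; lra.
Qed.

Lemma ler_powR_inv r (a M : R) : 0 < r -> 0 <= a -> 0 <= M ->
  (a `^ r^-1 <= M) = (a <= M `^ r).
Proof.
move=> r0 a0 M0; apply/idP/idP => h.
  have /(_ (powR_ge0 _ _) M0 h) := @ge0_ler_powR R r (ltW r0) (a `^ r^-1) M.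
  by rewrite -powRrM mulVf ?gt_eqF // powRr1.
have ir0 : 0 <= r^-1 by rewrite invr_ge0 ltW.
have /(_ a0 (powR_ge0 _ _) h) := @ge0_ler_powR R r^-1 ir0 a (M `^ r).
by rewrite -powRrM mulfV ?gt_eqF // powRr1.
Qed.

End PowerInequalities.

Definition cscale (R : realType) (X : choiceType) (a : R[i]) (f : X -> R[i]) :
  X -> R[i] := fun x => a * f x.
Local Notation "a ** f" := (cscale a f) (at level 40, left associativity).

Definition restrict (R : realType) (X : choiceType) (F : {fset X})
  (f : X -> R[i]) : X -> R[i] := fun x => if x \in F then f x else 0.

Definition cvg_pt (R : realType) (X : choiceType) (u : nat -> X -> R[i])
    (f : X -> R[i]) :=
  forall x e, 0 < e -> exists N : nat, forall n, (N <= n)%N ->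
    normc (u n x - f x) <= e.

Lemma complete_real (R : realType) (v : nat -> R) :
  (forall e, 0 < e -> exists N : nat, forall n k, (N <= n)%N -> (N <= k)%N ->
     `|v n - v k| <= e) ->
  exists l, forall e, 0 < e -> exists N : nat, forall n, (N <= n)%N ->
     `|v n - l| <= e.
Proof.
move=> cv; have : cvg (v @ \oo).
  apply/cauchy_cvgP/cauchy_exP => e e0.
  have [N hN] := cv (e / 2) ltac:(lra); exists (v N); exists N => // n /= nN.
  rewrite -ball_normE /=; apply: le_lt_trans (hN N n (leqnn _) nN) _; lra.
move=> /cvg_ex[l /cvgrPdist_le hl]; exists l => e e0.
have [N _ hN] := hl _ e0; exists N => n nN; rewrite distrC; exact: hN.
Qed.

Lemma complete_complex (R : realType) (v : nat -> R[i]) :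
  (forall e, 0 < e -> exists N : nat, forall n k, (N <= n)%N -> (N <= k)%N ->
     normc (v n - v k) <= e) ->
  exists l, forall e, 0 < e -> exists N : nat, forall n, (N <= n)%N ->
     normc (v n - l) <= e.
Proof.
move=> cv.
have [] := @complete_real R (fun n => complex.Re (v n)).
  move=> e /cv[N hN]; exists N => n k nN kN; rewrite -cReN -cReD.
  by apply: le_trans (normc_ge_abs_Re _) _; exact: hN.
move=> a ha; have [] := @complete_real R (fun n => complex.Im (v n)).
  move=> e /cv[N hN]; exists N => n k nN kN; rewrite -cImN -cImD.
  by apply: le_trans (normc_ge_abs_Im _) _; exact: hN.
move=> b hb; exists (a +i* b) => e e0.
have [N1 h1] := ha (e / 2) ltac:(lra); have [N2 h2] := hb (e / 2) ltac:(lra).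
exists (maxn N1 N2) => n; rewrite geq_max => /andP[/h1 {}h1 /h2 {}h2].
apply: le_trans (normc_le_ReIm _) _; rewrite cReD cImD cReN cImN /=; lra.
Qed.

(* Sealed, so that failing unifications never unfold the underlying sums. *)
HB.lock Definition lpmem (R : realType) (X : choiceType) (m : X -> R)
  (p : \bar R) (f : X -> R[i]) : Prop := lp m p f.

HB.lock Definition nrm (R : realType) (X : choiceType) (m : X -> R)
  (p : \bar R) (f : X -> R[i]) : R := fine (lpnorm m p f).

(** * The spaces l^p: Minkowski, evaluation, Fatou, completeness *)

Section LpSpaces.
Variables (R : realType) (X : choiceType) (m : X -> R).
Hypothesis m_gt0 : forall x, 0 < m x.
Implicit Types (p : \bar R) (f g : X -> R[i]) (F : {fset X}).

(** The finite-sum form of a norm bound, with both sides raised to the power r so that no root of a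
    sum occurs. The [else] branch is meant for p = +oo; -oo is excluded by 1 <= p. *)
Definition lpbound p f (M : R) : Prop :=
  if p is r%:E then
    forall F, \sum_(x <- F) m x * normc (f x) `^ r <= M `^ r
  else forall x, normc (f x) <= M.

Lemma lpnorm_ge0 p f : (0 <= lpnorm m p f)%E.
Proof.
case: p => [r| |] /=; first exact: poweR_ge0.
  by apply: ereal_sup_ubound; left.
by apply: ereal_sup_ubound; left.
Qed.

Lemma lpnorm_leP p f M : (1 <= p)%E -> 0 <= M ->
  (lpnorm m p f <= M%:E)%E <-> lpbound p f M.
Proof.
case: p => [r| |] //=; rewrite ?lee_fin => r1 M0; last first.
  split=> [h x|h].
    by rewrite -lee_fin; apply: le_trans h; apply: ereal_sup_ubound; right; exists x.
  by apply: ge_ereal_sup => _ [->|[x _ <-]]; rewrite lee_fin.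
have r0 : 0 < r by lra.
have g0 x : 0 <= m x * normc (f x) `^ r by rewrite mulr_ge0 ?powR_ge0 // ltW.
rewrite -(esum_le_fsetP _ g0).
have : (0 <= \esum_(x in [set: X]) (m x * normc (f x) `^ r)%:E)%E.
  by apply: esum_ge0 => x _; rewrite lee_fin.
(* An infinite sum has an infinite root because [r^-1] is not 0, so both sides of the equivalence
   fail. *)
case: (\esum_(x in _) _)%E => [S| |] //= S0; last first.
  by rewrite leye_eq invr_eq0 gt_eqF // leye_eq.
by rewrite !lee_fin ler_powR_inv.
Qed.

Local Notation nrm := (nrm m).

Lemma lpmemE p f : lpmem m p f = lp m p f.
Proof. by rewrite lpmem.unlock. Qed.

Lemma nrmE p f : nrm p f = fine (lpnorm m p f).
Proof. by rewrite nrm.unlock. Qed.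

Lemma nrm_ge0 p f : 0 <= nrm p f.
Proof. rewrite nrmE; exact/fine_ge0/lpnorm_ge0. Qed.

Lemma lpE p f : lpmem m p f -> lpnorm m p f = (nrm p f)%:E.
Proof. rewrite lpmemE nrmE; by move=> h; rewrite fineK // ge0_fin_numE ?lpnorm_ge0. Qed.

Section FixedExponent.
Variable p : \bar R.
Hypothesis p1 : (1 <= p)%E.

Lemma lpbound_lp f M : 0 <= M -> lpbound p f M -> lpmem m p f /\ nrm p f <= M.
Proof.
move=> M0 /(lpnorm_leP _ p1 M0) h.
have lf : lpmem m p f by rewrite lpmemE; apply: le_lt_trans h _; exact: ltry.
by split => //; rewrite -lee_fin -lpE.
Qed.

Lemma lp_lpbound f M : lpmem m p f -> nrm p f <= M -> lpbound p f M.
Proof.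
move=> lf h; apply/(lpnorm_leP _ p1 (le_trans (nrm_ge0 _ _) h)).
by rewrite lpE // lee_fin.
Qed.

(** Minkowski by convexity: |f + g| <= a (|f| / a) + b (|g| / b), and Jensen with weights a and b
    leaves two sums of size at most a and b. Positivity of a and b is why the norm inequalities
    derived from it carry a slack. *)
Lemma lpboundD f g a b : 0 < a -> 0 < b -> lpbound p f a -> lpbound p g b ->
  lpbound p (f + g) (a + b).
Proof.
move: p1; case: p => [r| |] //=; rewrite ?lee_fin => r1 a0 b0 hf hg.
  have r0 : 0 < r by lra.
  move=> F; pose c x := a * (normc (f x) / a) `^ r + b * (normc (g x) / b) `^ r.
  have c_le x : normc ((f + g) x) `^ r <= (a + b) `^ (r - 1) * c x.
    have eA : a * (normc (f x) / a) = normc (f x) by rewrite mulrC divfK ?gt_eqF.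
    have eB : b * (normc (g x) / b) = normc (g x) by rewrite mulrC divfK ?gt_eqF.
    have /= := @jensen_powR R bool [:: true; false] r (a + b)
      (fun i => if i then a else b)
      (fun i => if i then normc (f x) / a else normc (g x) / b) r1.
    rewrite !big_cons !big_nil /= !addr0; move=> h.
    apply: le_trans (h _ _ _); last 3 first.
    - by case; rewrite ltW.
    - by case; rewrite divr_ge0 ?normc_ge0 // ltW.
    - exact: lexx.
    apply: ge0_ler_powR; rewrite ?nnegrE ?normc_ge0 ?(ltW r0) //.
      by rewrite eA eB addr_ge0 ?normc_ge0.
    by rewrite eA eB; exact: ler_normcD.
  have scal h d : 0 < d -> lpbound r%:E h d ->
      \sum_(x <- F) m x * (d * (normc (h x) / d) `^ r) <= d.
    move=> d0 /(_ F) hh.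
    have dr : d^-1 `^ r = (d `^ r)^-1.
      by rewrite -[d^-1]powR_inv1 ?(ltW d0) // -powRrM mulN1r powRN.
    have -> : \sum_(x <- F) m x * (d * (normc (h x) / d) `^ r)
        = d * (d `^ r)^-1 * \sum_(x <- F) m x * normc (h x) `^ r.
      rewrite mulr_sumr; apply: eq_bigr => x _.
      rewrite powRM ?normc_ge0 ?invr_ge0 ?(ltW d0) //.
      by rewrite dr; ring.
    apply: le_trans (ler_wpM2l _ hh) _.
      by rewrite mulr_ge0 ?invr_ge0 ?powR_ge0 // ltW.
    by rewrite divfK // gt_eqF // powR_gt0.
  apply: (@le_trans _ _ ((a + b) `^ (r - 1) * \sum_(x <- F) m x * c x)).
    rewrite mulr_sumr; apply: ler_sum => x _.
    have := ler_wpM2l (ltW (m_gt0 x)) (c_le x); lra.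
  rewrite -(mulr_powRB1 (addr_ge0 (ltW a0) (ltW b0)) r0) mulrC.
  apply: ler_wpM2r; first exact: powR_ge0.
  under eq_bigr do rewrite mulrDr.
  by rewrite big_split /=; apply: lerD; apply: scal.
by move=> x; apply: le_trans (ler_normcD _ _) _; exact: lerD.
Qed.

Lemma lpD f g : lpmem m p f -> lpmem m p g -> lpmem m p (f + g).
Proof.
move=> lf lg.
have f0 : 0 < nrm p f + 1 by have := nrm_ge0 p f; lra.
have g0 : 0 < nrm p g + 1 by have := nrm_ge0 p g; lra.
have bf : lpbound p f (nrm p f + 1) by apply: lp_lpbound => //; lra.
have bg : lpbound p g (nrm p g + 1) by apply: lp_lpbound => //; lra.
by case: (lpbound_lp (ltW (addr_gt0 f0 g0)) (lpboundD f0 g0 bf bg)).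
Qed.

Lemma nrmD f g : lpmem m p f -> lpmem m p g -> nrm p (f + g) <= nrm p f + nrm p g.
Proof.
move=> lf lg; apply/ler_addgt0Pr => e e0.
have f0 : 0 < nrm p f + e / 2 by have := nrm_ge0 p f; lra.
have g0 : 0 < nrm p g + e / 2 by have := nrm_ge0 p g; lra.
have bf : lpbound p f (nrm p f + e / 2) by apply: lp_lpbound => //; lra.
have bg : lpbound p g (nrm p g + e / 2) by apply: lp_lpbound => //; lra.
have [_] := lpbound_lp (ltW (addr_gt0 f0 g0)) (lpboundD f0 g0 bf bg); lra.
Qed.

Lemma lpboundZ a f M : 0 <= M -> lpbound p f M -> lpbound p (a ** f) (normc a * M).
Proof.
move: p1; case: p => [r| |] //=; rewrite ?lee_fin => r1 M0 hf.
  move=> F; rewrite powRM ?normc_ge0 //.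
  have -> : \sum_(x <- F) m x * normc ((a ** f) x) `^ r
      = normc a `^ r * \sum_(x <- F) m x * normc (f x) `^ r.
    rewrite mulr_sumr; apply: eq_bigr => x _.
    by rewrite /cscale normcM powRM ?normc_ge0 //; ring.
  by apply: ler_wpM2l => //; exact: powR_ge0.
by move=> x; rewrite /cscale normcM ler_wpM2l ?normc_ge0.
Qed.

Lemma lpZ a f : lpmem m p f -> lpmem m p (a ** f).
Proof.
move=> lf; have b := lpboundZ a (nrm_ge0 p f) (lp_lpbound lf (lexx _)).
by case: (lpbound_lp (mulr_ge0 (normc_ge0 a) (nrm_ge0 p f)) b).
Qed.

Lemma nrmZ_le a f : lpmem m p f -> nrm p (a ** f) <= normc a * nrm p f.
Proof.
move=> lf; have b := lpboundZ a (nrm_ge0 p f) (lp_lpbound lf (lexx _)).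
by case: (lpbound_lp (mulr_ge0 (normc_ge0 a) (nrm_ge0 p f)) b).
Qed.

Lemma lpbound0 M : 0 <= M -> lpbound p 0 M.
Proof.
have n0 x : normc ((0 : X -> R[i]) x) = 0 by exact: normc0.
move: p1; case: p => [r| |] //=; rewrite ?lee_fin => r1 M0; [move=> F|move=> x].
  rewrite big1 ?powR_ge0 // => x _; rewrite n0 powR0 ?mulr0 //.
  by rewrite gt_eqF //; lra.
by rewrite n0.
Qed.

Lemma lp0 : lpmem m p 0.
Proof. by case: (lpbound_lp (lexx 0) (lpbound0 (lexx 0))). Qed.

Lemma nrm0 : nrm p 0 = 0.
Proof.
apply/eqP; rewrite eq_le nrm_ge0 andbT.
by case: (lpbound_lp (lexx 0) (lpbound0 (lexx 0))).
Qed.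

Lemma cscaleN1 f : (-1) ** f = - f.
Proof. by apply/funext => x; rewrite /cscale mulN1r. Qed.

Lemma lpN f : lpmem m p f -> lpmem m p (- f).
Proof. by rewrite -cscaleN1; exact: lpZ. Qed.

Lemma nrmN f : nrm p (- f) = nrm p f.
Proof.
rewrite !nrmE; congr fine; move: p1; case: p => [r| |] //= _.
  by congr (_ `^ _)%E; apply: eq_esum => x _; rewrite normcN.
rewrite (_ : (fun x => (normc ((- f) x))%:E) = (fun x => (normc (f x))%:E)) //.
by apply/funext => x; rewrite normcN.
Qed.

Lemma lpB f g : lpmem m p f -> lpmem m p g -> lpmem m p (f - g).
Proof. by move=> lf lg; apply: lpD => //; exact: lpN. Qed.

Lemma nrmB f g : lpmem m p f -> lpmem m p g -> nrm p (f - g) <= nrm p f + nrm p g.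
Proof. by move=> lf lg; rewrite -(nrmN g); apply: nrmD => //; exact: lpN. Qed.

Lemma nrm_sub_sym f g : nrm p (f - g) = nrm p (g - f).
Proof. by rewrite -nrmN opprB. Qed.

Lemma lp_sum (I : Type) (s : seq I) (u : I -> X -> R[i]) :
  (forall i, lpmem m p (u i)) -> lpmem m p (\sum_(i <- s) u i).
Proof.
by move=> h; elim/big_ind : _ => //; [exact: lp0|exact: lpD].
Qed.

Lemma nrm_sum (I : Type) (s : seq I) (u : I -> X -> R[i]) :
  (forall i, lpmem m p (u i)) -> nrm p (\sum_(i <- s) u i) <= \sum_(i <- s) nrm p (u i).
Proof.
move=> h; elim: s => [|i s IH]; first by rewrite !big_nil nrm0.
rewrite !big_cons; apply: le_trans (nrmD _ _) _ => //; first exact: lp_sum.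
by rewrite lerD2l.
Qed.

(** A bound for the functional f -> f x on l^p, read off from the single term at x. It turns norm
    convergence into pointwise convergence. *)
Definition evalc (x : X) : R := if p is r%:E then (m x)^-1 `^ r^-1 else 1.

Lemma evalc_ge0 x : 0 <= evalc x.
Proof. by rewrite /evalc; case: p => // r; exact: powR_ge0. Qed.

Lemma nrm_eval f x : lpmem m p f -> normc (f x) <= evalc x * nrm p f.
Proof.
move=> lf; have := lp_lpbound lf (lexx _); have := nrm_ge0 p f.
rewrite /evalc; move: (nrm p f) => M.
move: p1; case: p => [r| |] //=; rewrite ?lee_fin => r1 M0 hf; last by rewrite mul1r.
have r0 : 0 < r by lra.
have := hf [fset x]%fset; rewrite big_seq_fset1 => h.
have mi : 0 <= (m x)^-1 by rewrite invr_ge0 ltW.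
have <- : (normc (f x) `^ r) `^ r^-1 = normc (f x).
  by rewrite -powRrM mulfV ?gt_eqF // powRr1 // normc_ge0.
rewrite ler_powR_inv ?powR_ge0 ?mulr_ge0 ?powR_ge0 // powRM ?powR_ge0 //.
rewrite -powRrM mulVf ?gt_eqF // powRr1 //.
by rewrite -(ler_pM2l (m_gt0 x)) mulrA mulfV ?gt_eqF // mul1r.
Qed.

Lemma nrm_eq0 f : lpmem m p f -> nrm p f = 0 -> f = 0.
Proof.
move=> lf f0; apply/funext => x; apply/eqP; rewrite -normc_eq0 eq_le normc_ge0.
by rewrite andbT; apply: le_trans (nrm_eval x lf) _; rewrite f0 mulr0.
Qed.

Lemma restrictE F f : restrict F f = \sum_(y <- F) f y ** ind1 R y.
Proof.
apply/funext => x; rewrite fct_sumE /restrict /cscale /ind1.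
case: ifPn => xF.
  rewrite (big_fsetD1 x) //= eqxx mulr1 big_seq big1 ?addr0 // => y.
  by rewrite !inE => /andP[/negbTE yx _]; rewrite eq_sym yx mulr0.
rewrite big_seq big1 // => y yF; rewrite (_ : (x == y) = false) ?mulr0 //.
by apply/negP => /eqP xy; move: xF; rewrite xy yF.
Qed.

Lemma ind1_lp x : lpmem m p (ind1 R x).
Proof.
apply: (proj1 (@lpbound_lp _ (if p is r%:E then (m x) `^ r^-1 else 1) _ _)).
  by case: p => // r; exact: powR_ge0.
rewrite /ind1; move: p1; case: p => [r| |] //=; rewrite ?lee_fin => r1; [move=> F|move=> y]; last first.
  by case: (y == x); rewrite ?normc1 // normc0.
have r0 : 0 < r by lra.
rewrite -powRrM mulVf ?gt_eqF // powRr1 ?(ltW (m_gt0 _)) //.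
have z y : y != x -> normc ((y == x)%:R : R[i]) `^ r = 0.
  by move=> /negbTE ->; rewrite normc0 powR0 // gt_eqF.
have [xF|xF] := boolP (x \in F).
  rewrite (big_fsetD1 x) //= eqxx normc1 powR1 mulr1 big_seq big1 ?addr0 // => y.
  by rewrite !inE => /andP[yx _]; rewrite z // mulr0.
rewrite big_seq big1 ?(ltW (m_gt0 x)) // => y yF; rewrite z ?mulr0 //.
by apply/negP => /eqP xy; move: xF; rewrite -xy yF.
Qed.

Lemma restrict_lp F f : lpmem m p (restrict F f).
Proof. by rewrite restrictE; apply: lp_sum => y; apply: lpZ; exact: ind1_lp. Qed.

Lemma finsupp_restrict f : finsupp_fun f ->
  exists F, f = restrict F f /\ (forall x, x \notin F -> f x = 0).
Proof.
move=> fin; exists (fset_set [set x | f x != 0]).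
have h x : x \notin fset_set [set x | f x != 0] -> f x = 0.
  by rewrite in_fset_set // notin_setE /= => /negP/negPn/eqP.
by split => //; apply/funext => x; rewrite /restrict; case: ifPn => // /h.
Qed.

Lemma restrict_finsupp F f : finsupp_fun (restrict F f).
Proof.
apply: (@sub_finite_set _ _ [set` F]); last exact: finite_fset.
by move=> x /=; rewrite /restrict; case: ifP => //; rewrite eqxx.
Qed.

Lemma finsupp_lp f : finsupp_fun f -> lpmem m p f.
Proof. by move=> /finsupp_restrict[F [-> _]]; exact: restrict_lp. Qed.

Lemma lpbound_restrict f M : 0 <= M ->
  (forall F, lpbound p (restrict F f) M) -> lpbound p f M.
Proof.
move=> M0; move: p1; case: p => [r| |] //=; rewrite ?lee_fin => r1 h; [move=> F|move=> x].
  apply: le_trans (h F F); rewrite big_seq [leRHS]big_seq.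
  by apply: ler_sum => x xF; rewrite /restrict xF.
by apply: le_trans (h [fset x]%fset x); rewrite /restrict !inE eqxx.
Qed.

Lemma restrict_lpbound F f M : 0 <= M -> lpbound p f M ->
  lpbound p (restrict F f) M.
Proof.
move=> M0; move: p1; case: p => [r| |] //=; rewrite ?lee_fin => r1 h; [move=> F'|move=> x].
  apply: le_trans (h F'); apply: ler_sum => x _; rewrite /restrict.
  case: ifP => // _; rewrite normc0 powR0 ?mulr0; last by rewrite gt_eqF //; lra.
  by rewrite mulr_ge0 ?powR_ge0 // ltW.
by rewrite /restrict; case: ifP => // _; rewrite normc0.
Qed.

Lemma nrm_restrict F f : lpmem m p f -> nrm p (restrict F f) <= nrm p f.
Proof.
move=> lf; apply: (proj2 (lpbound_lp (nrm_ge0 _ _) _)).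
by apply: restrict_lpbound; [exact: nrm_ge0|exact: lp_lpbound].
Qed.

(** On a finite set pointwise convergence is norm convergence, and a norm bound is tested on finite
    sets. The same argument covers p = +oo. Besides completeness, it carries l^p bounds along limits
    that are known only in l^2 or pointwise. *)
Lemma lp_fatou u f (M : R) : cvg_pt u f -> (forall n, lpmem m p (u n)) ->
  (exists N, forall n, (N <= n)%N -> nrm p (u n) <= M) ->
  lpmem m p f /\ nrm p f <= M.
Proof.
move=> hu lu [N hM].
have M0 : 0 <= M by apply: le_trans (hM N (leqnn _)); exact: nrm_ge0.
apply: lpbound_lp => //; apply: lpbound_restrict => // F.
apply: lp_lpbound; first exact: restrict_lp.
apply/ler_addgt0Pr => e e0.
(* If [u n] and [f] differ by at most e / (c + 1) at each point of F, their restrictions to F differ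
   by at most e in norm. *)
pose c := \sum_(y <- F) nrm p (ind1 R y).
have c0 : 0 <= c by apply: sumr_ge0 => y _; exact: nrm_ge0.
have ec : 0 < e / (c + 1) by rewrite divr_gt0 //; lra.
have [N' hN'] : exists N' : nat, forall n, (N' <= n)%N -> forall x, x \in F ->
    normc (u n x - f x) <= e / (c + 1).
  suff : forall s : seq X, exists N' : nat, forall n, (N' <= n)%N ->
    forall x, x \in s -> normc (u n x - f x) <= e / (c + 1) by apply.
  elim=> [|y s [N1 h1]]; first by exists 0.
  have [N2 h2] := hu y _ ec; exists (maxn N1 N2) => n.
  rewrite geq_max => /andP[n1 n2] x; rewrite inE => /orP[/eqP ->|xs].
    exact: h2.
  exact: h1.
pose n := maxn N N'.
have -> : restrict F f = restrict F (u n) - restrict F (u n - f).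
  apply/funext => x; rewrite /restrict !fctE; case: ifP => _; last by rewrite subr0.
  by rewrite opprB addrC subrK.
apply: le_trans (nrmB (restrict_lp _ _) (restrict_lp _ _)) _.
apply: lerD.
  by apply: le_trans (nrm_restrict F (lu n)) _; apply: hM; rewrite leq_maxl.
rewrite restrictE.
apply: le_trans (nrm_sum _ _) _; first by move=> y; apply: lpZ; exact: ind1_lp.
apply: (@le_trans _ _ (\sum_(y <- F) e / (c + 1) * nrm p (ind1 R y))).
  rewrite big_seq [leRHS]big_seq; apply: ler_sum => y yF.
  apply: le_trans (nrmZ_le _ (ind1_lp y)) _.
  by apply: ler_wpM2r; [exact: nrm_ge0|apply: hN' => //; rewrite leq_maxr].
rewrite -mulr_sumr -/c -mulrA ler_piMr ?(ltW e0) // mulrC ler_pdivrMr; lra.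
Qed.

(** Density of finitely supported functions. It fails for p = +oo, which is why that exponent is
    treated by duality. *)
Lemma lp_tail f : (p < +oo)%E -> lpmem m p f -> forall e, 0 < e ->
  exists F0 : {fset X}, forall F, (F0 `<=` F)%fset -> nrm p (f - restrict F f) <= e.
Proof.
move=> py lf e e0; have := lp_lpbound lf (lexx _).
suff : forall M, lpbound p f M -> exists F0 : {fset X}, forall F,
    (F0 `<=` F)%fset -> lpbound p (f - restrict F f) e.
  move=> h /h [F0 h0]; exists F0 => F /h0.
  by case/(lpbound_lp (ltW e0)).
move: p1 py; case: p => [r| |] //=; rewrite ?lee_fin => r1 _ M hM.
pose a x := m x * normc (f x) `^ r.
have a0 x : 0 <= a x by rewrite mulr_ge0 ?powR_ge0 // ltW.
have er : 0 < e `^ r / 2 by rewrite divr_gt0 // powR_gt0.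
have [F0 h0] := esum_fin_approx a0 (ex_intro _ _ hM) er.
exists F0 => F sub F'.
have := h0 _ sub; have := h0 (F `|` F')%fset (fsubset_trans sub (fsubsetUl _ _)).
(* The tail over F' is a difference of the partial sums over F union F' and over F, both within half
   of e^r of the total. *)
have -> : \sum_(x <- F') m x * normc ((f - restrict F f) x) `^ r
    = \sum_(x <- [fset x in (F `|` F')%fset | x \notin F]%fset) a x.
  rewrite (big_fsetID _ (fun x => x \in F)) /= big_seq big1 ?add0r; last first.
    move=> x; rewrite !inE /= => /andP[_ xF].
    rewrite /restrict !fctE xF subrr normc0 powR0 ?mulr0 // gt_eqF //; lra.
  have -> : [fset x in F' | x \notin F]%fset
      = [fset x in (F `|` F')%fset | x \notin F]%fset.
    by apply/fsetP => x; rewrite !inE; case: (x \in F) => //=; rewrite andbF.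
  rewrite big_seq [RHS]big_seq; apply: eq_bigr => x.
  by rewrite !inE /= => /andP[_ /negbTE xF]; rewrite /restrict !fctE xF subr0.
rewrite (big_fsetID _ (fun x => x \in F) (F `|` F')%fset) /=.
have -> : [fset x in (F `|` F')%fset | x \in F]%fset = F.
  by apply/fsetP => x; rewrite !inE; case: (x \in F) => //=; rewrite andbF.
rewrite !ler_norml; lra.
Qed.

Definition cvg_lp (u : nat -> X -> R[i]) f := forall e, 0 < e ->
  exists N : nat, forall n, (N <= n)%N -> nrm p (u n - f) <= e.

Definition cauchy_lp (u : nat -> X -> R[i]) := forall e, 0 < e ->
  exists N : nat, forall n k, (N <= n)%N -> (N <= k)%N -> nrm p (u n - u k) <= e.

Lemma cvg_lp_pt u f : (forall n, lpmem m p (u n)) -> lpmem m p f -> cvg_lp u f ->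
  cvg_pt u f.
Proof.
move=> lu lf h x e e0; have c0 : 0 < evalc x + 1 by have := evalc_ge0 x; lra.
have [N hN] := h _ (divr_gt0 e0 c0); exists N => n /hN hn.
apply: le_trans (nrm_eval x (lpB (lu n) lf)) _.
by apply: ler_mul_div1; rewrite ?evalc_ge0 ?nrm_ge0.
Qed.

(** The candidate is the pointwise limit, which exists by [nrm_eval]. Fatou applied to k -> u n - u
    k then gives membership and convergence together. *)
Lemma complete_lp u : (forall n, lpmem m p (u n)) -> cauchy_lp u ->
  exists2 f, lpmem m p f & cvg_lp u f.
Proof.
move=> lu cu.
have /choice[f hf] : forall x, exists l : R[i], forall e, 0 < e ->
    exists N : nat, forall n, (N <= n)%N -> normc (u n x - l) <= e.
  move=> x; apply: complete_complex => e e0.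
  have c0 : 0 < evalc x + 1 by have := evalc_ge0 x; lra.
  have [N hN] := cu _ (divr_gt0 e0 c0); exists N => n k /hN hn /hn {}hn.
  apply: le_trans (nrm_eval x (lpB (lu n) (lu k))) _.
  by apply: ler_mul_div1; rewrite ?evalc_ge0 ?nrm_ge0.
have key e : 0 < e -> exists N : nat, forall n, (N <= n)%N ->
    lpmem m p (u n - f) /\ nrm p (u n - f) <= e.
  move=> e0; have [N hN] := cu _ e0; exists N => n nN.
  apply: (@lp_fatou (fun k => u n - u k)).
  - move=> x e1 e10; have [N1 h1] := hf x _ e10; exists N1 => k /h1.
    rewrite !fctE; have -> : u n x - u k x - (u n x - f x) = - (u k x - f x) by ring.
    by rewrite normcN.
  - by move=> k; exact: lpB.
  - by exists N => k kN; apply: hN.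
exists f.
  have [N hN] := key 1 ltr01; have [l1 _] := hN N (leqnn _).
  by have := lpB (lu N) l1; rewrite opprB addrC subrK.
by move=> e e0; have [N hN] := key e e0; exists N => n /hN[].
Qed.

End FixedExponent.
End LpSpaces.

(** * The pairing and the Hilbert space l^2 *)

HB.lock Definition ip (R : realType) (X : choiceType) (m : X -> R)
  (f g : X -> R[i]) : R[i] := pairing m f g.

Section Pairing.
Variables (R : realType) (X : choiceType) (m : X -> R).
Hypothesis m_gt0 : forall x, 0 < m x.
Implicit Types (f g h u v : X -> R[i]) (a : R[i]).

Local Notation ip := (ip m).

Lemma ipE f g : ip f g = pairing m f g.
Proof. by rewrite ip.unlock. Qed.

(** Absolute convergence of the pairing, kept apart from l^2 because it also serves l^1 against
    l^oo. *)
Definition pairable f g := has_bounded_sums (fun x => m x * (normc (f x) * normc (g x))).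

Lemma pairable_sum f g : pairable f g ->
  abs_summable (fun x => (m x)%:C * f x * conjc (g x)).
Proof.
apply: ler_has_bounded_sums => x.
by rewrite !normcM normc_conjc normcR gtr0_norm // mulrA.
Qed.

Lemma pairable_sym f g : pairable f g -> pairable g f.
Proof. by apply: ler_has_bounded_sums => x; rewrite (mulrC (normc (f x))). Qed.

Lemma pairing_sym f g : pairable f g -> ip g f = conjc (ip f g).
Proof.
move=> /pairable_sum s; rewrite ?ipE /pairing -csum_conj //; congr csum.
by apply/funext => x; rewrite !conjc_mul conjcK conjc_real; ring.
Qed.

Lemma pairing_linl a f1 f2 g : pairable f1 g -> pairable f2 g ->
  ip (a ** f1 + f2) g = a * ip f1 g + ip f2 g.
Proof.
move=> /pairable_sum s1 /pairable_sum s2; rewrite !ipE /pairing -csum_linear //; congr csum.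
by apply/funext => x; rewrite /cscale !fctE; ring.
Qed.

Lemma normc_pairing_le f g M : (forall F : {fset X},
    \sum_(x <- F) m x * (normc (f x) * normc (g x)) <= M) -> normc (ip f g) <= M.
Proof.
move=> h; rewrite ipE; apply: normc_csum_le => F; apply: le_trans (h F); apply: ler_sum => x _.
by rewrite !normcM normc_conjc normcR gtr0_norm // mulrA.
Qed.

Lemma ind1_ne (x y : X) : y \notin [fset x]%fset -> ind1 R x y = 0.
Proof. by rewrite inE /ind1 => /negbTE ->. Qed.

Lemma pairing_ind1 f x : ip f (ind1 R x) = (m x)%:C * f x.
Proof.
rewrite ?ipE /pairing (@csum_fin _ _ _ [fset x]%fset).
  by rewrite big_seq_fset1 /ind1 eqxx conjc1 mulr1.
by move=> y /ind1_ne ->; rewrite conjc0 mulr0.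
Qed.

Lemma pairing_ind1l f x : ip (ind1 R x) f = (m x)%:C * conjc (f x).
Proof.
rewrite ?ipE /pairing (@csum_fin _ _ _ [fset x]%fset).
  by rewrite big_seq_fset1 /ind1 eqxx mulr1.
by move=> y /ind1_ne ->; rewrite mulr0 mul0r.
Qed.

Lemma pairable1y f g : lpmem m 1%E f -> lpmem m +oo%E g ->
  forall F : {fset X}, \sum_(x <- F) m x * (normc (f x) * normc (g x))
    <= nrm m 1%E f * nrm m +oo%E g.
Proof.
move=> lf lg F.
have bf := lp_lpbound m_gt0 (lexx 1%E) lf (lexx _).
have bg := lp_lpbound m_gt0 (leey 1%E) lg (lexx _).
apply: (@le_trans _ _ (\sum_(x <- F) m x * normc (f x) `^ 1 * nrm m +oo%E g)).
  apply: ler_sum => x _; rewrite powRr1 ?normc_ge0 // mulrA.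
  by rewrite ler_wpM2l // mulr_ge0 ?normc_ge0 // ltW.
rewrite -mulr_suml; apply: ler_wpM2r; first exact: nrm_ge0.
by apply: le_trans (bf F) _; rewrite powRr1 // nrm_ge0.
Qed.

Local Notation L2 := (lpmem m 2%:E).
Local Notation N := (nrm m 2%:E).

Lemma le12 : (1 <= 2%:E :> \bar R)%E.
Proof. by rewrite lee_fin; lra. Qed.
Local Hint Resolve le12 : core.

Lemma l2_sum_le f (F : {fset X}) : L2 f ->
  \sum_(x <- F) m x * normc (f x) ^+ 2 <= N f ^+ 2.
Proof.
move=> lf; have := lp_lpbound m_gt0 le12 lf (lexx _) F.
rewrite -[X in _ <= X -> _]/(N f `^ 2%:R) powR_mulrn ?nrm_ge0 //.
by under eq_bigr => x _ do rewrite -[_ `^ _]/(normc (f x) `^ 2%:R) powR_mulrn ?normc_ge0 //.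
Qed.

Lemma l2_intro f M : 0 <= M ->
  (forall F : {fset X}, \sum_(x <- F) m x * normc (f x) ^+ 2 <= M ^+ 2) ->
  L2 f /\ N f <= M.
Proof.
move=> M0 h; apply: lpbound_lp => // F.
rewrite -[leRHS]/(M `^ 2%:R) powR_mulrn //.
by under eq_bigr => x _ do rewrite -[_ `^ _]/(normc (f x) `^ 2%:R) powR_mulrn ?normc_ge0 //.
Qed.

(** Cauchy-Schwarz from 2 |f| |g| <= (b / a) |f|^2 + (a / b) |g|^2 with a and b the two norms; the
    cases of norm 0 are removed first because of the quotients. *)
Lemma pairable22 f g : L2 f -> L2 g -> forall F : {fset X},
  \sum_(x <- F) m x * (normc (f x) * normc (g x)) <= N f * N g.
Proof.
move=> lf lg F.
have [f0|f0] := eqVneq (N f) 0.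
  rewrite f0 mul0r big1 // => x _; rewrite (nrm_eq0 m_gt0 le12 lf f0).
  by rewrite [normc _]normc0 mul0r mulr0.
have [g0|g0] := eqVneq (N g) 0.
  rewrite g0 mulr0 big1 // => x _; rewrite (nrm_eq0 m_gt0 le12 lg g0).
  by rewrite [X in _ * (_ * X)]normc0 !mulr0.
have a0 : 0 < N f by rewrite lt_def f0 nrm_ge0.
have b0 : 0 < N g by rewrite lt_def g0 nrm_ge0.
have := l2_sum_le F lf; have := l2_sum_le F lg.
move: (N f) (N g) a0 b0 => a b a0 b0 hg hf.
apply: (@le_trans _ _ (b / a / 2 * \sum_(x <- F) m x * normc (f x) ^+ 2
                     + a / b / 2 * \sum_(x <- F) m x * normc (g x) ^+ 2)).
  rewrite !mulr_sumr -big_split /=; apply: ler_sum => x _.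
  rewrite -subr_ge0.
  rewrite [leRHS](_ : _ = m x * (b * normc (f x) - a * normc (g x)) ^+ 2 / (2 * a * b)).
    apply: divr_ge0; first by rewrite mulr_ge0 ?sqr_ge0 // ltW.
    by rewrite ltW // !mulr_gt0.
  by field; rewrite !gt_eqF.
apply: (@le_trans _ _ (b / a / 2 * a ^+ 2 + a / b / 2 * b ^+ 2)).
  by apply: lerD; apply: ler_wpM2l => //; rewrite !divr_ge0 ?ltW.
by leq_eq; field; rewrite !gt_eqF.
Qed.

Lemma l2_pairable f g : L2 f -> L2 g -> pairable f g.
Proof. by move=> lf lg; exists (N f * N g); exact: pairable22. Qed.

Lemma ip_CS f g : L2 f -> L2 g -> normc (ip f g) <= N f * N g.
Proof. by move=> lf lg; apply: normc_pairing_le; exact: pairable22. Qed.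

Lemma ip_sym f g : L2 f -> L2 g -> ip g f = conjc (ip f g).
Proof. by move=> lf lg; apply: pairing_sym; exact: l2_pairable. Qed.

Lemma ip_linl a f g h : L2 f -> L2 g -> L2 h ->
  ip (a ** f + g) h = a * ip f h + ip g h.
Proof. by move=> lf lg lh; apply: pairing_linl; exact: l2_pairable. Qed.

Lemma ip_self f : L2 f -> ip f f = (N f ^+ 2)%:C.
Proof.
move=> lf; have g0 x : 0 <= m x * normc (f x) ^+ 2 by rewrite mulr_ge0 ?sqr_ge0 // ltW.
have fE : (fun x => (m x)%:C * f x * conjc (f x))
    = fun x => (m x * normc (f x) ^+ 2)%:C.
  by apply/funext => x; rewrite -mulrA mulc_conj -rmorphM.
rewrite ?ipE /pairing fE /csum /rsum /=.
have -> : \esum_(x in [set: X]) (Num.max (m x * normc (f x) ^+ 2) 0)%:E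
   = \esum_(x in [set: X]) (m x * normc (f x) ^+ 2)%:E.
  by apply: eq_esum => x _; rewrite max_l.
have -> : \esum_(x in [set: X]) (Num.max (- (m x * normc (f x) ^+ 2)) 0)%:E = 0%E.
  by apply: esum1 => x _; rewrite max_r // oppr_le0.
have -> : \esum_(x in [set: X]) (Num.max (0 : R) 0)%:E = 0%E.
  by apply: esum1 => x _; rewrite maxxx.
have -> : \esum_(x in [set: X]) (Num.max (- 0 : R) 0)%:E = 0%E.
  by apply: esum1 => x _; rewrite oppr0 maxxx.
rewrite /= !subr0; congr (_ +i* _).
rewrite nrmE /=.
have -> : \esum_(x in [set: X]) (m x * normc (f x) `^ 2)%:E
   = \esum_(x in [set: X]) (m x * normc (f x) ^+ 2)%:E.
  apply: eq_esum => x _.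
  by rewrite -[_ `^ _]/(normc (f x) `^ 2%:R) powR_mulrn ?normc_ge0.
have : (\esum_(x in [set: X]) (m x * normc (f x) ^+ 2)%:E <= (N f ^+ 2)%:E)%E.
  by apply/esum_le_fsetP => // F; exact: l2_sum_le.
have : (0 <= \esum_(x in [set: X]) (m x * normc (f x) ^+ 2)%:E)%E.
  by apply: esum_ge0 => x _; rewrite lee_fin.
case: (\esum_(x in _) _)%E => [s| |] //=; rewrite lee_fin => s0 _.
by rewrite powR12_sqrt // sqr_sqrtr.
Qed.

Lemma l2Z a f : L2 f -> L2 (a ** f). Proof. exact: lpZ. Qed.
Lemma l2D f g : L2 f -> L2 g -> L2 (f + g). Proof. exact: lpD. Qed.
Lemma l2N f : L2 f -> L2 (- f). Proof. exact: lpN. Qed.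
Lemma l2B f g : L2 f -> L2 g -> L2 (f - g). Proof. exact: lpB. Qed.
Lemma l20 : L2 0. Proof. exact: lp0. Qed.

Lemma cscale1 f : 1 ** f = f.
Proof. by apply/funext => x; rewrite /cscale mul1r. Qed.

Lemma ipDl f g h : L2 f -> L2 g -> L2 h -> ip (f + g) h = ip f h + ip g h.
Proof. by move=> lf lg lh; rewrite -{1}(cscale1 f) ip_linl // mul1r. Qed.

Lemma ip0l f : L2 f -> ip 0 f = 0.
Proof.
move=> lf; have := ipDl l20 l20 lf; rewrite addr0 => /eqP.
by rewrite eq_sym -subr_eq0 addrK => /eqP.
Qed.

Lemma ipZl a f g : L2 f -> L2 g -> ip (a ** f) g = a * ip f g.
Proof. by move=> lf lg; rewrite -[_ ** _]addr0 ip_linl ?ip0l ?addr0 //; exact: l20. Qed.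

Lemma ipNl f g : L2 f -> L2 g -> ip (- f) g = - ip f g.
Proof. by move=> lf lg; rewrite -cscaleN1 ipZl // mulN1r. Qed.

Lemma ipBl f g h : L2 f -> L2 g -> L2 h -> ip (f - g) h = ip f h - ip g h.
Proof. by move=> lf lg lh; rewrite ipDl ?ipNl //; exact: l2N. Qed.

Lemma ipDr f g h : L2 f -> L2 g -> L2 h -> ip h (f + g) = ip h f + ip h g.
Proof.
by move=> lf lg lh; rewrite ip_sym ?ipDl ?conjc_add -?ip_sym //; exact: l2D.
Qed.

Lemma ipZr a f g : L2 f -> L2 g -> ip g (a ** f) = conjc a * ip g f.
Proof.
by move=> lf lg; rewrite ip_sym ?ipZl ?conjc_mul -?ip_sym //; exact: l2Z.
Qed.

Lemma ipNr f g : L2 f -> L2 g -> ip g (- f) = - ip g f.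
Proof. by move=> lf lg; rewrite ip_sym ?ipNl ?conjc_opp -?ip_sym //; exact: l2N. Qed.

Lemma ipBr f g h : L2 f -> L2 g -> L2 h -> ip h (f - g) = ip h f - ip h g.
Proof. by move=> lf lg lh; rewrite ipDr ?ipNr //; exact: l2N. Qed.

Lemma ip_suml (I : Type) (s : seq I) (w : I -> X -> R[i]) f :
  (forall i, L2 (w i)) -> L2 f -> ip (\sum_(i <- s) w i) f = \sum_(i <- s) ip (w i) f.
Proof.
move=> lw lf; elim: s => [|i s IH]; first by rewrite !big_nil ip0l.
by rewrite !big_cons ipDl ?IH //; apply: lp_sum.
Qed.

Lemma ip_sumr (I : Type) (s : seq I) (w : I -> X -> R[i]) f :
  (forall i, L2 (w i)) -> L2 f -> ip f (\sum_(i <- s) w i) = \sum_(i <- s) ip f (w i).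
Proof.
move=> lw lf; rewrite ip_sym ?ip_suml ?conjc_sum //; last exact: lp_sum.
by apply: eq_bigr => i _; rewrite -ip_sym.
Qed.

Lemma nrm2_sqrD f g : L2 f -> L2 g ->
  N (f + g) ^+ 2 = N f ^+ 2 + N g ^+ 2 + 2 * complex.Re (ip f g).
Proof.
move=> lf lg; have := ip_self (l2D lf lg).
rewrite ipDl ?ipDr //; try exact: l2D.
rewrite (ip_sym lf lg) !ip_self // => /(congr1 (@complex.Re R)).
by rewrite !cReD cReJ /= => <-; ring.
Qed.

Lemma nrm2Z a f : L2 f -> N (a ** f) = normc a * N f.
Proof.
move=> lf; have := ip_self (l2Z a lf).
rewrite ipZl ?ipZr //; last exact: l2Z.
rewrite mulrA mulc_conj ip_self // -rmorphM /= => /complexI /eqP.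
by rewrite -exprMn eqrXn2 ?mulr_ge0 ?normc_ge0 ?nrm_ge0 // => /eqP.
Qed.

Lemma Re_ip_le f g : L2 f -> L2 g -> complex.Re (ip f g) <= N f * N g.
Proof.
move=> lf lg; apply: le_trans (ip_CS lf lg).
exact: le_trans (ler_norm _) (normc_ge_abs_Re _).
Qed.

Lemma nrm2_sqrB f g : L2 f -> L2 g ->
  N (f - g) ^+ 2 = N f ^+ 2 + N g ^+ 2 - 2 * complex.Re (ip f g).
Proof.
by move=> lf lg; rewrite nrm2_sqrD ?nrmN ?ipNr ?cReN //; [ring|exact: l2N].
Qed.

End Pairing.
Arguments le12 {R}.
#[global] Hint Resolve le12 : core.

Ltac fext := apply/funext => ?; rewrite /cscale ?fctE; ring.

Section CscaleTheory.
Variables (R : realType) (X : choiceType).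
Implicit Types (a b : R[i]) (f g : X -> R[i]).

Lemma cscaleDr a f g : a ** (f + g) = a ** f + a ** g.
Proof. by apply/funext => x; rewrite /cscale !fctE mulrDr. Qed.

Lemma cscaleDl a b f : (a + b) ** f = a ** f + b ** f.
Proof. by apply/funext => x; rewrite /cscale !fctE mulrDl. Qed.

Lemma cscaleA a b f : a ** (b ** f) = (a * b) ** f.
Proof. by apply/funext => x; rewrite /cscale mulrA. Qed.

Lemma cscaleNr a f : a ** (- f) = - (a ** f).
Proof. by apply/funext => x; rewrite /cscale !fctE mulrN. Qed.

Lemma cscaleNl a f : (- a) ** f = - (a ** f).
Proof. by apply/funext => x; rewrite /cscale !fctE mulNr. Qed.

Lemma cscaleBr a f g : a ** (f - g) = a ** f - a ** g.
Proof. by rewrite cscaleDr cscaleNr. Qed.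

Lemma cscaleBl a b f : (a - b) ** f = a ** f - b ** f.
Proof. by rewrite cscaleDl cscaleNl. Qed.

Lemma cscale0r a : a ** (0 : X -> R[i]) = 0.
Proof. by apply/funext => x; rewrite /cscale mulr0. Qed.

Lemma cscale_suml (I : Type) (s : seq I) a (u : I -> X -> R[i]) :
  a ** (\sum_(i <- s) u i) = \sum_(i <- s) a ** u i.
Proof.
elim: s => [|i s IH]; first by rewrite !big_nil cscale0r.
by rewrite !big_cons cscaleDr IH.
Qed.

End CscaleTheory.

Lemma inv_succ_small (R : realType) (e : R) : 0 < e ->
  exists K : nat, forall n, (K <= n)%N -> n.+1%:R^-1 <= e.
Proof.
move=> e0; exists (Num.bound e^-1) => n Kn.
rewrite invf_ple ?posrE //; apply: le_trans (_ : (Num.bound e^-1)%:R <= _).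
  by apply: ltW; apply: archi_boundP; rewrite invr_ge0 ltW.
by rewrite ler_nat; exact: leqW.
Qed.

Lemma geometric_small (R : realType) (q c e : R) : 0 <= q -> q < 1 -> 0 < e ->
  exists N : nat, forall n, (N <= n)%N -> c * q ^+ n <= e.
Proof.
move=> q0 q1 e0.
have : (fun n => c * q ^+ n) @ \oo --> c * 0.
  by apply: cvgMr; apply: cvg_expr; rewrite ger0_norm.
rewrite mulr0 => /cvgr0_norm_le /(_ _ e0)[N _ hN].
by exists N => n /hN; apply: le_trans; exact: ler_norm.
Qed.

(** * Resolvents of a graph in l^p and the Neumann series *)

Section Resolvents.
Variables (R : realType) (X : choiceType) (m : X -> R).
Hypothesis m_gt0 : forall x, 0 < m x.
Variable p : \bar R.
Hypothesis p1 : (1 <= p)%E.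
Implicit Types (f g h u v : X -> R[i]) (z : R[i]).
Local Notation L := (lpmem m p).
Local Notation N := (nrm m p).
Local Notation lpB := (lpB m_gt0 p1).
Local Notation lpD := (lpD m_gt0 p1).
Local Notation lpZ := (lpZ m_gt0 p1).

Lemma geometric_tail (u : nat -> X -> R[i]) (c q : R) : 0 <= q -> q < 1 ->
  (forall n, L (u n)) -> (forall n, N (u n.+1 - u n) <= c * q ^+ n) ->
  forall k n, (k <= n)%N -> N (u n - u k) <= c / (1 - q) * q ^+ k.
Proof.
move=> q0 q1 lu hu k n kn.
have c0 : 0 <= c by have := le_trans (nrm_ge0 _ _ _) (hu 0%N); rewrite mulr1.
have q1' : 0 < 1 - q by lra.
(* The exact partial geometric sum is what an induction on [j] reproduces; the stated bound drops
   its negative term. *)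
suff h : forall j, N (u (k + j)%N - u k) <= c / (1 - q) * (q ^+ k - q ^+ (k + j)).
  have := h (n - k)%N; rewrite subnKC // => /le_trans; apply.
  by rewrite ler_wpM2l ?divr_ge0 ?(ltW q1') // gerBl exprn_ge0.
elim=> [|j IH]; first by rewrite addn0 !subrr nrm0 // mulr0.
rewrite addnS -(subrK (u (k + j)%N) (u (k + j).+1)) -addrA.
apply: le_trans (nrmD m_gt0 p1 (lpB _ _) (lpB _ _)) _ => //.
apply: le_trans (lerD (hu _) IH) _; rewrite exprS.
leq_eq; field; rewrite gt_eqF //.
Qed.

Lemma geometric_cauchy (u : nat -> X -> R[i]) (c q : R) : 0 <= q -> q < 1 ->
  (forall n, L (u n)) -> (forall n, N (u n.+1 - u n) <= c * q ^+ n) ->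
  cauchy_lp m p u.
Proof.
move=> q0 q1 lu hu e e0.
have [M hM] := geometric_small (c / (1 - q)) q0 q1 e0.
exists M => n k Mn Mk; case: (leqP k n) => [kn|/ltnW nk].
  exact: le_trans (geometric_tail q0 q1 lu hu kn) (hM _ Mk).
rewrite nrm_sub_sym //.
exact: le_trans (geometric_tail q0 q1 lu hu nk) (hM _ Mn).
Qed.

Lemma cvg_lp_unique (u : nat -> X -> R[i]) f g : (forall n, L (u n)) ->
  L f -> L g -> cvg_lp m p u f -> cvg_lp m p u g -> f = g.
Proof.
move=> lu lf lg hf hg; apply/eqP; rewrite -subr_eq0; apply/eqP.
apply: (nrm_eq0 m_gt0 p1 (lpB lf lg)); apply/eqP; rewrite eq_le nrm_ge0 andbT.
apply/ler_addgt0Pr => e e0; rewrite add0r.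
have [M1 h1] := hf (e / 2) ltac:(lra); have [M2 h2] := hg (e / 2) ltac:(lra).
pose n := maxn M1 M2.
have -> : f - g = (u n - g) - (u n - f) by fext.
apply: le_trans (nrmB m_gt0 p1 (lpB (lu n) lg) (lpB (lu n) lf)) _.
have := h1 n (leq_maxl _ _); have := h2 n (leq_maxr _ _); lra.
Qed.

(** [resolvent_at] in terms of the sealed norm and of the operations of the function space;
    [resolventP] is the passage between the two. *)
Definition resolvent_op (A : graph R X) z (T : (X -> R[i]) -> X -> R[i]) :=
  [/\ forall f, L f -> L (T f),
      forall a f g, L f -> L g -> T (a ** f + g) = a ** T f + T g,
      exists2 M : R, 0 <= M & forall f, L f -> N (T f) <= M * N f,
      forall g, L g -> A (T g) (z ** T g - g)
    & forall f h, A f h -> T (z ** f - h) = f].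

Section LinearOperators.
Variable T : (X -> R[i]) -> X -> R[i].
Hypothesis T_lin : forall a f g, L f -> L g -> T (a ** f + g) = a ** T f + T g.

Lemma lin_op0 : T 0 = 0.
Proof.
have l0 : L 0 by exact: lp0.
by have := T_lin (-1) l0 l0; rewrite !cscaleN1 addNr => ->; rewrite addNr.
Qed.

Lemma lin_opZ a f : L f -> T (a ** f) = a ** T f.
Proof.
move=> lf; have := T_lin a lf (lp0 m_gt0 p1).
by rewrite lin_op0 !addr0.
Qed.

Lemma lin_opD f g : L f -> L g -> T (f + g) = T f + T g.
Proof. by move=> lf lg; have := T_lin 1 lf lg; rewrite !cscale1. Qed.

Lemma lin_opB f g : L f -> L g -> T (f - g) = T f - T g.
Proof.
move=> lf lg; have := T_lin (-1) lg lf.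
by rewrite !cscaleN1 addrC => ->; rewrite addrC.
Qed.

Lemma lin_opN f : L f -> T (- f) = - T f.
Proof. by move=> lf; rewrite -!cscaleN1 lin_opZ. Qed.

Lemma lin_op_sum (I : Type) (s : seq I) (u : I -> X -> R[i]) :
  (forall i, L (u i)) -> T (\sum_(i <- s) u i) = \sum_(i <- s) T (u i).
Proof.
move=> lu; elim: s => [|i s IH]; first by rewrite !big_nil lin_op0.
by rewrite !big_cons lin_opD ?IH //; exact: lp_sum.
Qed.

End LinearOperators.

Lemma bounded_opP (T : (X -> R[i]) -> X -> R[i]) : bounded_op m p T <->
  [/\ forall f, L f -> L (T f),
      forall a f g, L f -> L g -> T (a ** f + g) = a ** T f + T g
    & exists2 M : R, 0 <= M & forall f, L f -> N (T f) <= M * N f].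
Proof.
have E f : lp m p f = L f by rewrite lpmem.unlock.
split=> [[h1 h2 [M [M0 h3]]]|[h1 h2 [M M0 h3]]].
  split=> [f|a f g|]; rewrite -?E; first exact: h1.
    exact: h2.
  exists M => // f; rewrite -E => lf; rewrite -lee_fin EFinM -!lpE -?E //; last exact: h1.
  exact: h3.
split=> [f|a f g|]; rewrite ?E; first exact: h1.
  exact: h2.
exists M; split => // f; rewrite E => lf; rewrite !lpE //; last exact: h1.
by rewrite -EFinM lee_fin; exact: h3.
Qed.

Lemma resolventP A z T : resolvent_at m p A z T <-> resolvent_op A z T.
Proof.
have E f : lp m p f = L f by rewrite lpmem.unlock.
split=> [[/bounded_opP[h1 h2 h3] h4 h5]|[h1 h2 h3 h4 h5]]; split => //.
- by move=> g; rewrite -E; exact: h4.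
- by apply/bounded_opP.
- by move=> g; rewrite E; exact: h4.
Qed.

Variable A : graph R X.
Hypothesis A_dom : forall f g, A f g -> L f /\ L g.
Hypothesis A_lin : forall a f1 g1 f2 g2, A f1 g1 -> A f2 g2 ->
  A (a ** f1 + f2) (a ** g1 + g2).

(** The a priori bound makes solutions unique, so a solution operator obtained by choice is
    automatically linear, bounded and a left inverse. *)
Lemma resolvent_intro z M : 0 <= M ->
  (forall u h, A u h -> N u <= M * N (z ** u - h)) ->
  (forall g, L g -> exists u, A u (z ** u - g)) ->
  exists T, resolvent_op A z T.
Proof.
move=> M0 hM hA.
have uniq g u v : A u (z ** u - g) -> A v (z ** v - g) -> u = v.
  move=> hu hv; have := A_lin (-1) hv hu; rewrite !cscaleN1 => hd.
  have [ld _] := A_dom hd; apply/eqP; rewrite -subr_eq0 addrC; apply/eqP.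
  apply: (nrm_eq0 m_gt0 p1 ld); apply/eqP; rewrite eq_le nrm_ge0 andbT.
  apply: le_trans (hM _ _ hd) _.
  suff -> : z ** (- v + u) - (- (z ** v - g) + (z ** u - g)) = 0.
    by rewrite nrm0 // mulr0.
  apply/funext => x; rewrite /cscale !fctE; ring.
have /choice[T hT] : forall g, exists u, L g -> A u (z ** u - g).
  by move=> g; have [lg|] := pselect (L g); [have [u] := hA g lg; exists u|exists 0].
exists T; split.
- by move=> f /hT /A_dom[].
- move=> a f g lf lg; apply: (uniq (a ** f + g)).
    by apply: hT; apply: lpD => //; exact: lpZ.
  have := A_lin a (hT _ lf) (hT _ lg).
  congr (A _ _); apply/funext => x; rewrite /cscale !fctE; ring.
- exists M => // f lf; apply: le_trans (hM _ _ (hT _ lf)) _.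
  by rewrite opprB addrC subrK.
- exact: hT.
- move=> f h fh; apply: (uniq (z ** f - h)).
    by apply: hT; apply: lpB; [apply: lpZ|]; case: (A_dom fh).
  by rewrite opprB addrC subrK.
Qed.

(** Both requirements of [resolvent_intro] come from (z - A) u = (z0 - A) u - (z0 - z) u: the bound
    by absorbing q N(u) with q < 1, the solution as the fixed point of a contraction. *)
Lemma neumann z0 z T M : resolvent_op A z0 T -> 0 <= M ->
  (forall f, L f -> N (T f) <= M * N f) -> normc (z - z0) * M < 1 ->
  exists T', resolvent_op A z T'.
Proof.
move=> [T1 T2 _ T4 T5] M0 hM q1; set q := normc (z - z0) * M in q1.
have q0 : 0 <= q by rewrite mulr_ge0 ?normc_ge0.
have q1' : 0 < 1 - q by lra.
apply: (@resolvent_intro _ (M / (1 - q))); first by rewrite divr_ge0 // ltW.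
  move=> u h uh; have [lu lh] := A_dom uh.
  have lzu : L (z ** u - h) by apply: lpB => //; exact: lpZ.
  have lTu : L (T u) by exact: T1.
  have uE : u = (z0 - z) ** T u + T (z ** u - h).
    rewrite -{1}(T5 _ _ uh) -T2 //; congr T.
    by apply/funext => x; rewrite /cscale !fctE; ring.
  have : N u <= q * N u + M * N (z ** u - h).
    rewrite {1}uE; apply: le_trans (nrmD m_gt0 p1 (lpZ _ lTu) (T1 _ lzu)) _.
    apply: lerD; last exact: hM.
    apply: le_trans (nrmZ_le m_gt0 p1 _ lTu) _.
    by rewrite normcB /q -mulrA ler_wpM2l ?normc_ge0 // hM.
  by move=> le; rewrite mulrAC ler_pdivlMr //; lra.
move=> g lg.
(* A fixed point v satisfies (z0 - A) v = (z0 - z) v + g, that is (z - A) v = g. *)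
pose step u := T ((z0 - z) ** u + g).
have lstep u : L u -> L (step u) by move=> lu; apply: T1; apply: lpD => //; exact: lpZ.
have dstep u v : L u -> L v -> N (step u - step v) <= q * N (u - v).
  move=> lu lv; have luv := lpB lu lv.
  have -> : step u - step v = (z0 - z) ** T (u - v).
    rewrite -lin_opZ // /step -lin_opB //; try by apply: lpD => //; exact: lpZ.
    by congr T; fext.
  apply: le_trans (nrmZ_le m_gt0 p1 _ (T1 _ luv)) _.
  by rewrite normcB /q -mulrA ler_wpM2l ?normc_ge0 // hM.
pose u n := iter n step 0.
have lu n : L (u n) by elim: n => [|n IH]; [exact: lp0|exact: lstep].
have hu n : N (u n.+1 - u n) <= N (u 1%N - u 0%N) * q ^+ n.
  elim: n => [|n IH]; first by rewrite mulr1.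
  rewrite exprS; apply: le_trans (dstep (u n.+1) (u n) (lu _) (lu _)) _.
  by have := ler_wpM2l q0 IH; rewrite mulrCA.
have [v lv hv] := complete_lp m_gt0 p1 lu (geometric_cauchy q0 q1 lu hu).
have vE : v = step v.
  apply: (@cvg_lp_unique (fun n => u n.+1)) => //; first exact: lstep.
    by move=> e /hv[K hK]; exists K => n Kn; apply: hK; rewrite (leq_trans Kn).
  move=> e /hv[K hK]; exists K => n /hK; apply: le_trans.
  apply: le_trans (dstep _ _ (lu n) lv) _.
  by rewrite -[leRHS]mul1r ler_wpM2r ?nrm_ge0 // ltW.
exists v; have /T4 : L ((z0 - z) ** v + g) by apply: lpD => //; exact: lpZ.
rewrite -/(step v) -vE; congr (A _ _); fext.
Qed.

End Resolvents.

Lemma finsupp_lin (R : realType) (X : choiceType) (a : R[i]) (f g : X -> R[i]) :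
  finsupp_fun f -> finsupp_fun g -> finsupp_fun (a ** f + g).
Proof.
move=> hf hg; apply: (@sub_finite_set _ _ ([set x | f x != 0] `|` [set x | g x != 0])).
  move=> x /=; rewrite /cscale !fctE => h.
  have [f0|f0] := eqVneq (f x) 0; last by left.
  by right; move: h; rewrite f0 mulr0 add0r.
by rewrite finite_setU.
Qed.

Lemma finsupp_ind1 (R : realType) (X : choiceType) (x : X) : finsupp_fun (ind1 R x).
Proof.
apply: (@sub_finite_set _ _ [set x]); last exact: finite_set1.
by move=> y /=; rewrite /ind1; case: (y =P x) => // _; rewrite eqxx.
Qed.

(** * The closed form and its operator *)

Section ClosedForm.
Variables (R : realType) (X : choiceType) (m : X -> R).
Hypothesis m_gt0 : forall x, 0 < m x.
Local Notation ip := (ip m).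
Local Notation L2 := (lpmem m 2%:E).
Local Notation N := (nrm m 2%:E).
Local Notation l2D := (l2D m_gt0).
Local Notation l2B := (l2B m_gt0).
Local Notation l2Z := (l2Z m_gt0).
Local Notation l2N := (l2N m_gt0).
Local Notation cvg2 := (cvg_lp m 2%:E).
Implicit Types (f g h u v w : X -> R[i]) (a z : R[i]).

Variable G : X -> X -> R[i].
Hypothesis G_l2 : forall x, L2 (G x).
(** Abstract model of coboundary, boundary and their sum: every value is an l^2 pairing, so the map
    makes sense on all of l^2, although its values need not form an l^2 function. The form studied
    is w -> |D w|^2. *)
Definition opD w : X -> R[i] := fun x => ip w (G x).
Local Notation D := opD.
Hypothesis D_ind1 : forall x, L2 (D (ind1 R x)).

Lemma l2_fin f : finsupp_fun f -> L2 f.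
Proof. exact: (finsupp_lp m_gt0 le12). Qed.

Lemma D_lin a f g : L2 f -> L2 g -> D (a ** f + g) = a ** D f + D g.
Proof. by move=> lf lg; apply/funext => x; rewrite /D ip_linl. Qed.

Lemma D_Z a f : L2 f -> D (a ** f) = a ** D f.
Proof. by move=> lf; apply/funext => x; rewrite /D ipZl. Qed.

Lemma D_D f g : L2 f -> L2 g -> D (f + g) = D f + D g.
Proof. by move=> lf lg; apply/funext => x; rewrite /D ipDl. Qed.

Lemma D_B f g : L2 f -> L2 g -> D (f - g) = D f - D g.
Proof. by move=> lf lg; apply/funext => x; rewrite /D ipBl. Qed.

Lemma D_0 : D 0 = 0.
Proof. by apply/funext => x; rewrite /D ip0l. Qed.

Lemma D_sum (I : Type) (s : seq I) (u : I -> X -> R[i]) : (forall i, L2 (u i)) ->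
  D (\sum_(i <- s) u i) = \sum_(i <- s) D (u i).
Proof.
move=> lu; elim: s => [|i s IH]; first by rewrite !big_nil D_0.
rewrite !big_cons D_D ?IH //; exact: lp_sum.
Qed.

Lemma D_fin_l2 f : finsupp_fun f -> L2 (D f).
Proof.
move=> /finsupp_restrict[F [-> _]]; rewrite restrictE D_sum; last first.
  by move=> y; apply: l2Z; exact: ind1_lp.
by apply: lp_sum => // y; rewrite D_Z; [exact: l2Z|exact: ind1_lp].
Qed.

Lemma ip_cvg (un : nat -> X -> R[i]) u v : (forall n, L2 (un n)) -> L2 u -> L2 v ->
  cvg2 un u -> forall e, 0 < e -> exists K : nat, forall n, (K <= n)%N ->
    normc (ip (un n) v - ip u v) <= e.
Proof.
move=> lun lu lv h e e0; have c0 : 0 < N v + 1 by have := nrm_ge0 m 2%:E v; lra.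
have [K hK] := h _ (divr_gt0 e0 c0); exists K => n /hK hn.
rewrite -ipBl //; apply: le_trans (ip_CS m_gt0 (l2B (lun n) lu) lv) _.
by rewrite mulrC; apply: ler_mul_div1; rewrite ?nrm_ge0.
Qed.

Lemma cvg_D_pt (un : nat -> X -> R[i]) u : (forall n, L2 (un n)) -> L2 u ->
  cvg2 un u -> cvg_pt (fun n => D (un n)) (D u).
Proof. by move=> lun lu h x; apply: ip_cvg. Qed.

Lemma cvg_pt_unique (un : nat -> X -> R[i]) u v : cvg_pt un u -> cvg_pt un v -> u = v.
Proof.
move=> hu hv; apply/funext => x; apply/eqP; rewrite -subr_eq0; apply/eqP.
apply: normc_small => e e0.
have [K1 h1] := hu x (e / 2) ltac:(lra); have [K2 h2] := hv x (e / 2) ltac:(lra).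
pose n := maxn K1 K2.
have := h1 n (leq_maxl _ _); have := h2 n (leq_maxr _ _).
have -> : u x - v x = (un n x - v x) - (un n x - u x) by ring.
have := ler_normcB (un n x - v x) (un n x - u x); lra.
Qed.

Definition form_seq w (wn : nat -> X -> R[i]) :=
  [/\ forall n, finsupp_fun (wn n), cvg2 wn w & cauchy_lp m 2%:E (fun n => D (wn n))].

(** The l^2 limit of [D (wn n)] can only be [D w], because D is pointwise continuous on l^2. This is
    closability, and it makes the closed form the plain formula |D w|^2 on its domain. *)
Lemma form_seq_cvg w wn : L2 w -> form_seq w wn ->
  L2 (D w) /\ cvg2 (fun n => D (wn n)) (D w).
Proof.
move=> lw [fw cw cDw]; have ln n : L2 (wn n) by apply: l2_fin.
have lDn n : L2 (D (wn n)) by apply: D_fin_l2.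
have [v lv hv] := complete_lp m_gt0 le12 lDn cDw.
suff -> : D w = v by [].
apply: (@cvg_pt_unique (fun n => D (wn n))); first exact: cvg_D_pt.
exact: (cvg_lp_pt m_gt0 le12 lDn lv).
Qed.

Definition formdom w := L2 w /\ exists wn, form_seq w wn.

Lemma formdom_l2 w : formdom w -> L2 w. Proof. by case. Qed.

Lemma formdom_Dl2 w : formdom w -> L2 (D w).
Proof. by case=> lw [wn] /(form_seq_cvg lw)[]. Qed.

Lemma formdom_fin w : finsupp_fun w -> formdom w.
Proof.
move=> fw; split; first exact: l2_fin.
exists (fun=> w); split => // e e0; exists 0 => *; by rewrite subrr nrm0 // ltW.
Qed.

Lemma cvg_lin (p : \bar R) (p1 : (1 <= p)%E) (un vn : nat -> X -> R[i]) u v a :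
  (forall n, lpmem m p (un n)) -> (forall n, lpmem m p (vn n)) ->
  lpmem m p u -> lpmem m p v ->
  cvg_lp m p un u -> cvg_lp m p vn v ->
  cvg_lp m p (fun n => a ** un n + vn n) (a ** u + v).
Proof.
move=> lun lvn lu lv hu hv e e0.
have c0 : 0 < normc a + 1 by have := normc_ge0 a; lra.
have e1 : 0 < e / 2 / (normc a + 1) by rewrite !divr_gt0.
have [K1 h1] := hu _ e1; have [K2 h2] := hv (e / 2) ltac:(lra).
exists (maxn K1 K2) => n; rewrite geq_max => /andP[/h1 {}h1 /h2 {}h2].
have -> : a ** un n + vn n - (a ** u + v) = a ** (un n - u) + (vn n - v) by fext.
have lu' : lpmem m p (un n - u) by exact: lpB.
have lv' : lpmem m p (vn n - v) by exact: lpB.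
apply: le_trans (nrmD m_gt0 p1 (lpZ m_gt0 p1 _ lu') lv') _.
have := nrmZ_le m_gt0 p1 a lu'.
have : normc a * nrm m p (un n - u) <= e / 2.
  by apply: ler_mul_div1; rewrite ?normc_ge0 ?nrm_ge0.
lra.
Qed.

Lemma cauchy_lin (p : \bar R) (p1 : (1 <= p)%E) (un vn : nat -> X -> R[i]) a :
  (forall n, lpmem m p (un n)) -> (forall n, lpmem m p (vn n)) ->
  cauchy_lp m p un -> cauchy_lp m p vn ->
  cauchy_lp m p (fun n => a ** un n + vn n).
Proof.
move=> lun lvn hu hv e e0.
have c0 : 0 < normc a + 1 by have := normc_ge0 a; lra.
have e1 : 0 < e / 2 / (normc a + 1) by rewrite !divr_gt0.
have [K1 h1] := hu _ e1; have [K2 h2] := hv (e / 2) ltac:(lra).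
exists (maxn K1 K2) => n k; rewrite !geq_max => /andP[n1 n2] /andP[k1 k2].
have {}h1 := h1 _ _ n1 k1; have {}h2 := h2 _ _ n2 k2.
have -> : a ** un n + vn n - (a ** un k + vn k)
  = a ** (un n - un k) + (vn n - vn k) by fext.
have lu' : lpmem m p (un n - un k) by exact: lpB.
have lv' : lpmem m p (vn n - vn k) by exact: lpB.
apply: le_trans (nrmD m_gt0 p1 (lpZ m_gt0 p1 _ lu') lv') _.
have := nrmZ_le m_gt0 p1 a lu'.
have : normc a * nrm m p (un n - un k) <= e / 2.
  by apply: ler_mul_div1; rewrite ?normc_ge0 ?nrm_ge0.
lra.
Qed.

Lemma formdom_lin a u v : formdom u -> formdom v -> formdom (a ** u + v).
Proof.
move=> [lu [un [fu cu du]]] [lv [vn [fv cv dv]]]; split.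
  by apply: l2D => //; exact: l2Z.
exists (fun n => a ** un n + vn n); split.
- by move=> n; exact: finsupp_lin.
- by apply: cvg_lin => // n; exact: l2_fin.
- have -> : (fun n => D (a ** un n + vn n)) = (fun n => a ** D (un n) + D (vn n)).
    by apply/funext => n; rewrite D_lin //; exact: l2_fin.
  by apply: cauchy_lin => // n; exact: D_fin_l2.
Qed.

(** The operator of the closed form. Testing against finitely supported functions is enough since
    they are a form core; [lap_weak] recovers the whole domain. *)
Definition lap : graph R X := fun w f => [/\ formdom w, L2 f
  & forall v, finsupp_fun v -> ip (D w) (D v) = ip f v].

Lemma lap_weak w f v : lap w f -> formdom v -> ip (D w) (D v) = ip f v.
Proof.
move=> [dw lf h] [lv [vn sv]]; have [lDv cDv] := form_seq_cvg lv sv.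
have [fv cv _] := sv; have lDw := formdom_Dl2 dw.
have ln n : L2 (vn n) by apply: l2_fin.
have lDn n : L2 (D (vn n)) by apply: D_fin_l2.
rewrite (ip_sym m_gt0 lDv lDw) (ip_sym m_gt0 lv lf); congr conjc.
apply/eqP; rewrite -subr_eq0; apply/eqP; apply: normc_small => e e0.
have e2 : 0 < e / 2 by lra.
have [K1 h1] := ip_cvg lDn lDv lDw cDv e2.
have [K2 h2] := ip_cvg ln lv lf cv e2.
pose n := maxn K1 K2.
have {}h1 := h1 n (leq_maxl _ _); have {}h2 := h2 n (leq_maxr _ _).
have E : ip (D (vn n)) (D w) = ip (vn n) f.
  by rewrite (ip_sym m_gt0 lDw (lDn n)) h // -(ip_sym m_gt0 lf (ln n)).
have -> : ip (D v) (D w) - ip v f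
    = (ip (vn n) f - ip v f) - (ip (D (vn n)) (D w) - ip (D v) (D w)).
  by rewrite E; ring.
have := ler_normcB (ip (vn n) f - ip v f) (ip (D (vn n)) (D w) - ip (D v) (D w)).
lra.
Qed.

Lemma lap_dom u f : lap u f -> L2 u /\ L2 f.
Proof. by case=> [[]]. Qed.

Lemma lap_lin a u f v g : lap u f -> lap v g -> lap (a ** u + v) (a ** f + g).
Proof.
move=> [du lf hu] [dv lg hv]; split; first exact: formdom_lin.
  by apply: l2D => //; exact: l2Z.
move=> w fw; have lu := formdom_l2 du; have lv := formdom_l2 dv.
have lDw := D_fin_l2 fw; have lw := l2_fin fw.
by rewrite D_lin // !ip_linl ?hu ?hv //; exact: formdom_Dl2.
Qed.

Lemma lap_sym u f v g : lap u f -> lap v g -> ip f v = ip u g.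
Proof.
move=> hu hv; have [du lf _] := hu; have [dv lg _] := hv.
have lu := formdom_l2 du; have lv := formdom_l2 dv.
rewrite -(lap_weak hu dv) (ip_sym m_gt0 (formdom_Dl2 dv) (formdom_Dl2 du)).
by rewrite (lap_weak hv du) -(ip_sym m_gt0 lg lu).
Qed.

Lemma lap_self u f : lap u f -> ip f u = (N (D u) ^+ 2)%:C.
Proof.
move=> hu; have [du lf _] := hu.
by rewrite -(lap_weak hu du) ip_self //; exact: formdom_Dl2.
Qed.

Lemma lap_ip_resolvent z u h : lap u h ->
  ip (z ** u - h) u = z * (N u ^+ 2)%:C - (N (D u) ^+ 2)%:C.
Proof.
move=> hu; have [du lh _] := hu; have lu := formdom_l2 du.
by rewrite ipBl ?ipZl ?ip_self ?(lap_self hu) //; exact: l2Z.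
Qed.

(** With A u = h, <(-lam - A) u, u> = -(lam |u|^2 + |D u|^2) has modulus at least lam |u|^2, and
    Cauchy-Schwarz cancels one factor |u|. *)
Lemma lap_bound_neg (lam : R) u h : 0 < lam -> lap u h ->
  N u <= lam^-1 * N ((- lam)%:C ** u - h).
Proof.
move=> lam0 hu; have [du lh _] := hu; have lu := formdom_l2 du.
have lw : L2 ((- lam)%:C ** u - h) by apply: l2B => //; exact: l2Z.
have := normc_ge_abs_Re (ip ((- lam)%:C ** u - h) u).
have := ip_CS m_gt0 lw lu.
rewrite lap_ip_resolvent // -rmorphM -rmorphB normcR /=.
have := sqr_ge0 (N (D u)); have := nrm_ge0 m 2%:E u.
have := nrm_ge0 m 2%:E ((- lam)%:C ** u - h).
move: (N u) (N (D u)) (N (_ - _)) => a b c c0 a0 b0.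
rewrite mulNr -opprD normrN ger0_norm; last first.
  by rewrite addr_ge0 // mulr_ge0 ?sqr_ge0 // ltW.
move=> h1 _; rewrite mulrC ler_pdivlMr //.
move: a0; rewrite le_eqVlt => /orP[/eqP a0|a0]; last first.
  rewrite -(ler_pM2r a0); apply: le_trans h1; rewrite -subr_ge0.
  rewrite (_ : _ - _ = b ^+ 2) //; ring.
by rewrite -a0 mul0r.
Qed.

(** Since <A u, u> is real, the imaginary part of <(z - A) u, u> is Im z |u|^2. *)
Lemma lap_bound_im z u h : complex.Im z != 0 -> lap u h ->
  N u <= `|complex.Im z|^-1 * N (z ** u - h).
Proof.
move=> z0 hu; have [du lh _] := hu; have lu := formdom_l2 du.
have lw : L2 (z ** u - h) by apply: l2B => //; exact: l2Z.
have := normc_ge_abs_Im (ip (z ** u - h) u).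
have := ip_CS m_gt0 lw lu.
rewrite lap_ip_resolvent // cImD cImN (mulrC z) cImZ /= oppr0 addr0 mulrC.
rewrite normrM ger0_norm ?sqr_ge0 //.
have := nrm_ge0 m 2%:E u; have := nrm_ge0 m 2%:E (z ** u - h).
have im0 : 0 < `|complex.Im z| by rewrite normr_gt0.
move: (N u) (N (_ - _)) => a c c0 a0 h1 h2.
rewrite mulrC ler_pdivlMr //.
move: a0; rewrite le_eqVlt => /orP[/eqP a0|a0]; last first.
  rewrite -(ler_pM2r a0); apply: le_trans h1; apply: le_trans h2.
  by rewrite expr2 mulrAC.
by rewrite -a0 mul0r.
Qed.

(** * The weak equation solved by minimising an energy *)

Section Minimisation.
Variables (lam : R) (g : X -> R[i]).
Hypothesis lam0 : 0 < lam.
Hypothesis lg : L2 g.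

Let energy w : R := N (D w) ^+ 2 + lam * N w ^+ 2 - 2 * complex.Re (ip w g).
Let values := [set r | exists2 w, finsupp_fun w & r = energy w].

Lemma energy_ge w : finsupp_fun w -> - (N g ^+ 2 / lam) <= energy w.
Proof.
move=> fw; have := Re_ip_le m_gt0 (l2_fin fw) lg; rewrite /energy.
move: (complex.Re _) (N w) (N g) (N (D w)) => r a b c h.
have : 0 <= c ^+ 2 + lam * (a - b / lam) ^+ 2.
  by rewrite addr_ge0 ?sqr_ge0 // mulr_ge0 ?sqr_ge0 // ltW.
have -> : c ^+ 2 + lam * (a - b / lam) ^+ 2
   = c ^+ 2 + lam * a ^+ 2 - 2 * (a * b) + b ^+ 2 / lam by field; rewrite gt_eqF.
lra.
Qed.

Let finsupp0 : finsupp_fun (0 : X -> R[i]).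
Proof.
by rewrite /finsupp_fun (_ : [set x | _] = set0) // -subset0 => x /=; rewrite eqxx.
Qed.

Let has_inf_values : has_inf values.
Proof.
split; first by exists (energy 0); exists 0.
by exists (- (N g ^+ 2 / lam)) => _ [w fw ->]; exact: energy_ge.
Qed.

Lemma energy_inf w : finsupp_fun w -> inf values <= energy w.
Proof. by move=> fw; apply: ge_inf; [case: has_inf_values|exists w]. Qed.

Lemma energyD w v : finsupp_fun w -> finsupp_fun v ->
  energy (w + v) = energy w + N (D v) ^+ 2 + lam * N v ^+ 2
   + 2 * complex.Re (ip (D w) (D v) + lam%:C * ip w v - ip g v).
Proof.
move=> fw fv; have lw := l2_fin fw; have lv := l2_fin fv.
have lDw := D_fin_l2 fw; have lDv := D_fin_l2 fv.
rewrite /energy D_D // !nrm2_sqrD // ipDl // !cReD cReN cReZ.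
by rewrite (ip_sym m_gt0 lv lg) cReJ; ring.
Qed.

(** The quadratic part obeys the parallelogram law, and the energy at the midpoint is at least the
    infimum. Minimising sequences are therefore Cauchy in the form norm. *)
Lemma energy_parallelogram w v : finsupp_fun w -> finsupp_fun v ->
  N (D (w - v)) ^+ 2 + lam * N (w - v) ^+ 2
  <= 2 * (energy w + energy v - 2 * inf values).
Proof.
move=> fw fv; have lw := l2_fin fw; have lv := l2_fin fv.
have lDw := D_fin_l2 fw; have lDv := D_fin_l2 fv.
have lwv : L2 (w + v) by exact: l2D.
have f0 : finsupp_fun ((2^-1)%:C ** (w + v)).
  have := finsupp_lin (2^-1)%:C (finsupp_lin 1 fw fv) finsupp0.
  by rewrite cscale1 addr0.
have := energy_inf f0; rewrite D_B // /energy D_Z // D_D // !nrm2Z //; last exact: l2D.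
rewrite !nrm2_sqrB // ipZl // ipDl // cReZ cReD !exprMn !nrm2_sqrD //.
rewrite normcR ger0_norm //.
have -> : (2^-1 : R) ^+ 2 = 4^-1 by field.
lra.
Qed.

(** Takes the place of the Riesz representation theorem on the form domain: the limit of a
    minimising sequence satisfies the Euler equation of the energy. *)
Lemma weak_solution : exists2 w, formdom w & forall v, finsupp_fun v ->
  ip (D w) (D v) + lam%:C * ip w v = ip g v.
Proof.
have /choice[wn hwn] : forall n : nat, exists w, finsupp_fun w /\
    energy w < inf values + n.+1%:R^-1.
  move=> n; have n0 : 0 < n.+1%:R^-1 :> R by rewrite invr_gt0.
  by have [_ [w fw ->] h] := inf_adherent n0 has_inf_values; exists w.
have fw n : finsupp_fun (wn n) by case: (hwn n).
have lw n : L2 (wn n) by exact: l2_fin.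
have lDw n : L2 (D (wn n)) by exact: D_fin_l2.
have small e : 0 < e -> exists K : nat, forall n k, (K <= n)%N -> (K <= k)%N ->
    N (D (wn n - wn k)) ^+ 2 + lam * N (wn n - wn k) ^+ 2 <= e.
  move=> e0; have [K hK] := @inv_succ_small R (e / 4) ltac:(lra).
  exists K => n k Kn Kk; apply: le_trans (energy_parallelogram (fw n) (fw k)) _.
  have [_ h1] := hwn n; have [_ h2] := hwn k.
  have := hK _ Kn; have := hK _ Kk; move: h1 h2.
  move: (energy (wn n)) (energy (wn k)) (inf values) n.+1%:R^-1 k.+1%:R^-1 => *; lra.
have cw : cauchy_lp m 2%:E wn.
  move=> e e0; have [K hK] := small (lam * e ^+ 2) (mulr_gt0 lam0 (exprn_gt0 2 e0)).
  exists K => n k Kn Kk.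
  rewrite -(ler_pXn2r (n := 2)) ?nnegrE ?nrm_ge0 ?(ltW e0) //.
  rewrite -(ler_pM2l lam0); apply: le_trans (hK n k Kn Kk).
  by rewrite lerDr sqr_ge0.
have cDw : cauchy_lp m 2%:E (fun n => D (wn n)).
  move=> e e0; have [K hK] := small (e ^+ 2) (exprn_gt0 2 e0).
  exists K => n k Kn Kk; rewrite -D_B //.
  rewrite -(ler_pXn2r (n := 2)) ?nnegrE ?nrm_ge0 ?(ltW e0) //.
  apply: le_trans (hK n k Kn Kk).
  by rewrite lerDl mulr_ge0 ?sqr_ge0 // ltW.
have [w lw' cvw] := complete_lp m_gt0 le12 lw cw.
have sw : form_seq w wn by [].
have [lDw' cvDw] := form_seq_cvg lw' sw.
exists w; first by split => //; exists wn.
(* [2 * Re (ell v)] is the derivative of the energy at [w] in the direction [v]. *)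
pose ell v := ip (D w) (D v) + lam%:C * ip w v - ip g v.
suff ell0 v : finsupp_fun v -> ell v = 0.
  by move=> v fv; apply/eqP; rewrite -subr_eq0; apply/eqP; exact: ell0.
have ell_ge v' : finsupp_fun v' ->
    0 <= N (D v') ^+ 2 + lam * N v' ^+ 2 + 2 * complex.Re (ell v').
  move=> fv; have lv := l2_fin fv; have lDv := D_fin_l2 fv.
  apply/ler_addgt0Pr => e e0.
  (* The two pairings enter with a factor 2 and cost e / 3 each; the gap between the energy of
     [wn n] and the infimum costs the last third. *)
  have e6 : 0 < e / 6 by lra.
  have e6' : 0 < e / 6 / lam by rewrite divr_gt0.
  have [K1 h1] := ip_cvg lDw lDw' lDv cvDw e6.
  have [K2 h2] := ip_cvg lw lw' lv cvw e6'.
  have [K3 h3] := @inv_succ_small R (e / 3) ltac:(lra).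
  pose n := maxn K1 (maxn K2 K3).
  have {}h1 := h1 n (leq_maxl _ _).
  have {}h2 := h2 n (leq_trans (leq_maxl _ _) (leq_maxr _ _)).
  have {}h3 := h3 n (leq_trans (leq_maxr _ _) (leq_maxr _ _)).
  have := energy_inf (finsupp_lin 1 (fw n) fv); rewrite cscale1 energyD //.
  have [_ {}hwn] := hwn n.
  have := le_trans (normc_ge_abs_Re _) h1; have := le_trans (normc_ge_abs_Re _) h2.
  rewrite ler_pdivlMr // -[X in _ * X](gtr0_norm lam0) -normrM.
  rewrite !ler_norml /ell !cReD !cReN !cReZ; move: hwn h3.
  move: (energy (wn n)) (inf values) n.+1%:R^-1 (N _ ^+ 2) (N _ ^+ 2).
  move: (complex.Re _) (complex.Re _) (complex.Re _) (complex.Re _) (complex.Re _) => *.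
  lra.
move=> fv; apply: contrapT => /eqP l0.
have lv := l2_fin fv; have lDv := D_fin_l2 fv.
pose K := N (D v) ^+ 2 + lam * N v ^+ 2.
have K0 : 0 <= K by rewrite addr_ge0 ?sqr_ge0 // mulr_ge0 ?sqr_ge0 // ltW.
have K1 : 0 < K + 1 by lra.
(* Along [s ** v] with s = -t ell(v) the linear term is -2 t |ell(v)|^2 and the quadratic one t^2 K
   |ell(v)|^2. Minimality would force t K >= 2, against t (K + 1) = 1. *)
pose t := (K + 1)^-1; have t0 : 0 < t by rewrite invr_gt0.
pose s := - (t%:C * ell v).
have fsv : finsupp_fun (s ** v).
  by have := finsupp_lin s fv finsupp0; rewrite addr0.
have := ell_ge _ fsv.
have -> : ell (s ** v) = conjc s * ell v.
  by rewrite /ell D_Z // !ipZr //; ring.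
rewrite D_Z // !nrm2Z // /s normcN normcM normcR (gtr0_norm t0).
have -> : conjc (- (t%:C * ell v)) * ell v = (- t * normc (ell v) ^+ 2)%:C.
  transitivity (- t%:C * (ell v * conjc (ell v))).
    by rewrite conjc_opp conjc_mul conjc_real; ring.
  by rewrite mulc_conj -rmorphN -rmorphM.
have a0 : 0 < normc (ell v) by rewrite lt_def normc_ge0 normc_eq0 l0.
move: (normc (ell v)) a0 => a a0 /=.
have -> : (t * a * N (D v)) ^+ 2 + lam * (t * a * N v) ^+ 2 + 2 * (- t * a ^+ 2)
  = t * a ^+ 2 * (t * K - 2) by rewrite /K; ring.
rewrite pmulr_rge0; last by rewrite mulr_gt0 // exprn_gt0.
have : t * (K + 1) = 1 by rewrite mulVf // gt_eqF.
lra.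
Qed.

End Minimisation.

Lemma lap_resolvent_neg (lam : R) : 0 < lam -> exists T,
  resolvent_op m 2%:E lap (- lam)%:C T /\
  forall f, L2 f -> N (T f) <= lam^-1 * N f.
Proof.
move=> lam0; have [|||T hT] := @resolvent_intro _ _ _ m_gt0 _ le12 lap lap_dom
    lap_lin (- lam)%:C lam^-1.
- by rewrite invr_ge0 ltW.
- by move=> u h; exact: lap_bound_neg.
(* (-lam - A) w = g is the equation for A + lam with right-hand side -g. *)
- move=> g lg; have [w dw hw] := weak_solution lam0 (l2N lg).
  have lw := formdom_l2 dw.
  have lr : L2 ((- lam)%:C ** w) by exact: l2Z.
  exists w; split => //; first exact: l2B.
  move=> v fv; have lv := l2_fin fv; have := hw _ fv.
  rewrite ipBl // ipZl // ipNl // rmorphN => /(canRL (addrK _)) ->; ring.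
exists T; split => // f lf; have [_ _ _ T4 _] := hT.
have := lap_bound_neg lam0 (T4 _ lf).
by rewrite opprB addrC subrK.
Qed.

Lemma resolvent_bound_im z T : complex.Im z != 0 ->
  resolvent_op m 2%:E lap z T -> forall f, L2 f -> N (T f) <= `|complex.Im z|^-1 * N f.
Proof.
move=> z0 [_ _ _ T4 _] f lf; have := lap_bound_im z0 (T4 _ lf).
by rewrite opprB addrC subrK.
Qed.

Lemma normc_sqr_lt z (r : R) : 0 <= r ->
  complex.Re z ^+ 2 + complex.Im z ^+ 2 < r ^+ 2 -> normc z < r.
Proof. by move=> r0; rewrite -sqr_normcE ltr_pXn2r // ?nnegrE ?normc_ge0. Qed.

(** Two Neumann steps. The bound 1 / lam at -lam opens a disc of radius lam, which reaches -1 + iY;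
    the bound 1 / |Y| there opens a disc of radius |Y|, which contains a + ib. *)
Lemma lap_resolvent_nonreal z : complex.Im z != 0 ->
  exists T, resolvent_op m 2%:E lap z T.
Proof.
(* The second disc contains a + ib exactly when (a + 1)^2 + b^2 < 2 b Y; this Y makes b Y equal to
   the left side. *)
case: z => a b /= b0; pose Y := ((a + 1) ^+ 2 + b ^+ 2) / b.
have b2 : 0 < b ^+ 2 by rewrite exprn_even_gt0.
have Y0 : Y != 0.
  rewrite /Y mulf_neq0 ?invr_eq0 // gt_eqF //.
  by rewrite ltr_wpDl ?sqr_ge0.
(* The squared distance from -lam to -1 + iY is Y^4 + Y^2, less than lam^2 = (Y^2 + 1)^2. *)
pose lam := Y ^+ 2 + 1; have lam0 : 0 < lam by rewrite /lam; have := sqr_ge0 Y; lra.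
have [T1 [hT1 bT1]] := lap_resolvent_neg lam0.
have [||T2 hT2] := @neumann _ _ _ m_gt0 _ le12 lap lap_dom lap_lin (- lam)%:C
  ((-1) +i* Y) T1 lam^-1 hT1 _ bT1.
- by rewrite invr_ge0 ltW.
- rewrite ltr_pdivrMr // mul1r; apply: normc_sqr_lt; first exact: ltW.
  rewrite cReD cImD cReN cImN /= /lam; have := sqr_ge0 Y.
  have -> : (-1 - - (Y ^+ 2 + 1)) ^+ 2 + (Y - 0) ^+ 2
    = Y ^+ 2 * Y ^+ 2 + Y ^+ 2 by ring.
  have -> : (Y ^+ 2 + 1) ^+ 2 = Y ^+ 2 * Y ^+ 2 + 2 * Y ^+ 2 + 1 by ring.
  lra.
have imY : complex.Im ((-1) +i* Y) != 0 by [].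
apply: (@neumann _ _ _ m_gt0 _ le12 lap lap_dom lap_lin _ (a +i* b) T2 _ hT2 _
  (resolvent_bound_im imY hT2)); first by rewrite invr_ge0.
rewrite /= ltr_pdivrMr ?normr_gt0 // mul1r; apply: normc_sqr_lt => //.
rewrite cReD cImD cReN cImN /= real_normK ?num_real //.
have -> : (a - -1) ^+ 2 + (b - Y) ^+ 2 = Y ^+ 2 + ((a + 1) ^+ 2 + b ^+ 2 - 2 * (b * Y)).
  by ring.
rewrite gtrDl; have -> : b * Y = (a + 1) ^+ 2 + b ^+ 2 by rewrite /Y mulrC divfK.
have := sqr_ge0 (a + 1); lra.
Qed.

End ClosedForm.

(** * Edge estimates for the conjugated form *)

Section ExponentialBounds.
Variable R : realType.
Implicit Types a : R.

(** For a > 0 it comes from 1 - a <= e^(-a), which gives e^a <= 1 / (1 - a) <= 1 + 2 a up to a =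
    1/2. *)
Lemma expR_le_1D2 a : `|a| <= 2^-1 -> expR a <= 1 + 2 * `|a|.
Proof.
move=> ha; have [a0|a0] := leP a 0.
  apply: (@le_trans _ _ 1); first by rewrite -expR0 ler_expR.
  by rewrite lerDl mulr_ge0.
rewrite gtr0_norm // in ha *.
have h : 0 < 1 - a by lra.
have : expR a * (1 - a) <= 1.
  rewrite -[leRHS](expRxMexpNx_1 a) ler_wpM2l ?expR_ge0 //; exact: expR_ge1Dx.
rewrite -ler_pdivlMr // mul1r => /le_trans; apply.
rewrite -(ler_pM2r h) mulVf ?gt_eqF //.
have : 0 <= a * (1 - 2 * a) by rewrite mulr_ge0 //; lra.
lra.
Qed.

Lemma abs_expR_sub1 a : `|a| <= 2^-1 -> `|expR a - 1| <= 2 * `|a|.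
Proof.
move=> ha; rewrite ler_norml; have := expR_le_1D2 ha; have := expR_ge1Dx a.
have := ler_norm (- a); rewrite normrN; have := normr_ge0 a; lra.
Qed.

(* e^a + e^-a - 2 = (e^a - 1)^2 e^-a *)
Lemma abs_cosh_sub2 a : `|a| <= 2^-1 -> `|expR a + expR (- a) - 2| <= 8 * a ^+ 2.
Proof.
move=> ha; have := abs_expR_sub1 ha.
have : expR (- a) <= 2.
  by apply: le_trans (@expR_le_1D2 (- a) _) _; rewrite normrN //; lra.
have := expR_gt0 (- a); have := expRxMexpNx_1 a.
move: (expR a) (expR (- a)) => e e' ee' e'0 e'2 h.
have -> : e + e' - 2 = (e - 1) ^+ 2 * e'.
  have -> : (e - 1) ^+ 2 * e' = e * (e * e') - 2 * (e * e') + e' by ring.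
  by rewrite ee'; ring.
rewrite normrM (ger0_norm (ltW e'0)) normrX.
have -> : 8 * a ^+ 2 = (2 * `|a|) ^+ 2 * 2 by rewrite exprMn real_normK ?num_real; ring.
apply: ler_pM; rewrite ?(ltW e'0) ?exprn_ge0 //.
by rewrite ler_pXn2r ?nnegrE // mulr_ge0.
Qed.

End ExponentialBounds.

(* The first-order term in [a] only sees [Im P], and (Im P)^2 <= b E |beta|^2. *)
Lemma pair_estimate (R : realType) (P : R[i]) (a b al be dl eps : R) :
  0 <= eps -> eps <= 1 -> 0 <= b -> 0 <= al -> 0 <= be -> 0 <= dl ->
  normc P = b * al * be -> (0 < b -> `|a| <= 2^-1) -> `|a| <= eps * dl ->
  0 <= b * (al ^+ 2 + be ^+ 2) + 2 * complex.Re P /\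
  normc (P * (expR a - 1)%:C + conjc P * (expR (- a) - 1)%:C) <=
  eps * (2 * (b * (al ^+ 2 + be ^+ 2) + 2 * complex.Re P)
    + 8 * (b * dl ^+ 2 * (al ^+ 2 + be ^+ 2))).
Proof.
move=> e0 e1 b0 al0 be0 dl0 nP ha had.
have := sqr_normcE P; rewrite nP => sP.
have reP : - (b * al * be) <= complex.Re P.
  by have := normc_ge_abs_Re P; rewrite nP ler_norml => /andP[].
(* The energy of one edge: if P = b al be zeta with |zeta| = 1, then E = b |al + zeta be|^2. *)
set E := b * (al ^+ 2 + be ^+ 2) + 2 * complex.Re P.
have E0 : 0 <= E.
  have : 0 <= b * (al - be) ^+ 2 by rewrite mulr_ge0 ?sqr_ge0.
  rewrite /E; lra.
split => //.
move: b0; rewrite le_eqVlt => /orP[/eqP b0|b0].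
  have -> : P = 0 by apply/eqP; rewrite -normc_eq0 nP -b0 !mul0r.
  rewrite conjc0 !mul0r addr0 normc0 mulr_ge0 // addr_ge0 // mulr_ge0 //.
  by rewrite -b0 !mul0r.
have {}ha := ha b0.
(* One power of eps is given away through eps <= 1, so that first- and second-order terms share the
   factor eps. *)
have a2 : a ^+ 2 <= eps * dl ^+ 2.
  apply: (@le_trans _ _ ((eps * dl) ^+ 2)).
    by rewrite -[a ^+ 2]real_normK ?num_real // ler_pXn2r ?nnegrE // mulr_ge0.
  by rewrite exprMn ler_wpM2r ?sqr_ge0 // expr2 ler_piMr.
(* Separates the first-order part, which carries P - conj P = 2i Im P, from the second-order part
   with e^a + e^(-a) - 2. *)
have -> : P * (expR a - 1)%:C + conjc P * (expR (- a) - 1)%:C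
    = (P - conjc P) * (expR a - 1)%:C + conjc P * (expR a + expR (- a) - 2)%:C.
  rewrite (_ : expR (- a) - 1 = (expR a + expR (- a) - 2) - (expR a - 1)); last by ring.
  by rewrite (rmorphB _ (expR a + expR (- a) - 2)); ring.
apply: le_trans (ler_normcD _ _) _; rewrite !normcM !normcR normc_conjc nP.
have -> : normc (P - conjc P) = 2 * `|complex.Im P|.
  case: (P) => p1 p2 /=; rewrite /normc /= subrr expr0n add0r opprK sqrtr_sqr.
  by rewrite -mulr2n normrMn mulr_natl.
set im := `|complex.Im P|.
(* The difference of the two sides is the square (Re P + b be^2)^2. *)
have im2 : im ^+ 2 <= b * E * be ^+ 2.
  rewrite /im real_normK ?num_real //.
  have -> : complex.Im P ^+ 2 = (b * al * be) ^+ 2 - complex.Re P ^+ 2 by rewrite sP; ring.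
  have : 0 <= (complex.Re P + b * be ^+ 2) ^+ 2 by exact: sqr_ge0.
  rewrite /E; lra.
have tri c : 0 <= eps * (b * dl ^+ 2 * c ^+ 2).
  apply: mulr_ge0 => //; apply: mulr_ge0; last exact: sqr_ge0.
  by apply: mulr_ge0; [exact: ltW|exact: sqr_ge0].
have imd : 2 * (im * dl) <= E + b * dl ^+ 2 * be ^+ 2.
  have r0 : 0 <= E + b * dl ^+ 2 * be ^+ 2.
    by rewrite addr_ge0 // !mulr_ge0 ?sqr_ge0 // ltW.
  rewrite -(ler_pXn2r (n := 2)) ?nnegrE // ?mulr_ge0 ?normr_ge0 //.
  have : 0 <= (E - b * dl ^+ 2 * be ^+ 2) ^+ 2 by exact: sqr_ge0.
  have := ler_wpM2r (sqr_ge0 dl) im2.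
  have -> : (2 * (im * dl)) ^+ 2 = 4 * (im ^+ 2 * dl ^+ 2) by ring.
  lra.
have first : 2 * im * `|expR a - 1| <= eps * (2 * (E + b * dl ^+ 2 * be ^+ 2)).
  apply: (@le_trans _ _ (2 * im * (2 * (eps * dl)))).
    apply: ler_wpM2l; first by rewrite mulr_ge0 // normr_ge0.
    by apply: le_trans (abs_expR_sub1 ha) _; rewrite ler_wpM2l.
  have := ler_wpM2l e0 imd; lra.
have second : b * al * be * `|expR a + expR (- a) - 2|
    <= eps * (4 * (b * dl ^+ 2 * (al ^+ 2 + be ^+ 2))).
  apply: (@le_trans _ _ (b * al * be * (8 * (eps * dl ^+ 2)))).
    apply: ler_wpM2l; first by rewrite !mulr_ge0 // ltW.
    by apply: le_trans (abs_cosh_sub2 ha) _; rewrite ler_wpM2l.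
  have := tri (al - be); lra.
apply: le_trans (lerD first second) _.
have := tri al; have := tri be; lra.
Qed.

Definition mulE (R : realType) (X : choiceType) (phi : X -> R) (u : X -> R[i]) :
  X -> R[i] := fun x => (expR (phi x))%:C * u x.

Lemma sum_fset_pick (V : zmodType) (X : choiceType) (F : {fset X}) (x : X) (c : X -> V) :
  x \in F -> \sum_(y <- F) (if x == y then c y else 0) = c x.
Proof.
move=> xF; rewrite (big_fsetD1 x) //= eqxx big_seq big1 ?addr0 // => y.
by rewrite !inE eq_sym => /andP[/negbTE ->].
Qed.

(** * Conjugating the form by exponential weights *)

Section TwistedForm.
Variables (R : realType) (X : choiceType) (m : X -> R).
Hypothesis m_gt0 : forall x, 0 < m x.
Local Notation ip := (ip m).
Local Notation L2 := (lpmem m 2%:E).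
Local Notation N := (nrm m 2%:E).
Local Notation l2D := (l2D m_gt0).
Local Notation l2B := (l2B m_gt0).
Local Notation l2Z := (l2Z m_gt0).
Local Notation l2N := (l2N m_gt0).
Local Notation cvg2 := (cvg_lp m 2%:E).
Implicit Types (f g h u v w : X -> R[i]) (a z : R[i]) (F : {fset X}) (phi : X -> R).

Variable G : X -> X -> R[i].
Hypothesis G_l2 : forall x, L2 (G x).
Local Notation D := (opD m G).
Hypothesis D_ind1 : forall x, L2 (D (ind1 R x)).

Let q x y := ip (D (ind1 R x)) (D (ind1 R y)).

Variables (b d : X -> X -> R) (cneg : X -> R) (s Mf Cf : R).
Hypothesis b_def : forall x y, b x y = if x == y then 0 else normc (q x y).
Hypothesis d_ge0 : forall x y, 0 <= d x y.
Hypothesis d_sym : forall x y, d x y = d y x.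
Hypothesis intrinsic : forall x F, \sum_(y <- F) b x y * d x y ^+ 2 <= m x.
Hypothesis jump : forall x y, 0 < b x y -> d x y <= s.
Hypothesis s_gt0 : 0 < s.
Hypothesis Mf_ge0 : 0 <= Mf.
Hypothesis Cf_ge0 : 0 <= Cf.
Hypothesis cneg_ge : forall x F,
  - cneg x <= N (D (ind1 R x)) ^+ 2 - \sum_(y <- F) b x y.
Hypothesis cneg_bounded : forall w F, finsupp_fun w ->
  \sum_(x <- F) cneg x * normc (w x) ^+ 2 <= Mf * N (D w) ^+ 2 + Cf * N w ^+ 2.

Lemma q_conj x y : q y x = conjc (q x y).
Proof. exact: ip_sym. Qed.

Lemma b_ge0 x y : 0 <= b x y.
Proof. by rewrite b_def; case: ifP => // _; exact: normc_ge0. Qed.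

Lemma b_sym x y : b x y = b y x.
Proof. by rewrite !b_def eq_sym q_conj normc_conjc. Qed.

Lemma ip_D_restrict F u v : ip (D (restrict F u)) (D (restrict F v))
  = \sum_(x <- F) \sum_(y <- F) u x * conjc (v y) * q x y.
Proof.
have li c x : L2 (c ** ind1 R x) by apply: l2Z; exact: ind1_lp.
have lD c x : L2 (D (c ** ind1 R x)).
  by rewrite D_Z //; [exact: l2Z|exact: ind1_lp].
rewrite !restrictE !D_sum // ip_suml //; last exact: lp_sum.
apply: eq_bigr => x _; rewrite ip_sumr //; apply: eq_bigr => y _.
rewrite !D_Z //; try exact: ind1_lp.
by rewrite ipZl ?ipZr //; [rewrite /q; ring|exact: l2Z].
Qed.

Lemma mulE_restrict phi F u : mulE phi (restrict F u) = restrict F (mulE phi u).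
Proof. by apply/funext => x; rewrite /mulE /restrict; case: ifP => //; rewrite mulr0. Qed.

(** The perturbation caused by conjugation, as in Davies' method. The first argument carries
    e^(-phi), so that for u = e^phi w the conjugated form at (u, v) is the original one at (w, e^phi
    v). *)
Definition twist phi u v := ip (D (mulE (\- phi) u)) (D (mulE phi v)) - ip (D u) (D v).

(** Half of 2 * 2 ((1 + Mf) Q + Cf A) + 8 * 2 A, the sums of edge energies and of metric terms with
    Q = |D u|^2 and A = |u|^2, rounded up to a multiple of Q + A. *)
Definition twist_const := 2 * Mf + 2 * Cf + 10.

(** The perturbation is a double sum, controlled pair by pair through [pair_estimate]. The edge
    energies are then summed by the form bound and the metric terms by the intrinsic metric
    condition. *)
Lemma twist_fin phi (eps : R) u : 0 <= eps -> eps <= 1 -> eps * s <= 2^-1 ->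
  (forall x y, `|phi x - phi y| <= eps * d x y) -> finsupp_fun u ->
  normc (twist phi u u) <= eps * twist_const * (N (D u) ^+ 2 + N u ^+ 2).
Proof.
move=> e0 e1 es hphi fu; have [F [uE uF]] := finsupp_restrict fu.
pose P x y := u x * conjc (u y) * q x y.
(* On the diagonal e^(a x x) - 1 = 0, so deleting those terms changes nothing and makes the modulus
   of the rest equal to b |u x| |u y| everywhere. *)
pose P' x y := if x == y then 0 else P x y.
pose a x y := phi y - phi x.
pose al x := normc (u x).
pose E x y := b x y * (al x ^+ 2 + al y ^+ 2) + 2 * complex.Re (P' x y).
have al0 x : 0 <= al x by exact: normc_ge0.
have P'sym x y : P' y x = conjc (P' x y).
  rewrite /P' eq_sym; case: ifP => _; first by rewrite conjc0.
  by rewrite /P q_conj !conjc_mul conjcK; ring.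
have nP' x y : normc (P' x y) = b x y * al x * al y.
  rewrite /P' b_def; case: ifP => _; first by rewrite normc0 !mul0r.
  by rewrite /P !normcM normc_conjc /al; ring.
have est x y : 0 <= E x y /\
    normc (P' x y * (expR (a x y) - 1)%:C + conjc (P' x y) * (expR (- a x y) - 1)%:C)
    <= eps * (2 * E x y + 8 * (b x y * d x y ^+ 2 * (al x ^+ 2 + al y ^+ 2))).
  apply: pair_estimate => //; first exact: b_ge0.
    move=> /jump dxy; apply: le_trans (hphi y x) _; rewrite d_sym.
    by apply: le_trans es; rewrite ler_wpM2l.
  by rewrite d_sym; exact: hphi.
have twE : twist phi u u = \sum_(x <- F) \sum_(y <- F) P' x y * (expR (a x y) - 1)%:C.
  rewrite /twist uE !mulE_restrict !ip_D_restrict -sumrB; apply: eq_bigr => x _.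
  rewrite -sumrB; apply: eq_bigr => y _.
  have key : (expR (- phi x))%:C * (expR (phi y))%:C = (expR (a x y))%:C :> R[i].
    by rewrite -rmorphM -expRD addrC.
  transitivity (P x y * ((expR (a x y))%:C - 1)).
    by rewrite -key /P /mulE conjc_mul conjc_real; ring.
  rewrite (rmorphB _ (expR (a x y))) rmorph1 /P'; case: eqP => [->|//].
  by rewrite /a subrr expR0 rmorph1 subrr !mulr0.
(* Doubling joins the terms (x, y) and (y, x); the first-order term is small only after this
   symmetrisation. *)
have tw2 : 2 * twist phi u u = \sum_(x <- F) \sum_(y <- F)
    (P' x y * (expR (a x y) - 1)%:C + conjc (P' x y) * (expR (- a x y) - 1)%:C).
  rewrite mulr_natl mulr2n {1}twE twE [X in _ + X]exchange_big -big_split.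
  apply: eq_bigr => x _; rewrite -big_split; apply: eq_bigr => y _ /=.
  by rewrite (P'sym x y) /a opprB.
have tw2_le : 2 * normc (twist phi u u) <= \sum_(x <- F) \sum_(y <- F)
    eps * (2 * E x y + 8 * (b x y * d x y ^+ 2 * (al x ^+ 2 + al y ^+ 2))).
  have -> : 2 * normc (twist phi u u) = normc (2 * twist phi u u).
    by rewrite normcM -(rmorph_nat (real_complex R)) normcR normr_nat.
  rewrite tw2; apply: le_trans (ler_normc_sum _ _ _) _; apply: ler_sum => x _.
  apply: le_trans (ler_normc_sum _ _ _) _; apply: ler_sum => y _.
  by case: (est x y).
have sym2 (c : X -> X -> R) : (forall x y, c x y = c y x) ->
    \sum_(x <- F) \sum_(y <- F) c x y * (al x ^+ 2 + al y ^+ 2)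
    = 2 * \sum_(x <- F) (\sum_(y <- F) c x y) * al x ^+ 2.
  move=> csym.
  have -> : \sum_(x <- F) \sum_(y <- F) c x y * (al x ^+ 2 + al y ^+ 2)
    = \sum_(x <- F) \sum_(y <- F) c x y * al x ^+ 2
      + \sum_(x <- F) \sum_(y <- F) c x y * al y ^+ 2.
    rewrite -big_split; apply: eq_bigr => x _; rewrite -big_split.
    by apply: eq_bigr => y _ /=; ring.
  rewrite [X in _ + X]exchange_big mulr_natl mulr2n; congr (_ + _).
    by apply: eq_bigr => x _; rewrite mulr_suml.
  apply: eq_bigr => x _; rewrite mulr_suml; apply: eq_bigr => y _.
  by rewrite csym.
have sumd : \sum_(x <- F) \sum_(y <- F) b x y * d x y ^+ 2 * (al x ^+ 2 + al y ^+ 2)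
    <= 2 * N u ^+ 2.
  rewrite (sym2 (fun x y => b x y * d x y ^+ 2)); last first.
    by move=> x y; rewrite b_sym d_sym.
  rewrite ler_wpM2l //; apply: le_trans (l2_sum_le m_gt0 F (l2_fin m_gt0 fu)).
  by apply: ler_sum => x _; rewrite ler_wpM2r ?sqr_ge0.
have QE : N (D u) ^+ 2 = \sum_(x <- F) al x ^+ 2 * N (D (ind1 R x)) ^+ 2
    + \sum_(x <- F) \sum_(y <- F) complex.Re (P' x y).
  have := ip_self m_gt0 (D_fin_l2 m_gt0 G_l2 D_ind1 fu).
  rewrite {1 2}uE ip_D_restrict => /(congr1 (@complex.Re R)) /= <-.
  rewrite -big_split Re_sum big_seq [RHS]big_seq; apply: eq_bigr => x xF /=.
  rewrite Re_sum.
  have <- : complex.Re (P x x) = al x ^+ 2 * N (D (ind1 R x)) ^+ 2.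
    by rewrite /P mulc_conj /q ip_self // -rmorphM.
  rewrite -(sum_fset_pick (fun y => complex.Re (P x y)) xF) -big_split.
  apply: eq_bigr => y _ /=; rewrite /P'; case: eqP => _; first by rewrite addr0.
  by rewrite add0r.
(* The sum of E is twice the form with Q(1_x) replaced by the degree of x within F. That degree
   exceeds Q(1_x) by at most [cneg x], and the form bound controls the excess. *)
have sumE : \sum_(x <- F) \sum_(y <- F) E x y
    <= 2 * ((1 + Mf) * N (D u) ^+ 2 + Cf * N u ^+ 2).
  have -> : \sum_(x <- F) \sum_(y <- F) E x y
    = 2 * (\sum_(x <- F) (\sum_(y <- F) b x y) * al x ^+ 2
      + \sum_(x <- F) \sum_(y <- F) complex.Re (P' x y)).
    rewrite mulrDr -sym2; last exact: b_sym.
    rewrite mulr_sumr -big_split; apply: eq_bigr => x _.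
    by rewrite mulr_sumr -big_split.
  rewrite ler_wpM2l //.
  have := cneg_bounded F fu.
  have : \sum_(x <- F) (\sum_(y <- F) b x y) * al x ^+ 2
      <= \sum_(x <- F) al x ^+ 2 * N (D (ind1 R x)) ^+ 2
       + \sum_(x <- F) cneg x * al x ^+ 2.
    rewrite -big_split; apply: ler_sum => x _ /=.
    have := cneg_ge x F; have := sqr_ge0 (al x).
    move: (\sum_(y <- F) b x y) (al x ^+ 2) (N _ ^+ 2) (cneg x) => B A Q c A0 h.
    have : B <= Q + c by lra.
    by move=> /(ler_wpM2r A0); rewrite mulrDl (mulrC Q).
  rewrite mulrDl mul1r QE; lra.
have := tw2_le.
have -> : \sum_(x <- F) \sum_(y <- F)
    eps * (2 * E x y + 8 * (b x y * d x y ^+ 2 * (al x ^+ 2 + al y ^+ 2)))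
  = eps * (2 * \sum_(x <- F) \sum_(y <- F) E x y
    + 8 * \sum_(x <- F) \sum_(y <- F) b x y * d x y ^+ 2 * (al x ^+ 2 + al y ^+ 2)).
  rewrite !mulr_sumr -big_split mulr_sumr; apply: eq_bigr => x _.
  by rewrite /= !mulr_sumr -big_split mulr_sumr.
have := sqr_ge0 (N (D u)); have := sqr_ge0 (N u).
move: sumE sumd; rewrite /twist_const.
move: (\sum_(x <- F) _) (\sum_(x <- F) _) (normc _) (N u ^+ 2) (N (D u) ^+ 2).
move=> S2 S1 B A Q h1 h2 A0 Q0 h3.
have MA := mulr_ge0 Mf_ge0 A0; have CQ := mulr_ge0 Cf_ge0 Q0.
have h : 2 * S1 + 8 * S2 <= 2 * ((2 * Mf + 2 * Cf + 10) * (Q + A)) by lra.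
have := ler_wpM2l e0 h; lra.
Qed.


Lemma cvg_cauchy (un : nat -> X -> R[i]) u : (forall n, L2 (un n)) -> L2 u ->
  cvg2 un u -> cauchy_lp m 2%:E un.
Proof.
move=> lun lu h e e0; have [K hK] := h (e / 2) ltac:(lra).
exists K => n k /hK hn /hK hk.
have -> : un n - un k = (un n - u) - (un k - u) by fext.
have := nrmB m_gt0 le12 (l2B (lun n) lu) (l2B (lun k) lu); lra.
Qed.

Lemma cvg_sum (l : seq X) (cn : nat -> X -> R[i]) (c : X -> R[i]) (v : X -> X -> R[i]) :
  (forall x, L2 (v x)) -> cvg_pt cn c ->
  cvg2 (fun n => \sum_(x <- l) cn n x ** v x) (\sum_(x <- l) c x ** v x).
Proof.
move=> lv hc; elim: l => [|x l IH].
  by move=> e e0; exists 0%N => n _; rewrite !big_nil subrr nrm0 // ltW.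
move=> e e0; have c0 : 0 < N (v x) + 1 by have := nrm_ge0 m 2%:E (v x); lra.
have e1 : 0 < e / 2 / (N (v x) + 1) by rewrite !divr_gt0.
have [K1 h1] := hc x _ e1; have [K2 h2] := IH (e / 2) ltac:(lra).
have ls (c' : X -> R[i]) : L2 (\sum_(y <- l) c' y ** v y).
  by apply: lp_sum => // y; exact: l2Z.
exists (maxn K1 K2) => n; rewrite geq_max => /andP[/h1 {}h1 /h2 {}h2].
rewrite !big_cons.
have -> : cn n x ** v x + \sum_(y <- l) cn n y ** v y
    - (c x ** v x + \sum_(y <- l) c y ** v y)
  = (cn n x - c x) ** v x + (\sum_(y <- l) cn n y ** v y - \sum_(y <- l) c y ** v y).
  by rewrite cscaleBl opprD addrACA.
apply: le_trans (nrmD m_gt0 le12 (l2Z _ (lv x)) (l2B (ls _) (ls _))) _.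
rewrite nrm2Z //.
have : normc (cn n x - c x) * N (v x) <= e / 2.
  by rewrite mulrC; apply: ler_mul_div1; rewrite ?normc_ge0 ?nrm_ge0.
lra.
Qed.

Section LocallyConstantWeight.
Variables (phi : X -> R) (F0 : {fset X}) (k : R).
Hypothesis phi_const : forall x, x \notin F0 -> phi x = k.

(** Reason for weights that are constant off a finite set: multiplication by e^phi is then a scalar
    plus a finite-rank operator into finitely supported functions, so it preserves l^2 and the form
    domain. *)
Lemma mulE_decomp u : mulE phi u = (expR k)%:C ** u
  + \sum_(x <- F0) (((expR (phi x))%:C - (expR k)%:C) * u x) ** ind1 R x.
Proof.
rewrite -(restrictE F0 (fun x => ((expR (phi x))%:C - (expR k)%:C) * u x)).
apply/funext => x; rewrite /mulE /restrict /cscale !fctE.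
by case: ifPn => [_|/phi_const ->]; [ring|rewrite addr0].
Qed.

Lemma mulE_l2 u : L2 u -> L2 (mulE phi u).
Proof.
move=> lu; rewrite mulE_decomp; apply: l2D; first exact: l2Z.
by apply: lp_sum => // x; apply: l2Z; exact: ind1_lp.
Qed.

Lemma mulE_fin u : finsupp_fun u -> finsupp_fun (mulE phi u).
Proof.
apply: sub_finite_set => x /=; apply: contra_neq => u0.
by rewrite /mulE u0 mulr0.
Qed.

Lemma D_mulE u : L2 u -> D (mulE phi u) = (expR k)%:C ** D u
  + \sum_(x <- F0) (((expR (phi x))%:C - (expR k)%:C) * u x) ** D (ind1 R x).
Proof.
move=> lu; have l1 c x : L2 (c ** ind1 R x) by apply: l2Z; exact: ind1_lp.
rewrite mulE_decomp D_lin //; last exact: lp_sum.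
congr (_ + _); rewrite D_sum //; apply: eq_bigr => x _.
by rewrite D_Z //; exact: ind1_lp.
Qed.

Lemma form_seq_mulE u un : formdom m G u -> form_seq m G u un ->
  form_seq m G (mulE phi u) (fun n => mulE phi (un n)).
Proof.
move=> du su; have [lu _] := du; have [fun_ cun cDun] := su.
have [lDu cDu] := form_seq_cvg m_gt0 G_l2 D_ind1 lu su.
have ln n : L2 (un n) by apply: l2_fin.
have lDn n : L2 (D (un n)) by apply: D_fin_l2.
pose c' (w : X -> R[i]) x := ((expR (phi x))%:C - (expR k)%:C) * w x.
have hc : cvg_pt (fun n => c' (un n)) (c' u).
  move=> x e e0; have := @cvg_lp_pt _ _ _ m_gt0 _ le12 _ _ ln lu cun x.
  set C := normc ((expR (phi x))%:C - (expR k)%:C) + 1.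
  have C0 : 0 < C by rewrite /C; have := normc_ge0 ((expR (phi x))%:C - (expR k)%:C); lra.
  move=> /(_ _ (divr_gt0 e0 C0))[K hK]; exists K => n /hK hn.
  rewrite /c' -mulrBr normcM; apply: (@le_trans _ _ (C * (e / C))).
    by apply: ler_pM => //; rewrite ?normc_ge0 // lerDl.
  by rewrite mulrC divfK // gt_eqF.
have ls (v : X -> X -> R[i]) w : (forall x, L2 (v x)) ->
    L2 (\sum_(x <- F0) c' w x ** v x).
  by move=> lv; apply: lp_sum => // x; exact: l2Z.
have li x : L2 (ind1 R x) by exact: ind1_lp.
split.
- by move=> n; exact: mulE_fin.
- have -> : (fun n => mulE phi (un n)) = fun n => (expR k)%:C ** un n
      + \sum_(x <- F0) c' (un n) x ** ind1 R x.
    by apply/funext => n; rewrite mulE_decomp.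
  have -> : mulE phi u = (expR k)%:C ** u + \sum_(x <- F0) c' u x ** ind1 R x.
    exact: mulE_decomp.
  by apply: cvg_lin => //; [move=> n; exact: ls|exact: ls|exact: cvg_sum].
- have -> : (fun n => D (mulE phi (un n))) = fun n => (expR k)%:C ** D (un n)
      + \sum_(x <- F0) c' (un n) x ** D (ind1 R x).
    by apply/funext => n; rewrite D_mulE.
  apply: (@cvg_cauchy _ ((expR k)%:C ** D u + \sum_(x <- F0) c' u x ** D (ind1 R x))).
  + by move=> n; apply: l2D; [exact: l2Z|exact: ls].
  + by apply: l2D; [exact: l2Z|exact: ls].
  + by apply: cvg_lin => //; [move=> n; exact: ls|exact: ls|exact: cvg_sum].
Qed.

Lemma formdom_mulE u : formdom m G u -> formdom m G (mulE phi u).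
Proof.
move=> du; have [lu [un su]] := du; split; first exact: mulE_l2.
by exists (fun n => mulE phi (un n)); exact: form_seq_mulE.
Qed.

Lemma ip_mulE u v : ip (mulE phi u) v = ip u (mulE phi v).
Proof.
rewrite !ipE /pairing; congr csum; apply/funext => x.
by rewrite /mulE conjc_mul conjc_real; ring.
Qed.

End LocallyConstantWeight.

Lemma ip_cvg2 (un vn : nat -> X -> R[i]) u v : (forall n, L2 (un n)) ->
  (forall n, L2 (vn n)) -> L2 u -> L2 v -> cvg2 un u -> cvg2 vn v ->
  forall e, 0 < e -> exists K : nat, forall n, (K <= n)%N ->
    normc (ip (un n) (vn n) - ip u v) <= e.
Proof.
move=> lun lvn lu lv hu hv e e0.
pose Cu := N u + 1; pose Cv := N v + 1.
have Cu0 : 0 < Cu by have := nrm_ge0 m 2%:E u; rewrite /Cu; lra.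
have Cv0 : 0 < Cv by have := nrm_ge0 m 2%:E v; rewrite /Cv; lra.
have e1 : 0 < e / 2 / Cv by rewrite !divr_gt0.
(* The cap 1 keeps N(vn) below N(v) + 1 = [Cv]. *)
have e2 : 0 < Num.min (e / 2 / Cu) 1 by rewrite lt_min ltr01 !divr_gt0.
have [K1 h1] := hu _ e1; have [K2 h2] := hv _ e2.
exists (maxn K1 K2) => n; rewrite geq_max => /andP[/h1 {}h1 /h2].
rewrite le_min => /andP[{}h2 h3].
have lun' := l2B (lun n) lu; have lvn' := l2B (lvn n) lv.
have -> : ip (un n) (vn n) - ip u v = ip (un n - u) (vn n) + ip u (vn n - v).
  by rewrite ipBl ?ipBr //; ring.
apply: le_trans (ler_normcD _ _) _.
have Nvn : N (vn n) <= Cv.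
  rewrite -(subrK v (vn n)); apply: le_trans (nrmD m_gt0 le12 lvn' lv) _.
  by rewrite /Cv; lra.
have b1 : normc (ip (un n - u) (vn n)) <= e / 2.
  apply: le_trans (ip_CS m_gt0 lun' (lvn n)) _.
  apply: (@le_trans _ _ (e / 2 / Cv * Cv)); last by rewrite divfK // gt_eqF.
  by apply: ler_pM => //; rewrite nrm_ge0.
have b2 : normc (ip u (vn n - v)) <= e / 2.
  apply: le_trans (ip_CS m_gt0 lu lvn') _.
  apply: (@le_trans _ _ (Cu * (e / 2 / Cu))); last by rewrite mulrC divfK // gt_eqF.
  by apply: ler_pM => //; rewrite ?nrm_ge0 // /Cu; lra.
lra.
Qed.

Lemma sqr_nrm_cvg (un : nat -> X -> R[i]) u : (forall n, L2 (un n)) -> L2 u ->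
  cvg2 un u -> forall e, 0 < e -> exists K : nat, forall n, (K <= n)%N ->
    N (un n) ^+ 2 <= N u ^+ 2 + e.
Proof.
move=> lun lu hu e e0; have [K hK] := ip_cvg2 lun lun lu lu hu hu e0.
exists K => n /hK; rewrite !ip_self // -rmorphB normcR ler_norml; lra.
Qed.

Definition sqr_fnorm u := N (D u) ^+ 2 + N u ^+ 2.

Section TwistEstimate.
Variables (phi : X -> R) (F0 : {fset X}) (k eps : R).
Hypothesis phi_const : forall x, x \notin F0 -> phi x = k.
Hypothesis eps_ge0 : 0 <= eps.
Hypothesis eps_le1 : eps <= 1.
Hypothesis eps_s : eps * s <= 2^-1.
Hypothesis phi_lip : forall x y, `|phi x - phi y| <= eps * d x y.

Local Notation kap := (eps * twist_const).

Let kap_ge0 : 0 <= kap.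
Proof.
rewrite /twist_const; apply: mulr_ge0 => //.
by rewrite !addr_ge0 // mulr_ge0.
Qed.

Let phiN_const x : x \notin F0 -> (\- phi) x = - k.
Proof. by move=> /phi_const /= ->. Qed.

Lemma twist_formdom u : formdom m G u ->
  normc (twist phi u u) <= kap * sqr_fnorm u.
Proof.
move=> du; have [lu [un su]] := du; have [fun_ cun _] := su.
have ln n : L2 (un n) by apply: l2_fin.
have lDn n : L2 (D (un n)) by apply: D_fin_l2.
have [lDu cDu] := form_seq_cvg m_gt0 G_l2 D_ind1 lu su.
have [lPu cPu] := form_seq_cvg m_gt0 G_l2 D_ind1 (mulE_l2 phi_const lu)
  (form_seq_mulE phi_const du su).
have [lMu cMu] := form_seq_cvg m_gt0 G_l2 D_ind1 (mulE_l2 phiN_const lu)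
  (form_seq_mulE phiN_const du su).
have lPn n : L2 (D (mulE phi (un n))) by apply: D_fin_l2 => //; exact: mulE_fin.
have lMn n : L2 (D (mulE (\- phi) (un n))) by apply: D_fin_l2 => //; exact: mulE_fin.
apply/ler_addgt0Pr => e e0.
have k0 := kap_ge0.
(* Two errors e / c come from the two forms in [twist], and two more, multiplied by [kap], from the
   form norm. *)
pose c := 2 * kap + 2; have c0 : 0 < c by rewrite /c; lra.
have e' : 0 < e / c by rewrite divr_gt0.
have [K1 h1] := ip_cvg2 lMn lPn lMu lPu cMu cPu e'.
have [K2 h2] := ip_cvg2 lDn lDn lDu lDu cDu cDu e'.
have [K3 h3] := sqr_nrm_cvg lDn lDu cDu e'.
have [K4 h4] := sqr_nrm_cvg ln lu cun e'.
pose n := maxn (maxn K1 K2) (maxn K3 K4).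
have {}h1 := h1 n (leq_trans (leq_maxl _ _) (leq_maxl _ _)).
have {}h2 := h2 n (leq_trans (leq_maxr _ _) (leq_maxl _ _)).
have {}h3 := h3 n (leq_trans (leq_maxl _ _) (leq_maxr _ _)).
have {}h4 := h4 n (leq_trans (leq_maxr _ _) (leq_maxr _ _)).
have tn := twist_fin eps_ge0 eps_le1 eps_s phi_lip (fun_ n).
have : normc (twist phi u u) <= normc (twist phi (un n) (un n)) + (e / c + e / c).
  rewrite /twist; move: h1 h2; set A := ip _ _; set B := ip _ _; set A' := ip _ _.
  set B' := ip _ _ => h1 h2.
  have -> : B - B' = (A - A') - ((A - B) - (A' - B')) by ring.
  have := ler_normcB (A - A') ((A - B) - (A' - B')); have := ler_normcB (A - B) (A' - B').
  lra.
move=> /le_trans; apply.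
have : kap * sqr_fnorm (un n) <= kap * (sqr_fnorm u + (e / c + e / c)).
  by rewrite ler_wpM2l // /sqr_fnorm; lra.
have ec : e / c * c = e by rewrite divfK // gt_eqF.
move: tn; rewrite -/(sqr_fnorm _); rewrite /c in ec *; lra.
Qed.

Lemma twist_sesqui_l u1 u2 v a : formdom m G u1 -> formdom m G u2 -> formdom m G v ->
  twist phi (a ** u1 + u2) v = a * twist phi u1 v + twist phi u2 v.
Proof.
move=> d1 d2 dv.
have lm w : formdom m G w -> L2 (D (mulE (\- phi) w)).
  by move=> dw; apply: formdom_Dl2 => //; exact: (formdom_mulE phiN_const).
have lp' w : formdom m G w -> L2 (D (mulE phi w)).
  by move=> dw; apply: formdom_Dl2 => //; exact: (formdom_mulE phi_const).
have lD w : formdom m G w -> L2 (D w) by move=> dw; exact: formdom_Dl2.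
have l2 w : formdom m G w -> L2 w by exact: formdom_l2.
have E : mulE (\- phi) (a ** u1 + u2) = a ** mulE (\- phi) u1 + mulE (\- phi) u2.
  by apply/funext => x; rewrite /mulE /cscale !fctE; ring.
rewrite /twist E !D_lin //; try exact: l2; try by apply/(mulE_l2 phiN_const)/l2.
by rewrite !ip_linl //; try exact: lm; try exact: lp'; try exact: lD; ring.
Qed.

Lemma twist_sesqui_r u v1 v2 a : formdom m G u -> formdom m G v1 -> formdom m G v2 ->
  twist phi u (a ** v1 + v2) = conjc a * twist phi u v1 + twist phi u v2.
Proof.
move=> d0 d1 d2.
have lm w : formdom m G w -> L2 (D (mulE (\- phi) w)).
  by move=> dw; apply: formdom_Dl2 => //; exact: (formdom_mulE phiN_const).
have lp' w : formdom m G w -> L2 (D (mulE phi w)).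
  by move=> dw; apply: formdom_Dl2 => //; exact: (formdom_mulE phi_const).
have lD w : formdom m G w -> L2 (D w) by move=> dw; exact: formdom_Dl2.
have l2 w : formdom m G w -> L2 w by exact: formdom_l2.
have E : mulE phi (a ** v1 + v2) = a ** mulE phi v1 + mulE phi v2.
  by apply/funext => x; rewrite /mulE /cscale !fctE; ring.
rewrite /twist E !D_lin //; try exact: l2; try by apply/(mulE_l2 phi_const)/l2.
rewrite !ipDr //; try (by apply/l2Z/lp'); try (by apply/l2Z/lD);
  try exact: lm; try exact: lp'; try exact: lD.
rewrite !ipZr //; try exact: lm; try exact: lp'; try exact: lD; ring.
Qed.

Lemma sqr_fnormD u v a : formdom m G u -> formdom m G v -> normc a = 1 ->
  sqr_fnorm (a ** v + u) + sqr_fnorm ((- a) ** v + u)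
  = 2 * (sqr_fnorm u + sqr_fnorm v).
Proof.
move=> du dv a1; rewrite /sqr_fnorm.
have lu := formdom_l2 du; have lv := formdom_l2 dv.
have lDu := formdom_Dl2 m_gt0 G_l2 D_ind1 du.
have lDv := formdom_Dl2 m_gt0 G_l2 D_ind1 dv.
have lav := l2Z a lv; have laDv := l2Z a lDv.
rewrite !D_lin // cscaleNl cscaleNl !nrm2_sqrD //; try exact: l2N.
rewrite !ipNl // !nrmN // !nrm2Z // a1 !cReN; ring.
Qed.

(** Polarisation over 1, -1, i, -i; the parallelogram identity for [sqr_fnorm] makes the constant
    come out unchanged. *)
Lemma twist_bound u v : formdom m G u -> formdom m G v ->
  normc (twist phi u v) <= kap * (sqr_fnorm u + sqr_fnorm v).
Proof.
move=> du dv.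
have t a : twist phi (a ** v + u) (a ** v + u) = a * conjc a * twist phi v v
    + a * twist phi v u + conjc a * twist phi u v + twist phi u u.
  have dav : formdom m G (a ** v + u) by exact: formdom_lin.
  by rewrite twist_sesqui_l // !twist_sesqui_r //; ring.
have fd a : formdom m G (a ** v + u) by exact: formdom_lin.
have n1 : normc (1 : R[i]) = 1 by exact: normc1.
have ni : normc ('i : R[i])%C = 1 by rewrite /normc /= expr0n expr1n add0r sqrtr1.
have ii : ('i * 'i : R[i])%C = -1.
  by apply/eqP; rewrite eq_complex /=; apply/andP; split; apply/eqP; ring.
have ci : conjc ('i : R[i])%C = - ('i)%C.
  by apply/eqP; rewrite eq_complex /=; apply/andP; split; apply/eqP; ring.
pose w a := a ** v + u.
(* In the sum of a twist(w a, w a) over the four roots a, the term twist(u, v) has coefficient a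
   conj(a) = 1 each time, and every other term cancels. *)
have E : 4 * twist phi u v = twist phi (w 1) (w 1) - twist phi (w (- 1)) (w (- 1))
   + 'i%C * twist phi (w 'i%C) (w 'i%C) - 'i%C * twist phi (w (- 'i%C)) (w (- 'i%C)).
  rewrite /w !t !conjc_opp conjc1 ci.
  have -> : forall A B C E0 : R[i], 'i%C * ('i%C * - 'i%C * A + 'i%C * B + - 'i%C * C + E0)
     = ('i%C * 'i%C) * (- 'i%C * A + B - C) + 'i%C * E0 by move=> *; ring.
  have -> : forall A B C E0 : R[i], 'i%C * (- 'i%C * - - 'i%C * A + - 'i%C * B + - - 'i%C * C + E0)
     = ('i%C * 'i%C) * (- 'i%C * A - B + C) + 'i%C * E0 by move=> *; ring.
  rewrite ii; ring.
have e4 : 4 * normc (twist phi u v) = normc (4 * twist phi u v).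
  by rewrite normcM -(rmorph_nat (real_complex R)) normcR normr_nat.
have h : 4 * normc (twist phi u v) <= kap * (sqr_fnorm (w 1) + sqr_fnorm (w (-1)))
   + kap * (sqr_fnorm (w 'i%C) + sqr_fnorm (w (- 'i%C))).
  rewrite e4 E.
  apply: le_trans (ler_normcB _ _) _; rewrite normcM ni mul1r.
  have h1 := twist_formdom (fd 1); have h2 := twist_formdom (fd (-1)).
  have h3 := twist_formdom (fd 'i%C); have h4 := twist_formdom (fd (- 'i%C)).
  rewrite -/(w _) in h1 h2 h3 h4.
  have := ler_normcD (twist phi (w 1) (w 1) - twist phi (w (- 1)) (w (- 1)))
    ('i%C * twist phi (w 'i%C) (w 'i%C)).
  rewrite normcM ni mul1r.
  have := ler_normcB (twist phi (w 1) (w 1)) (twist phi (w (- 1)) (w (- 1))).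
  lra.
move: h; rewrite !sqr_fnormD //; lra.
Qed.

End TwistEstimate.

Lemma nrm_ind1 x : N (ind1 R x) ^+ 2 = m x.
Proof.
have := ip_self m_gt0 (ind1_lp m_gt0 le12 x).
by rewrite pairing_ind1 /ind1 eqxx mulr1 => /complexI.
Qed.

(** Here A = |u|, Q = |D u|^2 and gam = |g|. The first inequality gives Q <= (2 + 2 zz) A^2 + gam^2;
    inserted in the second, smallness of k leaves at most A^2 / 2 on the right, which is
    absorbed. *)
Lemma twisted_a_priori (zz V M k A gam Q : R) : 0 <= zz -> 0 <= V -> 0 <= M ->
  0 <= k -> k <= 2^-1 -> k * (3 + 2 * zz + V) <= 4^-1 ->
  0 <= A -> 0 <= gam -> 0 <= Q ->
  Q <= k * (Q + A ^+ 2) + zz * A ^+ 2 + gam * A ->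
  A ^+ 2 <= k * (Q + A ^+ 2 + V * A ^+ 2) + gam * (M * A) ->
  A <= 2 * (1 + M) * gam.
Proof.
move=> zz0 V0 M0 k0 k2 kW A0 g0 Q0 h1 h2.
have A2 : 0 <= A ^+ 2 by exact: sqr_ge0.
have G2 : 0 <= gam ^+ 2 by exact: sqr_ge0.
have zA : 0 <= zz * A ^+ 2 by exact: mulr_ge0.
have VA : 0 <= V * A ^+ 2 by exact: mulr_ge0.
have ga : 2 * (gam * A) <= gam ^+ 2 + A ^+ 2.
  by have := sqr_ge0 (gam - A); rewrite sqrrB; lra.
have hQ : Q <= (2 + 2 * zz) * A ^+ 2 + gam ^+ 2.
  have : k * (Q + A ^+ 2) <= 2^-1 * (Q + A ^+ 2) by rewrite ler_wpM2r //; lra.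
  lra.
have hk : k * (Q + A ^+ 2 + V * A ^+ 2) <= 4^-1 * A ^+ 2 + 2^-1 * gam ^+ 2.
  apply: (@le_trans _ _ (k * ((3 + 2 * zz + V) * A ^+ 2 + gam ^+ 2))).
    by rewrite ler_wpM2l //; lra.
  rewrite mulrDr mulrA; apply: lerD; exact: ler_wpM2r.
have gM : gam * (M * A) <= 4^-1 * A ^+ 2 + M ^+ 2 * gam ^+ 2.
  by have := sqr_ge0 (2^-1 * A - M * gam); rewrite sqrrB !exprMn; lra.
have hA : A ^+ 2 <= (2 * (1 + M) * gam) ^+ 2.
  have Mg : 0 <= M * gam ^+ 2 by exact: mulr_ge0.
  have M2g : 0 <= M ^+ 2 * gam ^+ 2 by apply: mulr_ge0 => //; exact: sqr_ge0.
  have -> : (2 * (1 + M) * gam) ^+ 2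
    = 4 * gam ^+ 2 + 8 * (M * gam ^+ 2) + 4 * (M ^+ 2 * gam ^+ 2) by ring.
  lra.
by rewrite -(ler_pXn2r (n := 2)) ?nnegrE // !mulr_ge0 //; lra.
Qed.

Section ResolventDecay.
Variables (z : R[i]) (T T' : (X -> R[i]) -> X -> R[i]).
Hypothesis hT : resolvent_op m 2%:E (lap m G) z T.
Hypothesis hT' : resolvent_op m 2%:E (lap m G) (conjc z) T'.

(** For u = e^phi w, testing the conjugated equation with u bounds |D u| only in terms of |u|,
    because the form is not coercive at z. Testing with v = (conj z - A)^-1 u turns the unperturbed
    part into |u|^2. The constants depend neither on the weight nor on the point y. *)
Lemma twisted_resolvent_bound : exists2 eps : R, 0 < eps &
  exists2 C : R, 0 <= C & forall phi F0 k y,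
    (forall x, x \notin F0 -> phi x = k) ->
    (forall x x', `|phi x - phi x'| <= eps * d x x') -> phi y = 0 ->
    N (mulE phi (T (ind1 R y))) <= C * N (ind1 R y).
Proof.
have [T1 _ _ T4 _] := hT; have [T1' _ [M M0 hM] T4' _] := hT'.
pose zz := normc z; have zz0 : 0 <= zz by exact: normc_ge0.
pose V := zz * M ^+ 2 + M + M ^+ 2.
have V0 : 0 <= V by rewrite /V !addr_ge0 ?mulr_ge0 ?sqr_ge0.
pose W := 3 + 2 * zz + V; have W0 : 0 < W by rewrite /W; lra.
have W3 : 3 <= W by rewrite /W; lra.
have tc0 : 0 < twist_const.
  by rewrite /twist_const ltr_wpDl // addr_ge0 // mulr_ge0.
have s0 := s_gt0.
pose tc := twist_const; rewrite -/tc in tc0.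
(* One denominator that ensures eps <= 1, eps s <= 1/2, eps tc <= 1/2 and eps tc W <= 1/4. *)
pose den := 4 * (1 + s) * (1 + tc) * W.
have den0 : 0 < den by rewrite !mulr_gt0 //; lra.
pose eps := den^-1; have eps0 : 0 < eps by rewrite invr_gt0.
have epsM x c : x <= c * den -> eps * x <= c.
  by move=> h; rewrite mulrC ler_pdivrMr.
have st0 : 0 <= s * tc by rewrite mulr_ge0 // ltW.
have pW c : 0 <= c -> 3 * c <= c * W.
  by move=> c0; rewrite mulrC ler_wpM2l.
have denE : den = 4 * W + 4 * (s * W) + 4 * (tc * W) + 4 * (s * tc * W).
  by rewrite /den; ring.
have sW := pW _ (ltW s0); have tW := pW _ (ltW tc0); have stW := pW _ st0.
have eps1 : eps <= 1.
  by rewrite -[eps]mulr1; apply: epsM; rewrite denE; lra.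
have epss : eps * s <= 2^-1 by apply: epsM; rewrite denE; lra.
have epst : eps * tc <= 2^-1 by apply: epsM; rewrite denE; lra.
have epsW : eps * tc * W <= 4^-1.
  by rewrite -mulrA; apply: epsM; rewrite denE; lra.
exists eps => //; exists (2 * (1 + M)); first by rewrite mulr_ge0 //; lra.
move=> phi F0 k y phik lip phiy.
have k0 : 0 <= eps * tc by rewrite mulr_ge0 // ltW.
set g := ind1 R y; have lg : L2 g by exact: ind1_lp.
set w := T g; have lapw : lap m G w (z ** w - g) by exact: T4.
have [dw lzw _] := lapw; have lw := formdom_l2 dw.
set u := mulE phi w; have du : formdom m G u.
  exact: (formdom_mulE phik).
have lu := formdom_l2 du; have lDu := formdom_Dl2 m_gt0 G_l2 D_ind1 du.
(* e^(-phi) u is [w], so the conjugated form tests the equation of [w] with e^phi v. The source is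
   unaffected because phi vanishes at y. *)
have weak v : formdom m G v -> ip (D u) (D v) + twist phi u v = z * ip u v - ip g v.
  move=> dv; have lv := formdom_l2 dv.
  have dpv := formdom_mulE phik dv.
  have -> : ip (D u) (D v) + twist phi u v = ip (D w) (D (mulE phi v)).
    rewrite /twist addrC subrK; congr (ip (D _) _); apply/funext => x.
    rewrite /u /mulE mulrA -rmorphM /=.
    by rewrite (mulrC (expR (- phi x))) expRxMexpNx_1 mul1r.
  rewrite (lap_weak m_gt0 G_l2 D_ind1 lapw dpv).
  have lpv := mulE_l2 phik lv.
  rewrite ipBl ?ipZl //; last exact: l2Z.
  rewrite -ip_mulE -/u; congr (_ - _).
  by rewrite !pairing_ind1l /mulE phiy expR0 mul1r.
have tb v : formdom m G v ->
    normc (twist phi u v) <= eps * tc * (sqr_fnorm u + sqr_fnorm v).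
  by move=> dv; apply: (twist_bound phik (ltW eps0) eps1 epss lip).
have tuu : normc (twist phi u u) <= eps * tc * sqr_fnorm u.
  exact: (twist_formdom phik (ltW eps0) eps1 epss lip).
have CSgu := ip_CS m_gt0 lg lu.
have h1 : N (D u) ^+ 2 <= eps * tc * (N (D u) ^+ 2 + N u ^+ 2)
    + zz * N u ^+ 2 + N g * N u.
  have := weak u du; rewrite !ip_self // => /(canRL (addrK _)) /(congr1 (@normc R)).
  rewrite normcR ger0_norm ?sqr_ge0 // => {1}->.
  have := ler_normcB (z * (N u ^+ 2)%:C - ip g u) (twist phi u u).
  have := ler_normcB (z * (N u ^+ 2)%:C) (ip g u).
  rewrite normcM normcR (ger0_norm (sqr_ge0 _)); move: tuu CSgu; rewrite /sqr_fnorm -/zz.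
  move: (eps * tc * _) (zz * _) (N g * N u) (normc _) (normc _) (normc _) (normc _).
  move=> *; lra.
(* The second test function; its form norm is at most V |u|^2, which determines [V]. *)
set v := T' u; have lapv : lap m G v (conjc z ** v - u) by exact: T4'.
have [dv lzv _] := lapv; have lv := formdom_l2 dv.
have lDv := formdom_Dl2 m_gt0 G_l2 D_ind1 dv.
have Nv : N v <= M * N u by exact: hM.
have Nu0 := nrm_ge0 m 2%:E u; have Nv0 := nrm_ge0 m 2%:E v.
have Ng0 := nrm_ge0 m 2%:E g.
have Nv2 : N v ^+ 2 <= M ^+ 2 * N u ^+ 2.
  by rewrite -exprMn ler_pXn2r // nnegrE // mulr_ge0.
have Qv : sqr_fnorm v <= V * N u ^+ 2.
  have : N (D v) ^+ 2 <= zz * N v ^+ 2 + N u * N v.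
    have := lap_self m_gt0 G_l2 D_ind1 lapv; rewrite ipBl ?ipZl //; last exact: l2Z.
    rewrite ip_self // => /(congr1 (@normc R)).
    rewrite normcR ger0_norm ?sqr_ge0 // => <-.
    apply: le_trans (ler_normcB _ _) _; apply: lerD; last exact: ip_CS.
    by rewrite normcM normc_conjc normcR ger0_norm ?sqr_ge0.
  have := ler_wpM2l zz0 Nv2; have := ler_wpM2l Nu0 Nv.
  rewrite /sqr_fnorm /V.
  move: (N (D v) ^+ 2) (N v ^+ 2) Nv2 (N u * N v) => a1 a2 a3 a4.
  have -> : N u * (M * N u) = M * N u ^+ 2 by ring.
  lra.
have h2 : N u ^+ 2 <= eps * tc * (N (D u) ^+ 2 + N u ^+ 2 + V * N u ^+ 2)
    + N g * (M * N u).
  have := weak v dv.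
  have -> : ip (D u) (D v) = z * ip u v - (N u ^+ 2)%:C.
    rewrite (ip_sym m_gt0 lDv lDu) (lap_weak m_gt0 G_l2 D_ind1 lapv du).
    rewrite ipBl ?ipZl ?ip_self //; last exact: l2Z.
    rewrite conjc_add conjc_opp conjc_mul conjcK conjc_real.
    by rewrite -(ip_sym m_gt0 lv lu).
  move=> E; have : (N u ^+ 2)%:C = twist phi u v + ip g v.
    have -> : twist phi u v = z * ip u v - ip g v - (z * ip u v - (N u ^+ 2)%:C).
      by rewrite -E; ring.
    ring.
  move=> /(congr1 (@normc R)); rewrite normcR ger0_norm ?sqr_ge0 // => {1}->.
  apply: le_trans (ler_normcD _ _) _; apply: lerD.
    apply: le_trans (tb _ dv) _; rewrite ler_wpM2l // lerD2l //.
  apply: le_trans (ip_CS m_gt0 lg lv) _; exact: ler_wpM2l.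
exact: (twisted_a_priori zz0 V0 M0 k0 epst epsW Nu0 Ng0 (sqr_ge0 _) h1 h2).
Qed.

Hypothesis d_triangle : forall x y t : X, d x t <= d x y + d y t.
Hypothesis d_refl : forall x, d x x = 0.
Hypothesis finite_balls : forall x r, finite_set [set y | d x y <= r].

Lemma resolvent_kernel_decay : exists2 eps : R, 0 < eps &
  exists2 C : R, 0 <= C & forall x y,
    m x * (expR (eps * d x y) * normc (T (ind1 R y) x)) ^+ 2 <= C ^+ 2 * m y.
Proof.
have [eps eps0 [C C0 h]] := twisted_resolvent_bound.
exists eps => //; exists C => // x y.
(* Capping the distance from y at d(x, y) loses nothing at x and makes the weight constant off a
   ball, which is finite. *)
pose r := d x y; pose phi (t : X) := eps * Num.min (d y t) r.
have r0 : 0 <= r by exact: d_ge0.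
have lT : L2 (T (ind1 R y)) by have [T1 _ _ _ _] := hT; apply: T1; exact: ind1_lp.
have h0 := h phi (fset_set [set t | d y t <= r]) (eps * r) y.
have phik (w : X) : w \notin fset_set [set t | d y t <= r] -> phi w = eps * r.
  rewrite in_fset_set; last exact: finite_balls.
  rewrite notin_setE /= => /negP; rewrite -ltNge => rw.
  by rewrite /phi min_r // ltW.
have hN : N (mulE phi (T (ind1 R y))) <= C * N (ind1 R y).
  apply: (h0 phik) => [w w'|]; last by rewrite /phi d_refl min_l // mulr0.
  rewrite /phi -mulrBr normrM gtr0_norm // ler_wpM2l ?(ltW eps0) //.
  have := d_triangle y w w'; have := d_triangle y w' w; rewrite (d_sym w' w).
  rewrite ler_norml; case: (leP (d y w) r); case: (leP (d y w') r); have := d_ge0 w w'; lra.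
have : N (mulE phi (T (ind1 R y))) ^+ 2 <= C ^+ 2 * m y.
  by rewrite -nrm_ind1 -exprMn ler_pXn2r // nnegrE ?nrm_ge0 // mulr_ge0 // nrm_ge0.
move=> h1; apply: le_trans h1.
have := l2_sum_le m_gt0 [fset x]%fset (mulE_l2 phik lT).
rewrite big_seq_fset1 /mulE normcM normcR gtr0_norm ?expR_gt0 //.
by rewrite /phi (d_sym y x) -/r minxx.
Qed.

End ResolventDecay.

End TwistedForm.

(** * Consequences of subexponential growth *)

Section Growth.
Variables (R : realType) (X : choiceType) (m : X -> R) (d : X -> X -> R).
Hypothesis m_gt0 : forall x, 0 < m x.
Hypothesis d_ge0 : forall x y, 0 <= d x y.
Hypothesis d_sym : forall x y, d x y = d y x.
Hypothesis growth : forall e : R, 0 < e -> exists2 C : R, 0 < C &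
  forall x r (F : {fset X}), 0 < r -> (forall y, y \in F -> d x y <= r) ->
    \sum_(y <- F) m y <= C * expR (e * r) * m x.

(** The ball about x of radius d(x, y) + 1 contains y. The added 1 makes the radius positive, as d
    is only a pseudo metric. *)
Lemma mass_ratio (e : R) : 0 < e -> exists2 C : R, 0 < C &
  forall x y, m y <= C * expR (e * d x y) * m x.
Proof.
move=> e0; have [C C0 hC] := growth e0.
exists (C * expR e); first by rewrite mulr_gt0 ?expR_gt0.
move=> x y; have d1 : 0 < d x y + 1 by rewrite ltr_wpDl.
have := hC x _ [fset y]%fset d1; rewrite big_seq_fset1 => h.
apply: le_trans (h _) _; first by move=> y'; rewrite inE => /eqP ->; rewrite lerDl.
by rewrite mulrDr mulr1 expRD; leq_ring.
Qed.

(** By [mass_ratio] the masses in a ball have a positive lower bound, while their sum is bounded by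
    the growth condition. *)
Lemma finite_ball x r : finite_set [set y | d x y <= r].
Proof.
apply: contrapT => inf; have [C1 C10 h1] := mass_ratio ltr01.
have [C2 C20 h2] := growth ltr01.
pose r' := `|r| + 1; have r'0 : 0 < r' by rewrite ltr_wpDl.
have rr' : r <= r' by have := ler_norm r; rewrite /r'; lra.
pose c := m x / (C1 * expR r').
have c0 : 0 < c by rewrite divr_gt0 // mulr_gt0 ?expR_gt0.
have lb y : d x y <= r -> c <= m y.
  move=> dr; rewrite ler_pdivrMr ?mulr_gt0 ?expR_gt0 //.
  apply: le_trans (h1 y x) _; rewrite mul1r [leRHS]mulrC ler_wpM2r ?(ltW (m_gt0 _)) //.
  rewrite ler_wpM2l ?(ltW C10) // ler_expR d_sym; lra.
pose B := C2 * expR r' * m x; pose n := Num.bound (B / c).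
have [F Fsub Fn] := infinite_set_fset n inf.
have := h2 x _ F r'0; rewrite mul1r -/B => hB.
have {hB} : \sum_(y <- F) m y <= B.
  by apply: hB => y yF; apply: le_trans rr'; exact: Fsub.
have : c * n%:R <= \sum_(y <- F) m y.
  apply: (@le_trans _ _ (\sum_(y <- F) c)).
    rewrite big_const_seq iter_addr_0 count_predT -(mulr_natr c) ler_wpM2l ?(ltW c0) //.
    by rewrite ler_nat.
  rewrite big_seq [leRHS]big_seq; apply: ler_sum => y yF; apply: lb; exact: Fsub.
have : B / c < n%:R.
  apply: archi_boundP; rewrite divr_ge0 ?(ltW c0) //.
  by rewrite /B !mulr_ge0 ?expR_ge0 // ltW.
rewrite ltr_pdivrMr // mulrC => lt le1 le2.
by have := le_lt_trans (le_trans le1 le2) lt; rewrite ltxx.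
Qed.

(** Decomposition into shells of width 1. Growth at rate a / 2 uses up one factor q^n of the decay
    q^(2n), where q = e^(-a/2); the other factor sums geometrically. *)
Lemma exp_sum (a : R) : 0 < a -> exists2 C : R, 0 <= C &
  forall x (F : {fset X}), \sum_(y <- F) m y * expR (- (a * d x y)) <= C * m x.
Proof.
move=> a0; have a2 : 0 < a / 2 by lra.
have [C C0 hC] := growth a2.
pose q := expR (- (a / 2)).
have q0 : 0 < q by exact: expR_gt0.
have q1 : q < 1 by rewrite /q expR_lt1; lra.
have q1' : 0 < 1 - q by lra.
have Q0 : 0 <= C * expR (a / 2) / (1 - q).
  by rewrite divr_ge0 ?mulr_ge0 ?expR_ge0 // ltW.
exists (C * expR (a / 2) / (1 - q)) => // x F.
have [K hK] : exists K : nat, forall y, y \in F -> (Num.bound (d x y) < K)%N.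
  exists (\max_(y <- F) (Num.bound (d x y))).+1 => y yF.
  by rewrite ltnS (big_fsetD1 y) //= leq_maxl.
have dominated y : y \in F ->
    expR (- (a * d x y)) <= \sum_(n < K) (if d x y <= n.+1%:R then q ^+ n ^+ 2 else 0).
  move=> yF; have ex : exists n : nat, d x y <= n.+1%:R.
    exists (Num.bound (d x y)); apply: le_trans (ltW (archi_boundP (d_ge0 x y))) _.
    by rewrite ler_nat.
  (* Minimality gives d > n unless n = 0, hence e^(-a d) <= e^(-a n) = q^(2n) in both cases. *)
  case: (ex_minnP ex) => n hn minn_.
  have nK : (n < K)%N.
    apply: leq_ltn_trans (hK y yF); apply: minn_.
    apply: le_trans (ltW (archi_boundP (d_ge0 x y))) _; by rewrite ler_nat.
  rewrite (bigD1 (Ordinal nK)) //= hn.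
  apply: (@le_trans _ _ (q ^+ n ^+ 2)); last first.
    by rewrite lerDl sumr_ge0 // => i _; case: ifP => // _; rewrite sqr_ge0.
  rewrite -exprM /q -expRM_natl ler_expR natrM.
  rewrite mulrN lerN2 (_ : n%:R * 2%:R * (a / 2) = a * n%:R); last by field.
  rewrite ler_wpM2l ?(ltW a0) //.
  case: (n) minn_ => [//|k] minn_; rewrite leNgt; apply/negP => lt.
  by have := minn_ k (ltW lt); rewrite ltnn.
apply: (@le_trans _ _ (\sum_(n < K) q ^+ n * (q ^+ n *
    \sum_(y <- F) (if d x y <= n.+1%:R then m y else 0)))).
  under [leRHS]eq_bigr do rewrite mulrA -expr2 mulr_sumr.
  rewrite exchange_big big_seq [leRHS]big_seq; apply: ler_sum => y yF.
  apply: le_trans (ler_wpM2l (ltW (m_gt0 y)) (dominated y yF)) _.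
  rewrite mulr_sumr; apply: ler_sum => i _.
  by case: ifP => _; rewrite ?mulr0 // mulrC.
have shell n : q ^+ n * \sum_(y <- F) (if d x y <= n.+1%:R then m y else 0)
    <= C * expR (a / 2) * m x.
  have : \sum_(y <- F) (if d x y <= n.+1%:R then m y else 0)
      <= C * expR (a / 2 * n.+1%:R) * m x.
    have h := hC x _ [fset y in F | d x y <= n.+1%:R]%fset (ltr0Sn _ n).
    rewrite (big_fsetID _ (fun y => d x y <= n.+1%:R)) /=.
    rewrite [X in _ + X]big_seq [X in _ + X]big1 ?addr0; last first.
      by move=> y; rewrite !inE /= => /andP[_ /negbTE ->].
    apply: le_trans (h _); last by move=> y; rewrite !inE /= => /andP[].
    leq_eq.
    rewrite big_seq [RHS]big_seq; apply: eq_bigr => y.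
    by rewrite !inE /= => /andP[_ ->].
  move=> /(ler_wpM2l (exprn_ge0 n (ltW q0))) /le_trans; apply.
  rewrite /q -expRM_natl (_ : expR (a / 2 * n.+1%:R) = expR (a / 2) * expR (n%:R * (a / 2))).
    rewrite mulrN expRN; leq_eq; field.
    by rewrite gt_eqF ?expR_gt0.
  by rewrite -expRD -natr1; congr expR; ring.
apply: (@le_trans _ _ (\sum_(n < K) q ^+ n * (C * expR (a / 2) * m x))).
  by apply: ler_sum => n _; rewrite ler_wpM2l ?exprn_ge0 // ltW.
rewrite -mulr_suml [leRHS](_ : _ = (1 - q)^-1 * (C * expR (a / 2) * m x)); last by ring.
rewrite ler_wpM2r //; first by rewrite !mulr_ge0 ?expR_ge0 // ltW.
have -> : \sum_(n < K) q ^+ n = (1 - q ^+ K) / (1 - q).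
  apply: (mulIf (_ : 1 - q != 0)); first by rewrite gt_eqF.
  rewrite divfK ?gt_eqF // -[RHS]opprB subrX1 mulrC -mulNr opprB.
  by [].
rewrite -[leRHS]mul1r ler_wpM2r ?invr_ge0 ?(ltW q1') //.
by rewrite gerBl exprn_ge0 // ltW.
Qed.

(** Half of the exponential decay pays for the factor (m y / m x)^(1/2) through [mass_ratio], the
    other half for the summation through [exp_sum]. Rows use [b2] and columns [b1]. *)
Lemma kernel_schur (K : X -> X -> R) (eps A : R) : 0 < eps -> 0 <= A ->
  (forall x y, 0 <= K x y) ->
  (forall x y, m x * (expR (eps * d x y) * K x y) ^+ 2 <= A ^+ 2 * m y) ->
  exists2 S : R, 0 <= S &
    (forall x (F : {fset X}), \sum_(y <- F) K x y <= S) /\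
    (forall y (F : {fset X}), \sum_(x <- F) m x * K x y <= S * m y).
Proof.
move=> e0 A0 K0 hK; have [C1 C10 h1] := mass_ratio e0.
have e2 : 0 < eps / 2 by lra.
have [C2 C20 h2] := exp_sum e2.
(* Stands in for the square root of [C1]; only [C1 <= C3 ^+ 2] matters. *)
pose C3 := C1 + 1; have C30 : 0 <= C3 by rewrite /C3; lra.
have C13 : C1 <= C3 ^+ 2 by rewrite /C3; have := sqr_ge0 C1; lra.
pose E x y := expR (eps / 2 * d x y); have E0 x y : 0 < E x y by exact: expR_gt0.
have EE x y : expR (eps * d x y) = E x y ^+ 2.
  by rewrite /E -expRM_natl; congr expR; field.
have AC : 0 <= A * C3 by exact: mulr_ge0.
have b1 x y : E x y * K x y <= A * C3.
  rewrite -(ler_pXn2r (n := 2)) ?nnegrE // ?mulr_ge0 // ?(ltW (E0 _ _)) //.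
  apply: (@le_trans _ _ (A ^+ 2 * C1)); last first.
    by rewrite [leRHS]exprMn ler_wpM2l ?sqr_ge0.
  have P0 : 0 < m x * E x y ^+ 2 by rewrite mulr_gt0 // exprn_gt0.
  rewrite -(ler_pM2l P0); have := hK x y; rewrite EE.
  have := ler_wpM2l (sqr_ge0 A) (h1 x y); rewrite EE.
  have -> : m x * E x y ^+ 2 * (E x y * K x y) ^+ 2 = m x * (E x y ^+ 2 * K x y) ^+ 2.
    by ring.
  have -> : m x * E x y ^+ 2 * (A ^+ 2 * C1) = A ^+ 2 * (C1 * E x y ^+ 2 * m x) by ring.
  by move=> le1 le2; exact: le_trans le2 le1.
have b2 x y : m x * (E x y * K x y) <= A * C3 * m y.
  have my0 := ltW (m_gt0 y); have mx0 := ltW (m_gt0 x); have Exy := ltW (E0 x y).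
  have K0' := K0 x y.
  rewrite -(ler_pXn2r (n := 2)) ?nnegrE //; try by do !apply: mulr_ge0.
  apply: (@le_trans _ _ (A ^+ 2 * C1 * m y ^+ 2)); last first.
    rewrite [leRHS]exprMn ler_wpM2r ?sqr_ge0 // [leRHS]exprMn ler_wpM2l ?sqr_ge0 //.
  have P0 : 0 < E x y ^+ 2 by rewrite exprn_gt0.
  rewrite -(ler_pM2l P0).
  have := ler_wpM2l mx0 (hK x y); rewrite EE.
  have := h1 y x; rewrite d_sym EE => /(ler_wpM2l (mulr_ge0 (sqr_ge0 A) my0)).
  have -> : E x y ^+ 2 * (m x * (E x y * K x y)) ^+ 2
    = m x * (m x * (E x y ^+ 2 * K x y) ^+ 2) by ring.
  have -> : E x y ^+ 2 * (A ^+ 2 * C1 * m y ^+ 2)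
    = A ^+ 2 * m y * (C1 * E x y ^+ 2 * m y) by ring.
  move=> le1 le2; apply: le_trans le2 _; apply: le_trans le1.
  leq_ring.
have EN x y : expR (- (eps / 2 * d x y)) = (E x y)^-1 by rewrite expRN.
exists (A * C3 * C2); first by rewrite mulr_ge0.
split=> [x F|y F].
  rewrite -(ler_pM2l (m_gt0 x)) mulr_sumr.
  apply: (@le_trans _ _ (\sum_(y <- F) A * C3 * (m y * expR (- (eps / 2 * d x y))))).
    apply: ler_sum => y _; rewrite EN mulrA ler_pdivlMr //.
    by apply: le_trans (b2 x y); leq_ring.
  rewrite -mulr_sumr; apply: le_trans (ler_wpM2l AC (h2 x F)) _; leq_ring.
apply: (@le_trans _ _ (\sum_(x <- F) A * C3 * (m x * expR (- (eps / 2 * d y x))))).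
  apply: ler_sum => x _; rewrite d_sym EN mulrA ler_pdivlMr // (mulrC _ (m x)).
  apply: le_trans (ler_wpM2l (ltW (m_gt0 x)) (b1 x y)); leq_ring.
rewrite -mulr_sumr; apply: le_trans (ler_wpM2l AC (h2 y F)) _; leq_ring.
Qed.

End Growth.

(** * The Schur test on every l^p *)

Section SchurOperators.
Variables (R : realType) (X : choiceType) (m : X -> R).
Hypothesis m_gt0 : forall x, 0 < m x.
Variables (K : X -> X -> R[i]) (S : R).
Hypothesis S_ge0 : 0 <= S.
Hypothesis K_row : forall x (F : {fset X}), \sum_(y <- F) normc (K x y) <= S.
Hypothesis K_col : forall y (F : {fset X}), \sum_(x <- F) m x * normc (K x y) <= S * m y.
Implicit Types (f g : X -> R[i]) (F : {fset X}).

(** The sum carries no weight: the kernel is K x y = T(1_y)(x), so [m] enters only the column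
    bound. *)
Definition kernel_op f : X -> R[i] := fun x => csum [set: X] (fun y => K x y * f y).

Variable p : \bar R.
Hypothesis p1 : (1 <= p)%E.
Local Notation L := (lpmem m p).
Local Notation N := (nrm m p).

(** For finite p, Jensen reduces to a sum of |K x y| |f y|^r; the column bound for the single point
    x, m x |K x y| <= S m y, compares it with the norm of f. *)
Lemma kernel_summable f x : L f -> abs_summable (fun y => K x y * f y).
Proof.
move=> lf; have := lp_lpbound m_gt0 p1 lf (lexx _); have := nrm_ge0 m p f.
move: (N f) => M; move: p1; case: p => [r| |] //=; rewrite ?lee_fin => r1 M0 hM.
  have r0 : 0 < r by lra.
  pose B := S `^ (r - 1) * (S / m x * M `^ r).
  exists (B `^ r^-1) => F.
  under eq_bigr do rewrite normcM.
  have s0 : 0 <= \sum_(y <- F) normc (K x y) * normc (f y).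
    by apply: sumr_ge0 => y _; rewrite mulr_ge0 ?normc_ge0.
  have B0 : 0 <= B by rewrite mulr_ge0 ?powR_ge0 // mulr_ge0 ?powR_ge0 // divr_ge0 // ltW.
  have BE : (B `^ r^-1) `^ r = B by rewrite -powRrM mulVf ?gt_eqF // powRr1.
  have rn : r != 0 by rewrite gt_eqF.
  rewrite -[leLHS](powRr1 s0) -(mulfV rn) powRrM.
  rewrite ler_powR_inv ?powR_ge0 // BE.
  apply: le_trans (@jensen_powR _ _ F r S (fun y => normc (K x y))
    (fun y => normc (f y)) r1 _ _ (K_row x F)) _.
  - by move=> y; exact: normc_ge0.
  - by move=> y; exact: normc_ge0.
  rewrite ler_wpM2l ?powR_ge0 //.
  apply: (@le_trans _ _ (S / m x * \sum_(y <- F) m y * normc (f y) `^ r)); last first.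
    by rewrite ler_wpM2l // divr_ge0 // ltW.
  rewrite mulr_sumr; apply: ler_sum => y _; rewrite mulrA ler_wpM2r ?powR_ge0 //.
  rewrite mulrAC ler_pdivlMr //.
  by have := K_col y [fset x]%fset; rewrite big_seq_fset1 mulrC.
exists (S * M) => F; under eq_bigr do rewrite normcM.
apply: (@le_trans _ _ (\sum_(y <- F) normc (K x y) * M)).
  by apply: ler_sum => y _; rewrite ler_wpM2l ?normc_ge0.
by rewrite -mulr_suml ler_wpM2r.
Qed.

Lemma kernel_op_lin a f g : L f -> L g ->
  kernel_op (a ** f + g) = a ** kernel_op f + kernel_op g.
Proof.
move=> lf lg; apply/funext => x; rewrite /kernel_op /cscale !fctE.
rewrite -csum_linear; try exact: kernel_summable.
by congr csum; apply/funext => y; ring.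
Qed.

Lemma kernel_op_restrict F f : kernel_op (restrict F f)
  = fun x => \sum_(y <- F) K x y * f y.
Proof.
apply/funext => x; rewrite /kernel_op (@csum_fin _ _ _ F).
  rewrite big_seq [RHS]big_seq; apply: eq_bigr => y yF; by rewrite /restrict yF.
by move=> y yF; rewrite /restrict (negbTE yF) mulr0.
Qed.

(** Jensen along rows costs S^(r-1), and after exchanging the sums the columns cost the remaining
    S. *)
Lemma kernel_op_restrict_le F f : L f ->
  L (kernel_op (restrict F f)) /\ N (kernel_op (restrict F f)) <= S * N f.
Proof.
move=> lf; rewrite kernel_op_restrict.
apply: lpbound_lp => //; first by rewrite mulr_ge0 // nrm_ge0.
have := lp_lpbound m_gt0 p1 lf (lexx _); have := nrm_ge0 m p f.
move: (N f) => M; move: p1; case: p => [r| |] //=; rewrite ?lee_fin => r1 M0 hM.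
  have r0 : 0 < r by lra.
  move=> F'.
  apply: (@le_trans _ _ (\sum_(x <- F') m x * (S `^ (r - 1) *
      \sum_(y <- F) normc (K x y) * normc (f y) `^ r))).
    apply: ler_sum => x _; rewrite ler_wpM2l ?(ltW (m_gt0 x)) //.
    apply: (@le_trans _ _ ((\sum_(y <- F) normc (K x y) * normc (f y)) `^ r)).
      apply: ge0_ler_powR; rewrite ?nnegrE ?(ltW r0) ?normc_ge0 //.
        by apply: sumr_ge0 => y _; rewrite mulr_ge0 ?normc_ge0.
      apply: le_trans (ler_normc_sum _ _ _) _.
      by apply: ler_sum => y _; rewrite normcM.
    by apply: jensen_powR => // y; exact: normc_ge0.
  have -> : \sum_(x <- F') m x * (S `^ (r - 1) *
      \sum_(y <- F) normc (K x y) * normc (f y) `^ r)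
    = S `^ (r - 1) * \sum_(y <- F) (\sum_(x <- F') m x * normc (K x y)) * normc (f y) `^ r.
    rewrite mulr_sumr.
    under [RHS]eq_bigr do rewrite mulr_suml mulr_sumr.
    rewrite exchange_big; apply: eq_bigr => x _; rewrite !mulr_sumr.
    by apply: eq_bigr => y _; ring.
  rewrite powRM // -(mulr_powRB1 S_ge0 r0) (mulrC S) -mulrA.
  rewrite ler_wpM2l ?powR_ge0 //.
  apply: (@le_trans _ _ (S * \sum_(y <- F) m y * normc (f y) `^ r)); last first.
    by rewrite ler_wpM2l.
  rewrite mulr_sumr; apply: ler_sum => y _.
  by rewrite mulrA ler_wpM2r ?powR_ge0.
move=> x; apply: le_trans (ler_normc_sum _ _ _) _.
apply: (@le_trans _ _ (\sum_(y <- F) normc (K x y) * M)).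
  by apply: ler_sum => y _; rewrite normcM ler_wpM2l ?normc_ge0.
by rewrite -mulr_suml ler_wpM2r.
Qed.

(** Passes to infinite support by Fatou instead of density, so that p = +oo is included. *)
Lemma kernel_op_bounded f : L f -> L (kernel_op f) /\ N (kernel_op f) <= S * N f.
Proof.
move=> lf; apply: lpbound_lp => //; first by rewrite mulr_ge0 // nrm_ge0.
have SN : 0 <= S * N f by rewrite mulr_ge0 // nrm_ge0.
apply: (lpbound_restrict p1 SN) => F'.
(* On the finite set [F'] one finite truncation of f serves all points at once. *)
have /choice[Fn hFn] : forall n : nat, exists F, forall x, x \in F' ->
    normc (kernel_op (restrict F f) x - kernel_op f x) <= n.+1%:R^-1.
  move=> n; have n0 : 0 < n.+1%:R^-1 :> R by rewrite invr_gt0.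
  suff [F hF] : exists F, forall F1, (F `<=` F1)%fset -> forall x, x \in (F' : seq X) ->
      normc (kernel_op (restrict F1 f) x - kernel_op f x) <= n.+1%:R^-1.
    by exists F => x xF'; apply: hF => //; exact: fsubset_refl.
  elim: (F' : seq X) => [|x s [F1 h1]]; first by exists fset0.
  have [F2 h2] := csum_approx (kernel_summable x lf) n0.
  exists (F1 `|` F2)%fset => F3; rewrite fsubUset => /andP[s1 s2] y.
  rewrite inE => /orP[/eqP ->|ys]; last exact: h1.
  by rewrite normcB kernel_op_restrict; exact: h2.
apply: lp_lpbound => //; first exact: restrict_lp.
have [] := @lp_fatou _ _ _ m_gt0 _ p1 (fun n => restrict F' (kernel_op (restrict (Fn n) f)))
  (restrict F' (kernel_op f)) (S * N f) => //.
- move=> x e e0; have [k hk] := inv_succ_small e0; exists k => n /hk hn.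
  rewrite /restrict; case: ifPn => xF'; first exact: le_trans (hFn n x xF') hn.
  by rewrite subrr normc0 ltW.
- by move=> n; exact: restrict_lp.
- exists 0%N => n _; have [l1 l2] := kernel_op_restrict_le (Fn n) lf.
  exact: le_trans (nrm_restrict m_gt0 p1 _ l1) l2.
Qed.

End SchurOperators.

(** * Resolvents of symmetric operators *)

Section SymmetricResolvents.
Variables (R : realType) (X : choiceType) (m : X -> R).
Hypothesis m_gt0 : forall x, 0 < m x.
Local Notation ip := (ip m).
Local Notation L2 := (lpmem m 2%:E).
Local Notation N := (nrm m 2%:E).
Variable A : graph R X.
Hypothesis A_dom : forall f g, A f g -> L2 f /\ L2 g.
Hypothesis A_sym : forall u f v g, A u f -> A v g -> ip f v = ip u g.
Variables (z : R[i]) (T T' : (X -> R[i]) -> X -> R[i]).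
Hypothesis hT : resolvent_op m 2%:E A z T.
Hypothesis hT' : resolvent_op m 2%:E A (conjc z) T'.

Lemma resolvent_adjoint f g : L2 f -> L2 g -> ip (T f) g = ip f (T' g).
Proof.
move=> lf lg; have [T1 _ _ T4 _] := hT; have [T1' _ _ T4' _] := hT'.
have lu := T1 _ lf; have lv := T1' _ lg.
have l2Z a h : L2 h -> L2 (a ** h) by exact: lpZ.
have := A_sym (T4 _ lf) (T4' _ lg).
rewrite (ipBl m_gt0) ?(ipBr m_gt0) ?(ipZl m_gt0) ?(ipZr m_gt0) ?conjcK //;
  try exact: l2Z.
by move=> /(congr1 (fun c => z * ip (T f) (T' g) - c)); rewrite !subKr.
Qed.

(** m x (T f)(x) = <f, T' 1_x> because T' is the adjoint of T; so on all of l^2 the resolvent is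
    given by its kernel. *)
Lemma resolvent_kernelE f x : L2 f ->
  T f x = csum [set: X] (fun y => T (ind1 R y) x * f y).
Proof.
move=> lf; have [T1' _ _ _ _] := hT'.
have li y : L2 (ind1 R y) by exact: ind1_lp.
have E h : L2 h -> (m x)%:C * T h x = ip h (T' (ind1 R x)).
  by move=> lh; rewrite -resolvent_adjoint // pairing_ind1.
have mx0 : (m x)%:C != 0 :> R[i] by rewrite eq_complex /= gt_eqF.
have kE y : T (ind1 R y) x = (m x)%:C^-1 * ((m y)%:C * conjc (T' (ind1 R x) y)).
  by rewrite -[LHS](mulKf mx0) E // pairing_ind1l.
apply: (mulfI mx0); rewrite E // ipE /pairing.
have s : abs_summable (fun y => (m y)%:C * f y * conjc (T' (ind1 R x) y)).
  by apply: (pairable_sum m_gt0); apply: l2_pairable => //; exact: T1'.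
have s0 : abs_summable (fun _ : X => 0 : R[i]).
  by apply: (@abs_summable_fin _ _ _ fset0).
have := csum_linear ((m x)%:C^-1) s s0.
rewrite (@csum_fin _ _ (fun=> 0) fset0) // big_seq_fset0 addr0.
have -> : (fun y => T (ind1 R y) x * f y)
  = fun y => (m x)%:C^-1 * ((m y)%:C * f y * conjc (T' (ind1 R x) y)) + 0.
  by apply/funext => y; rewrite kE; ring.
by move=> ->; rewrite mulrA mulfV // mul1r.
Qed.

End SymmetricResolvents.

(** * Filter limits in epsilon form *)

Section NormConvergence.
Variables (R : realType) (X : choiceType) (m : X -> R).
Implicit Types (p : \bar R).

Lemma lpnorm_cvg0P (I : Type) (F : set_system I) (FF : Filter F) p
    (f : I -> X -> R[i]) : (\forall t \near F, lpmem m p (f t)) ->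
  (lpnorm m p (f t) @[t --> F] --> 0%E) <->
  (forall e : R, 0 < e -> \forall t \near F, nrm m p (f t) <= e).
Proof.
move=> lf.
have E : (fun t => fine (lpnorm m p (f t))) = fun t => nrm m p (f t).
  by apply/funext => t; rewrite nrm.unlock.
split.
  move=> /fine_cvgP[_]; rewrite /comp E => /cvgr0_norm_le h e e0.
  by apply: filterS (h _ e0) => t; exact: le_trans (ler_norm _).
move=> h; apply/fine_cvgP; split.
  by apply: filterS lf => t lt; rewrite lpE.
rewrite /comp E; apply/cvgrPdist_le => e e0; apply: filterS (h _ e0) => t.
by rewrite sub0r normrN ger0_norm // nrm_ge0.
Qed.

Lemma near_right0P (P : R -> Prop) : (\forall t \near 0^'+, P t) <->
  exists2 dl : R, 0 < dl & forall t, 0 < t -> t <= dl -> P t.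
Proof.
split=> [[dl /= dl0 h]|[dl dl0 h]].
  exists (dl / 2); first by rewrite divr_gt0.
  move=> t t0 tdl; apply: (h t) => //=; rewrite sub0r normrN gtr0_norm //; lra.
exists dl => //= t /=; rewrite sub0r normrN => tdl t0; apply: h => //.
by move: tdl; rewrite gtr0_norm // => /ltW.
Qed.

Lemma near_ooP (P : nat -> Prop) : (\forall n \near \oo, P n) <->
  exists N : nat, forall n, (N <= n)%N -> P n.
Proof. by split=> [[N _ h]|[N h]]; exists N. Qed.

End NormConvergence.

(** * Strongly continuous semigroups and their generators *)

Section Semigroups.
Variables (R : realType) (X : choiceType) (m : X -> R).
Hypothesis m_gt0 : forall x, 0 < m x.
Variable p : \bar R.
Hypothesis p1 : (1 <= p)%E.
Implicit Types (f g h u v : X -> R[i]) (t e : R).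
Local Notation L := (lpmem m p).
Local Notation N := (nrm m p).
Local Notation lpB := (lpB m_gt0 p1).
Local Notation lpD := (lpD m_gt0 p1).
Local Notation lpZ := (lpZ m_gt0 p1).

Definition bounded_lin (T : (X -> R[i]) -> X -> R[i]) :=
  [/\ forall f, L f -> L (T f),
      forall a f g, L f -> L g -> T (a ** f + g) = a ** T f + T g
    & exists2 M : R, 0 <= M & forall f, L f -> N (T f) <= M * N f].

(** Stands in for the operator norm: among the candidates M0 (3/4)^k, the last one before the first
    failure is nearly attained. The lower bound [c] guarantees that a candidate fails. *)
Lemma opnorm_attained T (c : R) : bounded_lin T -> 0 < c ->
  (exists2 f, L f & c * N f < N (T f)) ->
  exists M : R, [/\ c <= M, forall f, L f -> N (T f) <= M * N f
    & exists2 f, L f & 3 / 4 * M * N f < N (T f)].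
Proof.
move=> [_ _ [M0 M00 hM0]] c0 [f0 lf0 hf0].
pose B k := forall f, L f -> N (T f) <= M0 * (3 / 4) ^+ k * N f.
have up k : B k -> c <= M0 * (3 / 4) ^+ k.
  move=> hk; rewrite leNgt; apply/negP => /ltW le.
  have := lt_le_trans hf0 (hk _ lf0); rewrite ltNge; move/negP; apply.
  by rewrite ler_wpM2r // nrm_ge0.
have [k hk] : exists k, ~ B k.
  have q1 : (3 / 4 : R) < 1 by lra.
  have q0 : 0 <= (3 / 4 : R) by lra.
  have c2 : 0 < c / 2 by lra.
  have [k h] := geometric_small M0 q0 q1 c2; exists k => /up le.
  by have := le_trans le (h k (leqnn _)); lra.
have ex : exists k, `[< ~ B k >] by exists k; apply/asboolP.
case: (ex_minnP ex) => -[|n] /asboolP nB min_.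
  by exfalso; apply: nB => f lf; rewrite mulr1; exact: hM0.
have Bn : B n.
  by apply: contrapT => /asboolP /min_; rewrite ltnn.
exists (M0 * (3 / 4) ^+ n); split => //; first exact: up.
apply: contrapT => h; apply: nB => f lf; rewrite leNgt; apply/negP => lt.
apply: h; exists f => //; apply: le_lt_trans lt; rewrite exprS; leq_ring.
Qed.

(* Sokal's gliding hump. *)
Lemma uniform_boundedness (T : nat -> (X -> R[i]) -> X -> R[i]) :
  (forall n, bounded_lin (T n)) ->
  (forall n : nat, exists2 f, L f & 4 ^+ n * N f < N (T n f)) ->
  exists2 x, L x & forall C : R, exists K : nat, forall n, (K <= n)%N -> C < N (T n x).
Proof.
move=> bT unb.
have /choice[Mn hMn] : forall n : nat, exists M : R, [/\ 4 ^+ n <= M,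
    forall f, L f -> N (T n f) <= M * N f
    & exists2 f, L f & 3 / 4 * M * N f < N (T n f)].
  by move=> n; apply: opnorm_attained => //; rewrite exprn_gt0.
have lT n f : L f -> L (T n f) by case: (bT n) => h _ _; exact: h.
have linT n : forall a f g, L f -> L g -> T n (a ** f + g) = a ** T n f + T n g.
  by case: (bT n).
have M0 n : 0 < Mn n by have [h _ _] := hMn n; apply: lt_le_trans h; rewrite exprn_gt0.
have q0 : 0 <= (3^-1 : R) by rewrite invr_ge0.
have q1 : (3^-1 : R) < 1 by rewrite invf_lt1 //; lra.
have /choice[g hg] : forall n : nat, exists g, [/\ L g, N g <= 3^-1 ^+ n
    & 3 / 4 * Mn n * 3^-1 ^+ n <= N (T n g)].
  move=> n; have [_ bM [f lf hf]] := hMn n.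
  have f0 : N f != 0.
    apply/eqP => f0; move: hf; rewrite (nrm_eq0 m_gt0 p1 lf f0) (lin_op0 m_gt0 p1 (linT n)).
    by rewrite nrm0 // mulr0 ltxx.
  have Nf0 : 0 < N f by rewrite lt_def f0 nrm_ge0.
  pose c := 3^-1 ^+ n / N f; have c0 : 0 <= c by rewrite divr_ge0 ?exprn_ge0 // ltW.
  exists (c%:C ** f); split; first exact: lpZ.
    apply: le_trans (nrmZ_le m_gt0 p1 _ lf) _.
    by rewrite normcR ger0_norm // divfK.
  have cn0 : c != 0 by rewrite mulf_neq0 ?invr_eq0 // expf_neq0 // invr_eq0.
  have ci : 0 < c^-1 by rewrite invr_gt0 lt_def cn0.
  have : N (T n f) <= c^-1 * N (T n (c%:C ** f)).
    rewrite (lin_opZ m_gt0 p1 (linT n)) //.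
    have {1}-> : T n f = (c^-1)%:C ** (c%:C ** T n f).
      rewrite cscaleA -rmorphM mulVf // ; apply/funext => x; by rewrite /cscale mul1r.
    apply: le_trans (nrmZ_le m_gt0 p1 _ (lpZ _ (lT _ _ lf))) _.
    by rewrite normcR gtr0_norm.
  move=> /(lt_le_trans hf); rewrite -ltr_pdivrMl // invrK => /ltW; apply: le_trans.
  by rewrite /c; leq_eq; field.
(* The sign is chosen so that the image is at least as large as that of [g n]; one sign works
   because 2 T g = T (x + g) - T (x - g). *)
pose step n x := if N (T n (g n)) <= N (T n (x + g n)) then x + g n else x - g n.
pose fix x (n : nat) := if n is n'.+1 then step n' (x n') else 0.
have lg n : L (g n) by case: (hg n).
have lx n : L (x n).
  elim: n => [|n IH]; first exact: lp0.
  by rewrite /= /step; case: ifP => _; [exact: lpD|exact: lpB].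
have dx n : N (x n.+1 - x n) <= 1 * 3^-1 ^+ n.
  rewrite mul1r; apply: le_trans (_ : N (g n) <= _); last by case: (hg n).
  rewrite /= /step; case: ifP => _; first by rewrite addrAC subrr add0r.
  by rewrite addrAC subrr add0r nrmN.
have Tx n : N (T n (g n)) <= N (T n (x n.+1)).
  rewrite /= /step; case: ifP => //= /negbT; rewrite -ltNge => lt.
  have lp1 := lT n _ (lpD (lx n) (lg n)); have lp2 := lT n _ (lpB (lx n) (lg n)).
  have : 2 * N (T n (g n)) <= N (T n (x n + g n)) + N (T n (x n - g n)).
    have -> : 2 * N (T n (g n)) = N (2 ** T n (g n)).
      apply/eqP; rewrite eq_le; apply/andP; split; last first.
        apply: le_trans (nrmZ_le m_gt0 p1 _ (lT _ _ (lg n))) _.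
        by rewrite -(rmorph_nat (real_complex R)) normcR normr_nat.
      rewrite -ler_pdivlMl //.
      have {1}-> : T n (g n) = (2^-1)%:C ** (2 ** T n (g n)).
        rewrite cscaleA -(rmorph_nat (real_complex R)) -rmorphM mulVf //.
        by apply/funext => y; rewrite /cscale mul1r.
      apply: le_trans (nrmZ_le m_gt0 p1 _ (lpZ _ (lT _ _ (lg n)))) _.
      by rewrite normcR ger0_norm.
    have -> : 2 ** T n (g n) = T n (x n + g n) - T n (x n - g n).
      rewrite (lin_opD (linT n)) // (lin_opB (linT n)) //; fext.
    exact: nrmB.
  lra.
have [y ly hy] := complete_lp m_gt0 p1 lx (geometric_cauchy m_gt0 p1 q0 q1 lx dx).
(* The later steps add up to at most 3^-(n+1) / (1 - 1/3) = 3^-n / 2. *)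
have tail n : N (y - x n.+1) <= 2^-1 * 3^-1 ^+ n.
  apply/ler_addgt0Pr => e e0; have [K hK] := hy _ e0.
  pose k := maxn K n.+1.
  have -> : y - x n.+1 = (x k - x n.+1) - (x k - y) by fext.
  apply: le_trans (nrmB m_gt0 p1 (lpB (lx _) (lx _)) (lpB (lx _) ly)) _.
  apply: lerD; last by apply: hK; rewrite leq_maxl.
  apply: le_trans (geometric_tail m_gt0 p1 q0 q1 lx dx (leq_maxr _ _)) _.
  by rewrite exprS; leq_eq; field.
exists y => // C.
(* What remains is at least (3/4 - 1/2) Mn 3^-n, and Mn >= 4^n. *)
have low n : 4^-1 * (4 / 3) ^+ n <= N (T n y).
  have [h4 bM _] := hMn n; have [_ _ hgn] := hg n.
  have lyx := lpB ly (lx n.+1).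
  have := bM _ lyx; have := ler_wpM2l (ltW (M0 n)) (tail n).
  have := Tx n; have : N (T n (x n.+1)) <= N (T n y) + N (T n (y - x n.+1)).
    have {1}-> : T n (x n.+1) = T n y - T n (y - x n.+1).
      rewrite (lin_opB (linT n)) //; fext.
    by apply: nrmB => //; exact: lT.
  have := ler_wpM2r (exprn_ge0 n q0) h4; rewrite -exprMn.
  move: hgn; move: (x n.+1) => xn.
  move: (N _) (N _) (N _) (N _) (N _) (3^-1 ^+ n) => a1 a2 a3 a4 a5 q3.
  move: (Mn n) ((4 / 3) ^+ n) => Mm q43; lra.
have q34 : (3 / 4 : R) < 1 by lra.
have q340 : 0 <= (3 / 4 : R) by lra.
have e8 : 0 < (8^-1 : R) by rewrite invr_gt0.
have [K hK] := geometric_small `|C| q340 q34 e8.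
exists K => n /hK hn; apply: lt_le_trans (low n).
have P0 : 0 < (4 / 3 : R) ^+ n by rewrite exprn_gt0 // divr_gt0.
have := ler_wpM2r (ltW P0) hn.
rewrite -mulrA -exprMn (_ : 3 / 4 * (4 / 3) = 1 :> R); last by field.
rewrite expr1n mulr1 => h; apply: le_lt_trans (ler_norm C) _.
apply: le_lt_trans h _; rewrite ltr_pM2r // ltf_pV2 ?posrE //; lra.
Qed.


Definition semigroup_on (S : R -> (X -> R[i]) -> X -> R[i]) :=
  [/\ forall t, 0 <= t -> bounded_lin (S t),
      forall f, L f -> S 0 f = f,
      forall t (s : R) f, 0 <= t -> 0 <= s -> L f -> S (t + s) f = S t (S s f)
    & forall f, L f -> forall e, 0 < e -> exists2 dl : R, 0 < dl &
        forall t, 0 < t -> t <= dl -> N (S t f - f) <= e].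

Definition gen (S : R -> (X -> R[i]) -> X -> R[i]) f g :=
  [/\ L f, L g & forall e, 0 < e -> exists2 dl : R, 0 < dl &
        forall t, 0 < t -> t <= dl -> N ((t^-1)%:C ** (S t f - f) - g) <= e].

Lemma C0_semigroupP S : C0_semigroup m p S -> semigroup_on S.
Proof.
have E f : lp m p f = L f by rewrite lpmem.unlock.
move=> [S1 S2 S3 S4]; have B t : 0 <= t -> bounded_lin (S t).
  by move=> t0; apply/bounded_opP/S1.
split => //.
- by move=> f; rewrite -E; exact: S2.
- by move=> t s f t0 s0; rewrite -E; exact: S3.
move=> f lf e e0; apply/near_right0P; move: e e0; apply/lpnorm_cvg0P; last first.
  by apply: S4; rewrite E.
apply/near_right0P; exists 1 => // t t0 _; apply: lpB => //.
by case: (B t (ltW t0)) => h _ _; exact: h.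
Qed.

Lemma generatorP S f g : semigroup_on S -> generator m p S f g <-> gen S f g.
Proof.
have E h : lp m p h = L h by rewrite lpmem.unlock.
move=> [B _ _ _].
have lS t h : 0 <= t -> L h -> L (S t h) by move=> /B[h1 _ _]; exact: h1.
have P : L f -> L g ->
  (lpnorm m p (fun x => (t^-1)%:C * (S t f x - f x) - g x) @[t --> 0^'+] --> 0%E) <->
  (forall e, 0 < e -> exists2 dl : R, 0 < dl &
        forall t, 0 < t -> t <= dl -> N ((t^-1)%:C ** (S t f - f) - g) <= e).
  move=> lf lg.
  have near_l : \forall t \near 0^'+, L ((t^-1)%:C ** (S t f - f) - g).
    apply/near_right0P; exists 1 => // t t0 _; apply: lpB => //.
    by apply: lpZ; apply: lpB => //; apply: lS => //; exact: ltW.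
  split.
    move=> /(lpnorm_cvg0P _ near_l) h e e0; apply/near_right0P; exact: h.
  move=> h; apply/(lpnorm_cvg0P _ near_l) => e e0; apply/near_right0P; exact: h.
split=> [[]|[lf lg h]]; first by rewrite !E => lf lg h; split => //; apply/P.
by split; rewrite ?E //; apply/P.
Qed.

(** Otherwise times t_n <= 1 / (n + 1) exist at which 4^n is not a bound, and uniform boundedness
    yields a vector along which strong continuity at 0 fails. *)
Lemma sg_locally_bounded S : semigroup_on S -> exists2 dl : R, 0 < dl &
  exists2 M : R, 0 <= M & forall t f, 0 <= t -> t <= dl -> L f -> N (S t f) <= M * N f.
Proof.
move=> [B S0 _ cont]; apply: contrapT => h.
have /choice[tn htn] : forall n : nat, exists t : R, [/\ 0 <= t, t <= n.+1%:R^-1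
    & exists2 f, L f & 4 ^+ n * N f < N (S t f)].
  move=> n; apply: contrapT => hn; apply: h; exists n.+1%:R^-1; first by rewrite invr_gt0.
  exists (4 ^+ n); first by rewrite exprn_ge0.
  move=> t f t0 tn lf; rewrite leNgt; apply/negP => lt; apply: hn.
  by exists t; split => //; exists f.
(* At time 0 the operator is the identity, for which 4^n is a bound. *)
have tn0 n : 0 < tn n.
  have [t0 _ [f lf hf]] := htn n; rewrite lt_def t0 andbT; apply/eqP => t00.
  move: hf; rewrite t00 S0 // ltNge; move/negP; apply.
  by rewrite ler_peMl ?nrm_ge0 // exprn_ege1 //; lra.
have [||y ly unb] := uniform_boundedness (T := fun n => S (tn n)).
- by move=> n; apply: B; exact: ltW.
- by move=> n; case: (htn n).
have [dl dl0 hdl] := cont y ly 1 ltr01.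
have [K1 h1] := unb (N y + 1); have [K2 h2] := inv_succ_small dl0.
pose n := maxn K1 K2; have := h1 n (leq_maxl _ _).
have [_ le _] := htn n.
have := hdl (tn n) (tn0 n) (le_trans le (h2 n (leq_maxr _ _))).
have [lS _ _] := B _ (ltW (tn0 n)).
have := nrmD m_gt0 p1 (lpB (lS _ ly) ly) ly; rewrite subrK; lra.
Qed.

Lemma gen_small S f g : gen S f g -> (forall t, 0 < t -> L (S t f)) ->
  forall e, 0 < e -> exists2 dl : R, 0 < dl &
    forall t, 0 < t -> t <= dl -> N (S t f - f - t%:C ** g) <= e * t.
Proof.
move=> [lf lg h] lS e e0; have [dl dl0 hdl] := h e e0.
exists dl => // t t0 tdl.
have -> : S t f - f - t%:C ** g = t%:C ** ((t^-1)%:C ** (S t f - f) - g).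
  by rewrite cscaleBr cscaleA -rmorphM mulfV ?gt_eqF // rmorph1 cscale1.
apply: le_trans (nrmZ_le m_gt0 p1 _ _) _.
  by apply: lpB => //; apply: lpZ; apply: lpB => //; exact: lS.
by rewrite normcR gtr0_norm // mulrC ler_wpM2r ?(ltW t0) //; exact: hdl.
Qed.

(* S(t)u - u - t h = int_0^t (S(s)h - h) ds, as a limit of Riemann sums. *)
Lemma gen_riemann S u h (dl M t : R) : semigroup_on S -> 0 <= M ->
  (forall s f, 0 <= s -> s <= dl -> L f -> N (S s f) <= M * N f) ->
  gen S u h -> 0 < t -> t <= dl ->
  cvg_lp m p (fun n => (t / n.+1%:R)%:C **
    \sum_(k < n.+1) (S (k%:R * (t / n.+1%:R)) h - h)) (S t u - u - t%:C ** h).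
Proof.
move=> [B S0 SD _] M0 hM hu t0 tdl; have [lu lh _] := hu.
have lS s f : 0 <= s -> L f -> L (S s f) by move=> /B[h1 _ _]; exact: h1.
have linS s : 0 <= s -> forall a f g, L f -> L g -> S s (a ** f + g) = a ** S s f + S s g.
  by move=> /B[].
have lSu s : 0 < s -> L (S s u) by move=> s0; apply: lS => //; exact: ltW.
move=> e e0; pose e' := e / (M * t + 1).
have c0 : 0 < M * t + 1 by rewrite ltr_wpDl // mulr_ge0 // ltW.
have e'0 : 0 < e' by rewrite divr_gt0.
have [d1 d10 hd1] := gen_small hu lSu e'0.
have dt0 : 0 < d1 / t by rewrite divr_gt0.
have [K hK] := inv_succ_small dt0; exists K => n /hK hn.
pose tau := t / n.+1%:R; have tau0 : 0 < tau by rewrite divr_gt0.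
have tau_d1 : tau <= d1 by rewrite /tau mulrC -ler_pdivlMr.
have ntau : n.+1%:R * tau = t by rewrite /tau mulrC divfK // pnatr_eq0.
have ktau0 k : 0 <= k%:R * tau by rewrite mulr_ge0 // ltW.
pose r := S tau u - u - tau%:C ** h.
have lr : L r by apply: lpB; [apply: lpB => //; exact: lSu|exact: lpZ].
(* Telescoping reduces the claim to one step, S(tau) u - u = tau h + r with |r| <= e' tau; the n + 1
   remainders add up to at most M e' t. *)
have tele : forall k, S (k%:R * tau) u - u = \sum_(j < k) S (j%:R * tau) (S tau u - u).
  elim=> [|k IH]; first by rewrite big_ord0 mul0r S0 // subrr.
  rewrite big_ord_recr /= -IH -natr1 mulrDl mul1r SD // ?(ltW tau0) //.
  rewrite (lin_opB (linS _ (ktau0 k))) //; [fext|exact: lSu].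
have -> : tau%:C ** (\sum_(k < n.+1) (S (k%:R * tau) h - h)) - (S t u - u - t%:C ** h)
   = - \sum_(k < n.+1) S (k%:R * tau) r.
  rewrite -{1}ntau tele.
  have -> : \sum_(j < n.+1) S (j%:R * tau) (S tau u - u)
     = \sum_(j < n.+1) S (j%:R * tau) r + tau%:C ** \sum_(j < n.+1) S (j%:R * tau) h.
    rewrite cscale_suml -big_split; apply: eq_bigr => j _ /=.
    rewrite -(lin_opZ m_gt0 p1 (linS _ (ktau0 j))) // -(lin_opD (linS _ (ktau0 j))) //.
      by congr (S _ _); rewrite /r subrK.
    exact: lpZ.
  rewrite sumrB cscaleBr.
  have -> : tau%:C ** (\sum_(k < n.+1) h) = t%:C ** h.
    rewrite sumr_const card_ord -ntau; apply/funext => x.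
    by rewrite natmulfctE /cscale (rmorphM _ n.+1%:R) -(mulr_natl (h x)) -(rmorph_nat (real_complex R)); ring.
  fext.
rewrite nrmN //.
have lSr (k : 'I_n.+1) : L (S (k%:R * tau) r) by exact: lS.
apply: le_trans (nrm_sum m_gt0 p1 _ lSr) _.
apply: (@le_trans _ _ (\sum_(k < n.+1) M * (e' * tau))).
  apply: ler_sum => k _; apply: le_trans (hM _ _ (ktau0 k) _ lr) _.
    apply: le_trans tdl; rewrite -ntau ler_wpM2r ?(ltW tau0) // ler_nat.
    exact/ltnW/ltn_ord.
  by rewrite ler_wpM2l //; exact: hd1.
rewrite sumr_const card_ord -mulr_natl.
have -> : n.+1%:R * (M * (e' * tau)) = e' * (M * (n.+1%:R * tau)) by ring.
rewrite ntau /e' mulrAC ler_pdivrMr //.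
by rewrite ler_wpM2l ?(ltW e0) // lerDl.
Qed.

Lemma gen_commute S (T : (X -> R[i]) -> X -> R[i]) u h : semigroup_on S ->
  bounded_lin T -> (forall t f, 0 <= t -> L f -> T (S t f) = S t (T f)) ->
  gen S u h -> gen S (T u) (T h).
Proof.
move=> [B _ _ _] [T1 T2 [M M0 hM]] comm [lu lh hu]; split; [exact: T1|exact: T1|].
move=> e e0; have c0 : 0 < M + 1 by lra.
have [dl dl0 hdl] := hu _ (divr_gt0 e0 c0); exists dl => // t t0 tdl.
have lSu : L (S t u) by have [h1 _ _] := B _ (ltW t0); exact: h1.
have lq : L ((t^-1)%:C ** (S t u - u)) by apply: lpZ; exact: lpB.
have -> : (t^-1)%:C ** (S t (T u) - T u) - T h = T ((t^-1)%:C ** (S t u - u) - h).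
  rewrite (lin_opB T2) // (lin_opZ m_gt0 p1 T2) ?(lin_opB T2) //; last exact: lpB.
  by rewrite comm // ltW.
apply: le_trans (hM _ (lpB lq lh)) _.
by apply: ler_mul_div1; rewrite ?nrm_ge0 //; exact: hdl.
Qed.

Lemma gen_lin S a u1 h1 u2 h2 : semigroup_on S -> gen S u1 h1 -> gen S u2 h2 ->
  gen S (a ** u1 + u2) (a ** h1 + h2).
Proof.
move=> [B _ _ _] [lu1 lh1 g1] [lu2 lh2 g2]; split.
- by apply: lpD => //; exact: lpZ.
- by apply: lpD => //; exact: lpZ.
move=> e e0; have c0 : 0 < normc a + 1 by have := normc_ge0 a; lra.
have e1 : 0 < e / 2 / (normc a + 1) by rewrite !divr_gt0.
have [d1 d10 k1] := g1 _ e1; have [d2 d20 k2] := g2 (e / 2) ltac:(lra).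
exists (Num.min d1 d2); first by rewrite lt_min d10.
move=> t t0; rewrite le_min => /andP[td1 td2].
have [lS linS _] := B _ (ltW t0).
have lq f h : L f -> L h -> L ((t^-1)%:C ** (S t f - f) - h).
  by move=> lf lh; apply: lpB => //; apply: lpZ; apply: lpB => //; exact: lS.
have -> : (t^-1)%:C ** (S t (a ** u1 + u2) - (a ** u1 + u2)) - (a ** h1 + h2)
  = a ** ((t^-1)%:C ** (S t u1 - u1) - h1) + ((t^-1)%:C ** (S t u2 - u2) - h2).
  by rewrite linS //; fext.
apply: le_trans (nrmD m_gt0 p1 (lpZ _ (lq _ _ lu1 lh1)) (lq _ _ lu2 lh2)) _.
have := k2 t t0 td2; have := nrmZ_le m_gt0 p1 a (lq _ _ lu1 lh1).
have : normc a * N ((t^-1)%:C ** (S t u1 - u1) - h1) <= e / 2.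
  by apply: ler_mul_div1; rewrite ?normc_ge0 ?nrm_ge0 //; exact: k1.
lra.
Qed.

(** A mean value inequality suffices, since strong continuity makes the oscillation of s -> S s h
    small. In this form the criterion involves no integral and is stable under l^p limits of the
    pair (u, h). *)
Lemma gen_intro S u h : semigroup_on S -> L u -> L h ->
  (exists2 dl : R, 0 < dl & forall t e, 0 < t -> t <= dl ->
     (forall s, 0 <= s -> s <= t -> N (S s h - h) <= e) ->
     N (S t u - u - t%:C ** h) <= t * e) -> gen S u h.
Proof.
move=> [B S0 _ cont] lu lh [d1 d10 hd1]; split => // e e0.
have [d2 d20 hd2] := cont h lh e e0.
exists (Num.min d1 d2); first by rewrite lt_min d10.
move=> t t0; rewrite le_min => /andP[td1 td2].
have lSu : L (S t u) by have [h1 _ _] := B _ (ltW t0); exact: h1.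
have -> : (t^-1)%:C ** (S t u - u) - h = (t^-1)%:C ** (S t u - u - t%:C ** h).
  by rewrite [RHS]cscaleBr cscaleA -rmorphM mulVf ?gt_eqF // rmorph1 cscale1.
apply: le_trans (nrmZ_le m_gt0 p1 _ _) _.
  by apply: lpB; [exact: lpB|exact: lpZ].
rewrite normcR gtr0_norm ?invr_gt0 // mulrC ler_pdivrMr // mulrC.
apply: hd1 => // s s0 st; move: s0; rewrite le_eqVlt => /orP[/eqP <-|s0].
  by rewrite S0 // subrr nrm0 // ltW.
by apply: hd2 => //; exact: le_trans st td2.
Qed.

End Semigroups.

(** * Operators determined on finitely supported functions *)

Section Density.
Variables (R : realType) (X : choiceType) (m : X -> R).
Hypothesis m_gt0 : forall x, 0 < m x.
Variable p : \bar R.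
Hypothesis p1 : (1 <= p)%E.
Hypothesis p_fin : (p < +oo)%E.
Implicit Types (f g h u v : X -> R[i]).
Local Notation L := (lpmem m p).
Local Notation N := (nrm m p).
Local Notation lpB := (lpB m_gt0 p1).

Lemma bounded_lin_comp (T1 T2 : (X -> R[i]) -> X -> R[i]) :
  bounded_lin m p T1 -> bounded_lin m p T2 -> bounded_lin m p (T1 \o T2).
Proof.
move=> [l1 a1 [M1 M10 b1]] [l2 a2 [M2 M20 b2]]; split.
- by move=> f /l2/l1.
- by move=> a f g lf lg /=; rewrite a2 ?a1 //; exact: l2.
exists (M1 * M2); first exact: mulr_ge0.
move=> f lf /=; apply: le_trans (b1 _ (l2 _ lf)) _.
by rewrite -mulrA ler_wpM2l ?b2.
Qed.

Lemma bounded_lin_ext (T1 T2 : (X -> R[i]) -> X -> R[i]) f :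
  bounded_lin m p T1 -> bounded_lin m p T2 -> L f ->
  (forall F : {fset X}, T1 (restrict F f) = T2 (restrict F f)) -> T1 f = T2 f.
Proof.
move=> [l1 a1 [M1 M10 b1]] [l2 a2 [M2 M20 b2]] lf E.
apply/eqP; rewrite -subr_eq0; apply/eqP; apply: (nrm_eq0 m_gt0 p1).
  by apply: lpB; [exact: l1|exact: l2].
apply/eqP; rewrite eq_le nrm_ge0 andbT; apply/ler_addgt0Pr => e e0; rewrite add0r.
have c0 : 0 < M1 + M2 + 1 by rewrite ltr_wpDl // addr_ge0.
have [F hF] := lp_tail m_gt0 p1 p_fin lf (divr_gt0 e0 c0).
have {hF} := hF F (fsubset_refl _).
have lr : L (restrict F f) by exact: restrict_lp.
have ld := lpB lf lr; move=> hF.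
have -> : T1 f - T2 f = T1 (f - restrict F f) - T2 (f - restrict F f).
  by rewrite (lin_opB a1) // (lin_opB a2) // E; fext.
apply: le_trans (nrmB m_gt0 p1 (l1 _ ld) (l2 _ ld)) _.
have := b1 _ ld; have := b2 _ ld; have := nrm_ge0 m p (f - restrict F f).
have : (M1 + M2 + 1) * N (f - restrict F f) <= e.
  by rewrite mulrC -ler_pdivlMr.
lra.
Qed.

End Density.

(** * Transfer of resolvents between l^2 and l^p *)

Section SpectrumTransfer.
Variables (R : realType) (X : choiceType) (m : X -> R).
Hypothesis m_gt0 : forall x, 0 < m x.
Implicit Types (f g h u v w : X -> R[i]) (z : R[i]) (p : \bar R).
Local Notation ip := (ip m).
Local Notation L2 := (lpmem m 2%:E).
Local Notation N2 := (nrm m 2%:E).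

Variable A : graph R X.
Hypothesis A_dom : forall f g, A f g -> L2 f /\ L2 g.
Hypothesis A_lin : forall a f1 g1 f2 g2, A f1 g1 -> A f2 g2 ->
  A (a ** f1 + f2) (a ** g1 + g2).
Hypothesis A_sym : forall u f v g, A u f -> A v g -> ip f v = ip u g.
Hypothesis A_nonreal : forall z, complex.Im z != 0 ->
  exists T, resolvent_op m 2%:E A z T.
Hypothesis A_schur : forall z T, resolvent_op m 2%:E A z T -> exists2 S : R, 0 <= S &
  (forall x (F : {fset X}), \sum_(y <- F) normc (T (ind1 R y) x) <= S) /\
  (forall y (F : {fset X}), \sum_(x <- F) m x * normc (T (ind1 R y) x) <= S * m y).

Lemma resolvent_conjc z : (exists T, resolvent_op m 2%:E A z T) ->
  exists T, resolvent_op m 2%:E A (conjc z) T.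
Proof.
case: z => a b; have [->|b0] := eqVneq b 0; first by rewrite /= oppr0.
by move=> _; apply: A_nonreal; rewrite /= oppr_eq0.
Qed.

(** The candidate resolvent on every l^p at once: the kernel of the l^2 resolvent, summed against
    arbitrary functions. *)
Definition extend (T : (X -> R[i]) -> X -> R[i]) :=
  kernel_op (fun x y => T (ind1 R y) x).

Section OneResolvent.
Variables (z : R[i]) (T : (X -> R[i]) -> X -> R[i]).
Hypothesis hT : resolvent_op m 2%:E A z T.
Local Notation E := (extend T).

Lemma extend_bounded p : (1 <= p)%E -> bounded_lin m p E.
Proof.
move=> p1; have [S S0 [hr hc]] := A_schur hT; split.
- by move=> f lf; case: (kernel_op_bounded m_gt0 S0 hr hc p1 lf).
- by move=> a f g lf lg; apply: (kernel_op_lin m_gt0 S0 hr hc p1).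
- by exists S => // f lf; case: (kernel_op_bounded m_gt0 S0 hr hc p1 lf).
Qed.

Lemma extendE f : L2 f -> E f = T f.
Proof.
have [T' hT'] := resolvent_conjc (ex_intro _ T hT).
by move=> lf; apply/funext => x; rewrite (resolvent_kernelE m_gt0 A_sym hT hT').
Qed.

End OneResolvent.

Section FiniteExponent.
Variable S : \bar R -> R -> (X -> R[i]) -> X -> R[i].
Hypothesis S_sg : forall p, (1 <= p)%E -> (p < +oo)%E -> semigroup_on m p (S p).
Hypothesis S_gen : forall f g, gen m 2%:E (S 2%:E) f g <-> A f (- g).
Hypothesis S_consistent : forall p t f, (1 <= p)%E -> (p < +oo)%E -> 0 <= t ->
  L2 f -> lpmem m p f -> S p t f = S 2%:E t f.
Let lt2y : (2%:E < +oo :> \bar R)%E. Proof. exact: ltry. Qed.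

Variable p : \bar R.
Hypothesis p1 : (1 <= p)%E.
Hypothesis p_fin : (p < +oo)%E.
Local Notation L := (lpmem m p).
Local Notation N := (nrm m p).
Local Notation lpB := (lpB m_gt0 p1).
Local Notation lpD := (lpD m_gt0 p1).
Local Notation lpZ := (lpZ m_gt0 p1).
Local Notation lpN := (lpN m_gt0 p1).

(** In l^2 the displacement is a limit of Riemann sums, whose terms are those of [S p] by
    consistency. Each Riemann sum obeys the bound in l^p, and Fatou carries it along the l^2
    limit. *)
Lemma gen_transfer : exists2 dl : R, 0 < dl & forall u h,
  gen m 2%:E (S 2%:E) u h -> L u -> L h -> forall t e, 0 < t -> t <= dl ->
  (forall s, 0 <= s -> s <= t -> N (S p s h - h) <= e) ->
  N (S p t u - u - t%:C ** h) <= t * e.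
Proof.
have sg2 := S_sg le12 lt2y; have sgp := S_sg p1 p_fin.
have [dl dl0 [M M0 hM]] := sg_locally_bounded m_gt0 le12 sg2.
exists dl => // u h gu lu lh t e t0 tdl he.
have [lu2 lh2 _] := gu; have [B2 _ _ _] := sg2; have [Bp _ _ _] := sgp.
have lSp s f : 0 <= s -> L f -> L (S p s f) by move=> /Bp[k _ _]; exact: k.
have lS2 s f : 0 <= s -> L2 f -> L2 (S 2%:E s f) by move=> /B2[k _ _]; exact: k.
have := gen_riemann m_gt0 le12 sg2 M0 hM gu t0 tdl.
set w := fun n => _ => cw.
have tn0 n : 0 <= t / n.+1%:R by rewrite divr_ge0 // ltW.
have kn0 n k : 0 <= k%:R * (t / n.+1%:R) by rewrite mulr_ge0.
have l2w n : L2 (w n).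
  by apply: l2Z => //; apply: lp_sum => // k; apply: l2B => //; exact: lS2.
have wE n : w n = (t / n.+1%:R)%:C ** \sum_(k < n.+1) (S p (k%:R * (t / n.+1%:R)) h - h).
  rewrite /w; congr (_ ** _); apply: eq_bigr => k _; congr (_ - _).
  by rewrite S_consistent.
rewrite S_consistent ?(ltW t0) //.
have l2d : L2 (S 2%:E t u - u - t%:C ** h).
  by apply: l2B => //; [apply: l2B => //; exact: lS2 (ltW t0) lu2|exact: l2Z].
have lwk n (k : 'I_n.+1) : L (S p (k%:R * (t / n.+1%:R)) h - h) by apply: lpB => //; exact: lSp.
have lw n : L (w n) by rewrite wE; apply: lpZ; exact: lp_sum.
suff bd : exists K : nat, forall n, (K <= n)%N -> N (w n) <= t * e.
  by case: (lp_fatou m_gt0 p1 (cvg_lp_pt m_gt0 le12 l2w l2d cw) lw bd).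
exists 0%N => n _; rewrite wE; apply: le_trans (nrmZ_le m_gt0 p1 _ _) _.
  exact: lp_sum.
rewrite normcR ger0_norm //.
apply: (@le_trans _ _ (t / n.+1%:R * \sum_(k < n.+1) e)).
  rewrite ler_wpM2l //; apply: le_trans (nrm_sum m_gt0 p1 _ (lwk n)) _.
  apply: ler_sum => k _; apply: he => //.
  rewrite mulrA ler_pdivrMr // mulrC ler_wpM2l ?(ltW t0) // ler_nat.
  exact/ltnW/ltn_ord.
rewrite sumr_const card_ord -(mulr_natl e); leq_eq.
by rewrite mulrA divfK // pnatr_eq0.
Qed.

Lemma gen_unique u h1 h2 : gen m p (S p) u h1 -> gen m p (S p) u h2 -> h1 = h2.
Proof.
move=> g1 g2; have := gen_lin m_gt0 p1 (-1) (S_sg p1 p_fin) g1 g2.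
have [lu l1 k1] := g1; have [_ l2 k2] := g2; move=> _.
apply/eqP; rewrite -subr_eq0; apply/eqP; apply: (nrm_eq0 m_gt0 p1); first exact: lpB.
apply/eqP; rewrite eq_le nrm_ge0 andbT; apply/ler_addgt0Pr => e e0; rewrite add0r.
have [d1 d10 {}k1] := k1 (e / 2) ltac:(lra); have [d2 d20 {}k2] := k2 (e / 2) ltac:(lra).
pose t := Num.min d1 d2; have t0 : 0 < t by rewrite lt_min d10.
have td1 : t <= d1 by rewrite ge_min lexx.
have td2 : t <= d2 by rewrite ge_min lexx orbT.
have {}k1 := k1 t t0 td1; have {}k2 := k2 t t0 td2.
have lSu : L (S p t u) by have [B _ _ _] := S_sg p1 p_fin; have [k _ _] := B t (ltW t0); exact: k.
have lq : L ((t^-1)%:C ** (S p t u - u)) by apply: lpZ; exact: lpB.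
have -> : h1 - h2 = ((t^-1)%:C ** (S p t u - u) - h2) - ((t^-1)%:C ** (S p t u - u) - h1).
  by fext.
have := nrmB m_gt0 p1 (lpB lq l2) (lpB lq l1); lra.
Qed.

Variables (z : R[i]) (T : (X -> R[i]) -> X -> R[i]).
Hypothesis hT : resolvent_op m 2%:E A z T.
Local Notation E := (extend T).

(** The semigroup commutes with its own generator, so S(t) T f solves the resolvent equation with
    right-hand side S(t) f. *)
Lemma resolvent_semigroup_comm t f : 0 <= t -> L2 f -> T (S 2%:E t f) = S 2%:E t (T f).
Proof.
move=> t0 lf; have [T1 _ _ T4 T5] := hT; have sg2 := S_sg le12 lt2y.
have [B _ SD _] := sg2; have lu := T1 _ lf; have [lS linS _] := B t t0.
have lzu : L2 (z ** T f - f) by apply: l2B => //; exact: l2Z.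
have gu : gen m 2%:E (S 2%:E) (T f) (- (z ** T f - f)).
  by apply/S_gen; rewrite opprK; exact: T4.
have comm s g : 0 <= s -> L2 g -> S 2%:E t (S 2%:E s g) = S 2%:E s (S 2%:E t g).
  by move=> s0 lg; rewrite -!SD // addrC.
have /S_gen := gen_commute m_gt0 le12 sg2 (B t t0) comm gu.
rewrite (lin_opN m_gt0 le12 linS) // opprK (lin_opB linS) //; last exact: l2Z.
rewrite (lin_opZ m_gt0 le12 linS) // => /T5 <-; congr (T _).
by rewrite opprB addrC subrK.
Qed.

Lemma extend_semigroup_comm t f : 0 <= t -> L f -> E (S p t f) = S p t (E f).
Proof.
move=> t0 lf; have bE := extend_bounded hT p1.
have bE2 := extend_bounded hT le12; have [lE _ _] := bE.
have [Bp _ _ _] := S_sg p1 p_fin; have bS := Bp t t0.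
have [B2 _ _ _] := S_sg le12 lt2y; have [lS2 _ _] := B2 t t0.
have [T1 _ _ _ _] := hT.
apply: (bounded_lin_ext m_gt0 p1 p_fin (T1 := E \o S p t) (T2 := S p t \o E)) => //.
- exact: bounded_lin_comp.
- exact: bounded_lin_comp.
move=> F /=; set g := restrict F f.
have lg2 : L2 g by exact: restrict_lp.
have lg : L g by exact: restrict_lp.
have lTg : L (T g) by rewrite -(extendE hT lg2); exact: lE.
rewrite S_consistent // (extendE hT (lS2 _ lg2)) (extendE hT lg2).
by rewrite S_consistent ?resolvent_semigroup_comm //; exact: T1.
Qed.

(** For finitely supported g the function [extend T g] lies in the l^2 domain and [gen_transfer]
    applies. Its inequality passes to general g by density, and [gen_intro] concludes. *)
Lemma extend_gen g : L g -> gen m p (S p) (E g) (- (z ** E g - g)).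
Proof.
move=> lg; have sgp := S_sg p1 p_fin; have [T1 _ _ T4 _] := hT.
have [lE linE [C C0 hC]] := extend_bounded hT p1.
have [d1 d10 est] := gen_transfer.
have [d2 d20 [M M0 hM]] := sg_locally_bounded m_gt0 p1 sgp.
have [Bp _ _ _] := sgp.
have lS s f : 0 <= s -> L f -> L (S p s f) by move=> /Bp[k _ _]; exact: k.
have linS s : 0 <= s -> forall a f1 f2, L f1 -> L f2 ->
  S p s (a ** f1 + f2) = a ** S p s f1 + S p s f2 by move=> /Bp[].
pose H g' := - (z ** E g' - g').
have lH g' : L g' -> L (H g').
  by move=> lg'; apply/lpN/lpB => //; apply/lpZ/lE.
apply: (gen_intro m_gt0 p1 sgp); [exact: lE|exact: lH|].
exists (Num.min d1 d2); first by rewrite lt_min d10.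
move=> t e t0; rewrite le_min => /andP[td1 td2] he; rewrite -/(H g).
apply/ler_addgt0Pr => eta eta0.
pose CH := normc z * C + 1.
have CH0 : 0 <= CH by rewrite addr_ge0 // mulr_ge0 ?normc_ge0.
(* Collects the three errors of replacing g by its restriction: oscillation of H, displacement of E,
   and the term t H. *)
pose c := t * ((M + 1) * CH) + (M + 1) * C + t * CH + 1.
have c0 : 0 < c.
  by rewrite ltr_wpDl // !addr_ge0 // !mulr_ge0 ?(ltW t0) // addr_ge0.
have [F hF] := lp_tail m_gt0 p1 p_fin lg (divr_gt0 eta0 c0).
have {hF} := hF F (fsubset_refl _); set g' := restrict F g => hF.
have lg' : L g' by exact: restrict_lp.
have lg'2 : L2 g' by exact: restrict_lp.
pose nu := N (g - g').
have ld := lpB lg lg'.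
have hH : N (H g - H g') <= CH * nu.
  have -> : H g - H g' = - (z ** E (g - g')) + (g - g').
    by rewrite (lin_opB linE) // /H; fext.
  apply: le_trans (nrmD m_gt0 p1 (lpN (lpZ _ (lE _ ld))) ld) _.
  rewrite nrmN // /CH mulrDl mul1r lerD2r.
  apply: le_trans (nrmZ_le m_gt0 p1 _ (lE _ ld)) _.
  by rewrite -mulrA ler_wpM2l ?normc_ge0 // hC.
have hS s f : 0 <= s -> s <= t -> L f -> N (S p s f - f) <= (M + 1) * N f.
  move=> s0 st lf; apply: le_trans (nrmB m_gt0 p1 (lS _ _ s0 lf) lf) _.
  by rewrite mulrDl mul1r lerD2r; apply: hM => //; exact: le_trans st td2.
have gT : gen m 2%:E (S 2%:E) (E g') (H g').
  by apply/S_gen; rewrite /H opprK (extendE hT lg'2); exact: T4.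
have he' s : 0 <= s -> s <= t -> N (S p s (H g') - H g') <= e + (M + 1) * CH * nu.
  move=> s0 st; have lHd := lpB (lH _ lg) (lH _ lg').
  have -> : S p s (H g') - H g' = (S p s (H g) - H g) - (S p s (H g - H g') - (H g - H g')).
    rewrite (lin_opB (linS _ s0)) ; [fext|exact: lH|exact: lH].
  have lS1 : L (S p s (H g) - H g) by apply: lpB; [apply: lS|]; try exact: lH.
  have lS2 : L (S p s (H g - H g') - (H g - H g')) by apply: lpB => //; exact: lS.
  apply: le_trans (nrmB m_gt0 p1 lS1 lS2) _.
  apply: lerD; first exact: he.
  apply: le_trans (hS _ _ s0 st lHd) _; rewrite -mulrA ler_wpM2l //.
  by rewrite addr_ge0.
have := est _ _ gT (lE _ lg') (lH _ lg') t _ t0 td1 he'.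
have -> : S p t (E g) - E g - t%:C ** H g
  = (S p t (E g') - E g' - t%:C ** H g')
    + ((S p t (E (g - g')) - E (g - g')) - t%:C ** (H g - H g')).
  rewrite (lin_opB linE) // (lin_opB (linS _ (ltW t0))); [|exact: lE|exact: lE].
  fext.
have lEd := lE _ ld; have lHd := lpB (lH _ lg) (lH _ lg').
have la : L (S p t (E g') - E g' - t%:C ** H g').
  by apply: lpB; [apply: lpB; [apply: lS (ltW t0) _|]; exact: lE|apply/lpZ/lH].
have lb : L (S p t (E (g - g')) - E (g - g')).
  by apply: lpB => //; exact: lS (ltW t0) _.
move=> h1; apply: le_trans (nrmD m_gt0 p1 la (lpB lb (lpZ _ lHd))) _.
have h2 := nrmB m_gt0 p1 lb (lpZ t%:C lHd).
have h3 := hS _ _ (ltW t0) (lexx t) lEd.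
have h4 := nrmZ_le m_gt0 p1 t%:C lHd; rewrite normcR gtr0_norm // in h4.
have M1 : 0 <= M + 1 by rewrite addr_ge0.
have h5 := ler_wpM2l M1 (hC _ ld); have h6 := ler_wpM2l (ltW t0) hH.
have h7 : c * nu <= eta by rewrite mulrC -ler_pdivlMr.
have nu0 : 0 <= nu by exact: nrm_ge0.
move: h1 h2 h3 h4 h5 h6 h7; rewrite -/nu /c.
move: (N _) (N _) (N _) (N _) (N _) (N _) => a1 a2 a3 a4 a5 a6; lra.
Qed.

(** For the left inverse, [extend T] commutes with the semigroup and hence with the generator;
    uniqueness of the generator's value then gives E h = z E f - f. *)
Lemma finite_resolvent : resolvent_op m p (fun f g => gen m p (S p) f (- g)) z E.
Proof.
have [lE linE bE] := extend_bounded hT p1; split => //.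
  by move=> g lg; exact: extend_gen.
move=> f h gf; have [lf lh _] := gf; have {}lh : L h by rewrite -[h]opprK; exact: lpN.
have comm t g : 0 <= t -> L g -> E (S p t g) = S p t (E g).
  exact: extend_semigroup_comm.
have g1 := gen_commute m_gt0 p1 (S_sg p1 p_fin) (And3 lE linE bE) comm gf.
have := gen_unique g1 (extend_gen lf).
rewrite (lin_opN m_gt0 p1 linE) // => /oppr_inj Eh.
rewrite (lin_opB linE) //; last exact: lpZ.
by rewrite (lin_opZ m_gt0 p1 linE) // Eh opprB addrC subrK.
Qed.

End FiniteExponent.

(** * The exponent +oo by duality *)

Section InfiniteExponent.
Local Notation L1 := (lpmem m 1%E).
Local Notation Loo := (lpmem m +oo%E).
Local Notation N1 := (nrm m 1%E).
Local Notation Noo := (nrm m +oo%E).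
Let le11 : (1 <= 1 :> \bar R)%E. Proof. exact: lexx. Qed.
Let le1y : (1 <= +oo :> \bar R)%E. Proof. exact: leey. Qed.
Let lt1y : (1 < +oo :> \bar R)%E. Proof. exact: ltry. Qed.

Variable A1 : graph R X.
Hypothesis A1_dom : forall u v, A1 u v -> L1 u /\ L1 v.
Hypothesis A1_resolvent : forall z T, resolvent_op m 2%:E A z T ->
  resolvent_op m 1%E A1 z (extend T).

Definition dual_graph : graph R X := fun f g =>
  [/\ Loo f, Loo g & forall u v, A1 u v -> ip v f = ip u g].

Lemma pairable_1oo f g : L1 f -> Loo g -> pairable m f g.
Proof. by move=> lf lg; exists (N1 f * Noo g); exact: pairable1y. Qed.

Lemma ip_1oo_le f g : L1 f -> Loo g -> normc (ip f g) <= N1 f * Noo g.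
Proof. by move=> lf lg; apply: normc_pairing_le => //; exact: pairable1y. Qed.

Lemma ip0_any g : ip 0 g = 0.
Proof.
rewrite ipE /pairing (@csum_fin _ _ _ fset0) ?big_seq_fset0 // => x _.
by rewrite mulr0 mul0r.
Qed.

Lemma ip1oo_linl a f1 f2 g : L1 f1 -> L1 f2 -> Loo g ->
  ip (a ** f1 + f2) g = a * ip f1 g + ip f2 g.
Proof. by move=> l1 l2 lg; apply: pairing_linl => //; exact: pairable_1oo. Qed.

Lemma ip1oo_Bl a f1 f2 g : L1 f1 -> L1 f2 -> Loo g ->
  ip (a ** f1 - f2) g = a * ip f1 g - ip f2 g.
Proof.
move=> l1 l2 lg; have l0 : L1 0 by exact: lp0.
have := ip1oo_linl (-1) l2 l0 lg; rewrite ip0_any !addr0 cscaleN1 mulN1r => <-.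
by rewrite ip1oo_linl //; exact: lpN.
Qed.

Lemma ip1oo_Br a f g1 g2 : L1 f -> Loo g1 -> Loo g2 ->
  ip f (a ** g1 - g2) = conjc a * ip f g1 - ip f g2.
Proof.
move=> lf l1 l2; have s g : Loo g -> pairable m g f.
  by move=> lg; apply: pairable_sym; exact: pairable_1oo.
have l0 : Loo 0 by exact: lp0.
have := pairing_linl m_gt0 (-1) (s _ l2) (s _ l0).
rewrite ip0_any !addr0 cscaleN1 mulN1r => h.
have ln : Loo (- g2) by exact: lpN.
have := pairing_linl m_gt0 a (s _ l1) (s _ ln); rewrite h => k.
have lg : Loo (a ** g1 - g2) by apply: lpB => //; exact: lpZ.
have E g : Loo g -> ip f g = conjc (ip g f).
  by move=> lg'; apply: (pairing_sym m_gt0); exact: s.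
by rewrite !E // k conjc_add conjc_opp conjc_mul.
Qed.

Section Dual.
Variables (z : R[i]) (T T' : (X -> R[i]) -> X -> R[i]).
Hypothesis hT : resolvent_op m 2%:E A z T.
Hypothesis hT' : resolvent_op m 2%:E A (conjc z) T'.

(** On an indicator this is the Hermitian symmetry of the kernels at z and conj z; linearity and
    density in l^1 do the rest. *)
Lemma extend_adjoint w g : L1 w -> Loo g -> ip w (extend T g) = ip (extend T' w) g.
Proof.
move=> lw lg.
have [lE _ _] := extend_bounded hT le1y.
have [lE' linE' [C C0 hC]] := extend_bounded hT' le11.
have [T1 _ _ _ _] := hT; have [T1' _ _ _ _] := hT'.
have li1 x : L1 (ind1 R x) by exact: ind1_lp.
have li2 x : L2 (ind1 R x) by exact: ind1_lp.
have lEg := lE _ lg.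
have at_ind x : ip (ind1 R x) (extend T g) = ip (extend T' (ind1 R x)) g.
  rewrite pairing_ind1l (extendE hT' (li2 x)) ipE /pairing /extend /kernel_op.
  have [S S0 [hr hc]] := A_schur hT.
  have s := kernel_summable m_gt0 S0 hr hc le1y x lg.
  rewrite -(csum_conj s).
  have s' : abs_summable (fun y => conjc (T (ind1 R y) x * g y)).
    by case: s => M hM; exists M => F; under eq_bigr do rewrite normc_conjc.
  have s0 : abs_summable (fun _ : X => 0 : R[i]).
    by apply: (@abs_summable_fin _ _ _ fset0).
  have := csum_linear ((m x)%:C) s' s0.
  rewrite (@csum_fin _ _ (fun=> 0) fset0) // big_seq_fset0 addr0 => <-.
  congr csum; apply/funext => y; rewrite addr0 conjc_mul mulrA; congr (_ * _).
  have := resolvent_adjoint m_gt0 A_sym hT hT' (li2 y) (li2 x).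
  rewrite pairing_ind1 pairing_ind1l => E.
  have := congr1 conjc E; rewrite !conjc_mul !conjc_real conjcK => ->.
  by [].
have at_restrict F : ip (restrict F w) (extend T g) = ip (extend T' (restrict F w)) g.
  have lr u x : L1 (u x ** ind1 R x) by apply: lpZ.
  rewrite restrictE (lin_op_sum m_gt0 le11 linE'); last by move=> y; exact: lr.
  elim: (F : seq X) => [|x s IH]; first by rewrite !big_nil !ip0_any.
  have ls : L1 (\sum_(y <- s) w y ** ind1 R y) by apply: lp_sum => // y; exact: lr.
  have ls' : L1 (\sum_(y <- s) extend T' (w y ** ind1 R y)).
    by apply: lp_sum => // y; apply: lE'; exact: lr.
  rewrite !big_cons (lin_opZ m_gt0 le11 linE') //.
  by rewrite !ip1oo_linl // ?IH ?at_ind //; exact: lE'.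
apply/eqP; rewrite -subr_eq0; apply/eqP; apply: normc_small => e e0.
pose c := Noo (extend T g) + C * Noo g + 1.
have c0 : 0 < c by rewrite /c ltr_wpDl // addr_ge0 ?mulr_ge0 ?nrm_ge0.
have [F hF] := lp_tail m_gt0 le11 lt1y lw (divr_gt0 e0 c0).
have {hF} := hF F (fsubset_refl _) => hF.
have lr : L1 (restrict F w) by exact: restrict_lp.
have ld : L1 (w - restrict F w) by exact: lpB.
have Bl u v h : L1 u -> L1 v -> Loo h -> ip (u - v) h = ip u h - ip v h.
  by move=> lu lv lh; have := ip1oo_Bl 1 lu lv lh; rewrite cscale1 mul1r.
have -> : ip w (extend T g) - ip (extend T' w) g
   = ip (w - restrict F w) (extend T g) - ip (extend T' (w - restrict F w)) g.
  rewrite (lin_opB linE') // !Bl ?at_restrict //; try exact: lE'.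
  ring.
have := ler_normcB (ip (w - restrict F w) (extend T g))
  (ip (extend T' (w - restrict F w)) g).
have := ip_1oo_le ld lEg; have := ip_1oo_le (lE' _ ld) lg.
have := ler_wpM2r (nrm_ge0 m +oo%E g) (hC _ ld).
have : c * N1 (w - restrict F w) <= e by rewrite mulrC -ler_pdivlMr.
have := nrm_ge0 m 1%E (w - restrict F w); rewrite /c.
move: (normc _) (normc _) (normc _) (N1 _) (N1 _) (Noo _) (Noo _).
move=> *; lra.
Qed.

(** The resolvent of an adjoint at z is the adjoint of the l^1 resolvent at conj z. Functions in
    l^oo are identified by testing on indicators. *)
Lemma dual_resolvent : resolvent_op m +oo%E dual_graph z (extend T).
Proof.
have [lE linE bE] := extend_bounded hT le1y; split => //.
- move=> g lg; have lEg := lE _ lg; split => //.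
    by apply: lpB => //; exact: lpZ.
  move=> u v uv; have [lu lv] := A1_dom uv.
  have [_ _ _ _ T5] := A1_resolvent hT'.
  have lw : L1 (conjc z ** u - v) by apply: lpB => //; exact: lpZ.
  have := extend_adjoint lw lg; rewrite (T5 _ _ uv) ip1oo_Bl // ip1oo_Br // => <-.
  by rewrite subKr.
- move=> f h [lf lh fh]; apply/funext => x.
  have mx0 : (m x)%:C != 0 :> R[i] by rewrite eq_complex /= gt_eqF.
  have li : L1 (ind1 R x) by exact: ind1_lp.
  have lzf : Loo (z ** f - h) by apply: lpB => //; exact: lpZ.
  have [T1 _ _ T4 _] := A1_resolvent hT'.
  have lu := T1 _ li; have uv := T4 _ li; have [_ lv] := A1_dom uv.
  have := fh _ _ uv; rewrite ip1oo_Bl // => E.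
  have := extend_adjoint li lzf; rewrite ip1oo_Br // -E subKr !pairing_ind1l.
  move=> /(mulfI mx0) /(congr1 conjc); rewrite !conjcK; exact.
Qed.

End Dual.
End InfiniteExponent.

(** * From l^p back to l^2 *)

Section Converse.
Variables (p : \bar R) (Ap : graph R X).
Hypothesis p1 : (1 <= p)%E.
Hypothesis Ap_resolvent : forall z T, resolvent_op m 2%:E A z T ->
  resolvent_op m p Ap z (extend T).
Local Notation L := (lpmem m p).
Local Notation N := (nrm m p).

Lemma ip_fin_le f : finsupp_fun f -> exists2 C : R, 0 <= C &
  forall g, L g -> normc (ip g f) <= C * N g.
Proof.
move=> /finsupp_restrict[F [_ fF]].
exists (\sum_(x <- F) m x * (evalc m p x * normc (f x))).
  apply: sumr_ge0 => x _; rewrite mulr_ge0 ?mulr_ge0 ?evalc_ge0 ?normc_ge0 //.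
  exact: ltW.
move=> g lg; rewrite ipE /pairing (@csum_fin _ _ _ F); last first.
  by move=> x /fF ->; rewrite conjc0 mulr0.
apply: le_trans (ler_normc_sum _ _ _) _; rewrite mulr_suml; apply: ler_sum => x _.
rewrite !normcM normcR normc_conjc gtr0_norm // -!mulrA ler_wpM2l ?(ltW (m_gt0 x)) //.
rewrite [leRHS]mulrCA [leLHS]mulrC ler_wpM2l ?normc_ge0 //.
exact: nrm_eval.
Qed.

(** A factor D independent of k is invisible to 2^k-th roots; if C < y, then D (C / y)^(2^k) would
    fall below 1/2. *)
Lemma pow_bounded_le (y C D : R) : 0 <= y -> 0 < C -> 
  (forall k, y ^+ (2 ^ k) <= D * C ^+ (2 ^ k)) -> y <= C.
Proof.
move=> y0 C0 h; rewrite leNgt; apply/negP => Cy.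
have yp : 0 < y by exact: lt_trans Cy.
have q0 : 0 <= C / y by rewrite divr_ge0 // ltW.
have q1 : C / y < 1 by rewrite ltr_pdivrMr // mul1r.
have h2 : 0 < 2^-1 :> R by rewrite invr_gt0.
have [K hK] := geometric_small D q0 q1 h2.
have := hK (2 ^ K)%N (ltnW (ltn_expl K (ltnSn 1))).
have P0 : 0 < y ^+ (2 ^ K) by rewrite exprn_gt0.
rewrite expr_div_n mulrA ler_pdivrMr // => le1.
have := le_trans (h K) le1; rewrite leNgt; move/negP; apply.
by rewrite gtr_pMl //; lra.
Qed.

Section SymmetricBound.
Variables (z : R[i]) (T T' : (X -> R[i]) -> X -> R[i]) (M : R).
Hypothesis hT : resolvent_op m 2%:E A z T.
Hypothesis hT' : resolvent_op m 2%:E A (conjc z) T'.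
Hypothesis M_gt0 : 0 < M.
Hypothesis T_lp : forall f, L f -> N (extend T f) <= M * N f.
Hypothesis T'_lp : forall f, L f -> N (extend T' f) <= M * N f.

Let B := T' \o T.

Let hT'' : resolvent_op m 2%:E A (conjc (conjc z)) T.
Proof. by rewrite conjcK. Qed.

Let T_l2 f : L2 f -> L2 (T f). Proof. by have [h _ _ _ _] := hT; exact: h. Qed.
Let T'_l2 f : L2 f -> L2 (T' f). Proof. by have [h _ _ _ _] := hT'; exact: h. Qed.

Let B_sym f g : L2 f -> L2 g -> ip (B f) g = ip f (B g).
Proof.
move=> lf lg; rewrite /B /= (resolvent_adjoint m_gt0 A_sym hT' hT'' (T_l2 lf) lg).
by rewrite (resolvent_adjoint m_gt0 A_sym hT hT' lf (T_l2 lg)).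
Qed.

(* For the self-adjoint B = T'T, |<B^2n f, f>| is controlled by the l^p bound
   of B, and log-convexity of k |-> |B^k f| turns this into an l^2 bound. *)
Lemma normal_bound_fin f : finsupp_fun f -> N2 (B f) <= M ^+ 2 * N2 f.
Proof.
move=> ff; have lf2 : L2 f by exact: l2_fin.
have lf : L f by exact: finsupp_lp.
have [f0|f0] := eqVneq (N2 f) 0.
  have -> : f = 0 by exact: (nrm_eq0 m_gt0 le12).
  have [_ lT _ _ _] := hT; have [_ lT' _ _ _] := hT'.
  by rewrite /B /= (lin_op0 m_gt0 le12 lT) (lin_op0 m_gt0 le12 lT') nrm0 // mulr0.
have r0 : 0 < N2 f by rewrite lt_def f0 nrm_ge0.
pose it k := iter k B f.
have [lE _ _] := extend_bounded hT p1; have [lE' _ _] := extend_bounded hT' p1.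
have itP k : [/\ L2 (it k), L (it k) & N (it k) <= (M ^+ 2) ^+ k * N f].
  elim: k => [|k [l2 l1 IH]]; first by rewrite mul1r.
  have lT2 := T_l2 l2; have TE := extendE hT l2; have TE' := extendE hT' lT2.
  have lT : L (T (it k)) by rewrite -TE; exact: lE.
  split; [exact: T'_l2|by rewrite /= /B /= -TE'; exact: lE'|].
  rewrite /= /B /= -/(it k) -TE'; apply: le_trans (T'_lp lT) _.
  rewrite exprS -mulrA [M ^+ 2]expr2 -mulrA ler_wpM2l ?(ltW M_gt0) //.
  rewrite -TE; apply: le_trans (T_lp l1) _.
  by rewrite ler_wpM2l ?(ltW M_gt0).
have lit k : L2 (it k) by case: (itP k).
have ipit i j : ip (it (i + j)%N) f = ip (it i) (it j).
  elim: j i => [|j IH] i; first by rewrite addn0.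
  by rewrite -addSnnS IH /= B_sym.
have sq n : N2 (it n) ^+ 2 <= N2 (it (n + n)%N) * N2 f.
  have := ip_self m_gt0 (lit n); rewrite -ipit => /(congr1 (@complex.Re R)) /= <-.
  exact: Re_ip_le.
pose y := N2 (B f) / N2 f; have y0 : 0 <= y by rewrite divr_ge0 ?nrm_ge0.
(* Repeated use of |B^n f|^2 <= |B^(2n) f| |f|, starting from n = 1. *)
have pow k : y ^+ (2 ^ k) <= N2 (it (2 ^ k)%N) / N2 f.
  elim: k => [|k IH]; first by rewrite expr1.
  rewrite expnS mul2n -addnn exprD -expr2.
  apply: (@le_trans _ _ ((N2 (it (2 ^ k)%N) / N2 f) ^+ 2)).
    by rewrite ler_pXn2r // nnegrE ?exprn_ge0 // divr_ge0 ?nrm_ge0.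
  rewrite expr_div_n ler_pdivrMr ?exprn_gt0 //.
  by rewrite expr2 (expr2 (N2 f)) mulrA divfK // -expr2; exact: sq.
have [C C0 hC] := ip_fin_le ff.
(* The norm |B^n f| in l^2 has no direct l^p bound, but its square <B^(2n) f, f> is a pairing with
   the finitely supported f; hence squares on both sides. *)
suff : y ^+ 2 <= (M ^+ 2) ^+ 2.
  rewrite ler_pXn2r ?nnegrE ?exprn_ge0 ?(ltW M_gt0) //.
  by rewrite /y ler_pdivrMr.
apply: (@pow_bounded_le _ _ (C * N f / N2 f ^+ 2)).
- by rewrite exprn_ge0.
- by rewrite !exprn_gt0.
move=> k; rewrite -!exprM mulnC.
apply: (@le_trans _ _ ((N2 (it (2 ^ k)%N) / N2 f) ^+ 2)).
  by rewrite exprM ler_pXn2r // nnegrE ?exprn_ge0 // divr_ge0 ?nrm_ge0.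
rewrite expr_div_n ler_pdivrMr ?exprn_gt0 //.
have [_ l1 b] := itP (2 ^ k + 2 ^ k)%N.
have := ip_self m_gt0 (lit (2 ^ k)%N); rewrite -ipit => /(congr1 (@complex.Re R)) /= <-.
apply: le_trans (le_trans (ler_norm _) (normc_ge_abs_Re _)) _.
apply: le_trans (hC _ l1) _; apply: le_trans (ler_wpM2l C0 b) _.
rewrite mulrAC divfK ?expf_neq0 //.
by rewrite -exprM addnn -mul2n -(mulnC (2 ^ k)%N) mulrCA mulrA mulrC (mulnC (2 ^ k)%N) mulnA; leq_ring.
Qed.

(** |T g|^2 = <g, T' T g> <= M^2 |g|^2 for finitely supported g, then density. *)
Lemma symmetric_bound f : L2 f -> N2 (T f) <= M * N2 f.
Proof.
have fin g : finsupp_fun g -> N2 (T g) <= M * N2 g.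
  move=> fg; have lg := l2_fin m_gt0 fg; have lT := T_l2 lg.
  rewrite -(ler_pXn2r (n := 2)) ?nnegrE ?mulr_ge0 ?nrm_ge0 ?(ltW M_gt0) //.
  have := ip_self m_gt0 lT; rewrite (resolvent_adjoint m_gt0 A_sym hT hT' lg lT).
  move=> /(congr1 (@complex.Re R)) /= <-.
  apply: le_trans (Re_ip_le m_gt0 lg (T'_l2 lT)) _.
  apply: le_trans (ler_wpM2l (nrm_ge0 _ _ _) (normal_bound_fin fg)) _.
  rewrite exprMn; leq_ring.
move=> lf; have [_ linT [C C0 hC] _ _] := hT.
apply/ler_addgt0Pr => e e0; have c0 : 0 < C + 1 by rewrite ltr_wpDl.
have lt2y : (2%:E < +oo :> \bar R)%E by exact: ltry.
have [F hF] := lp_tail m_gt0 le12 lt2y lf (divr_gt0 e0 c0).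
have {hF} := hF F (fsubset_refl _) => hF.
have lr : L2 (restrict F f) by exact: restrict_lp.
have ld : L2 (f - restrict F f) by exact: l2B.
have -> : T f = T (restrict F f) + T (f - restrict F f).
  by rewrite (lin_opB linT) //; fext.
apply: le_trans (nrmD m_gt0 le12 (T_l2 lr) (T_l2 ld)) _; apply: lerD.
  apply: le_trans (fin _ (restrict_finsupp _ _)) _.
  by rewrite ler_wpM2l ?(ltW M_gt0) //; exact: nrm_restrict.
apply: le_trans (hC _ ld) _.
by apply: ler_mul_div1; rewrite ?nrm_ge0.
Qed.

End SymmetricBound.

(** In u = (z - z1) Tp u + Tp g the first term is at most N(u) / 2 and is absorbed; uniform l^p
    bounds near z follow. *)
Lemma resolvent_nearby z z1 Tp T1 M : resolvent_op m p Ap z Tp -> 0 <= M ->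
  (forall f, L f -> N (Tp f) <= M * N f) -> normc (z - z1) * M <= 2^-1 ->
  resolvent_op m p Ap z1 T1 -> forall g, L g -> N (T1 g) <= 2 * M * N g.
Proof.
move=> [lT linT _ _ T5] M0 hM small [lT1 _ _ T14 _] g lg.
set u := T1 g; have lu : L u by exact: lT1.
have luz : L ((z - z1) ** u) by exact: lpZ.
have uE : u = (z - z1) ** Tp u + Tp g.
  rewrite -{1}[u](T5 _ _ (T14 _ lg)) -linT //; congr Tp; rewrite -/u; fext.
have lTu := lT _ lu.
have h1 : N u <= N ((z - z1) ** Tp u) + N (Tp g).
  by rewrite {1}uE; apply: nrmD => //; [exact: lpZ|exact: lT].
have h2 := nrmZ_le m_gt0 p1 (z - z1) lTu.
have h3 := ler_wpM2l (normc_ge0 (z - z1)) (hM _ lu).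
have h4 := ler_wpM2r (nrm_ge0 m p u) small.
have := hM _ lg; move: h1 h2 h3 h4; rewrite mulrA.
move: (N _) (N _) (N _) (N _) (N _) => a1 a2 a3 a4 a5; lra.
Qed.

Lemma resolvent_converse z Tp : resolvent_op m p Ap z Tp ->
  exists T, resolvent_op m 2%:E A z T.
Proof.
move=> hTp; have [z0|] := eqVneq (complex.Im z) 0; last exact: A_nonreal.
have [_ _ [M0 M00 hM0] _ _] := hTp.
pose M := M0 + 1; have M1 : 0 < M by rewrite ltr_wpDl.
have hM f : L f -> N (Tp f) <= M * N f.
  move=> lf; apply: le_trans (hM0 _ lf) _; rewrite ler_wpM2r ?nrm_ge0 //.
  by rewrite lerDl.
(* One height suffices: eta M = 1/4 gives the bound 2 M at z + i eta and at its conjugate, and then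
   eta times 2 M is 1/2 < 1, so the Neumann series from z + i eta reaches z. *)
pose eta := (4 * M)^-1; have eta0 : 0 < eta by rewrite invr_gt0 mulr_gt0.
have etaM : eta * M = 4^-1 by rewrite /eta invfM mulfVK // gt_eqF.
pose z1 := z + (0 +i* eta).
have im1 : complex.Im z1 != 0 by rewrite /z1 cImD z0 add0r gt_eqF.
have im1' : complex.Im (conjc z1) != 0 by rewrite cImJ oppr_eq0.
have n0 : normc (0 +i* eta) = eta.
  by rewrite /normc /= expr0n add0r sqrtr_sqr gtr0_norm.
have d1 : normc (z - z1) = eta.
  by rewrite normcB /z1 addrC addKr n0.
have d1' : normc (z - conjc z1) = eta.
  have -> : z - conjc z1 = 0 +i* eta.
    move: z0; rewrite /z1; case: (z) => a b /= ->.
    by apply/eqP; rewrite eq_complex /=; apply/andP; split; apply/eqP; ring.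
  exact: n0.
have [T hT] := A_nonreal im1; have [T' hT'] := A_nonreal im1'.
have etaM2 : eta * M <= 2^-1 by rewrite etaM; lra.
have hE f : L f -> N (extend T f) <= 2 * M * N f.
  by apply: (resolvent_nearby hTp (ltW M1) hM _ (Ap_resolvent hT)); rewrite d1.
have hE' f : L f -> N (extend T' f) <= 2 * M * N f.
  by apply: (resolvent_nearby hTp (ltW M1) hM _ (Ap_resolvent hT')); rewrite d1'.
have M2 : 0 < 2 * M by rewrite mulr_gt0.
have := symmetric_bound hT hT' M2 hE hE' => bT.
apply: (@neumann _ _ _ m_gt0 _ le12 A A_dom A_lin z1 z T _ hT (ltW M2) bT).
by rewrite d1 mulrCA etaM; lra.
Qed.

End Converse.
End SpectrumTransfer.

Lemma resolvent_op_iff (R : realType) (X : choiceType) (m : X -> R) (p : \bar R)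
    (A A' : graph R X) (z : R[i]) (T : (X -> R[i]) -> X -> R[i]) :
  (forall f g, A f g <-> A' f g) -> resolvent_op m p A z T -> resolvent_op m p A' z T.
Proof.
move=> AA' [h1 h2 h3 h4 h5]; split => //.
  by move=> g lg; apply/AA'; exact: h4.
by move=> f h /AA'; exact: h5.
Qed.

(** Phases c_i turn the sum of moduli into one pairing <f, h> with h the sum of c_i g_i, and |h| is
    at most the sum of the |g_i| at every point. *)
Lemma sum_normc_ip_le (R : realType) (X : choiceType) (m : X -> R)
    (m_gt0 : forall x, 0 < m x) (I : choiceType) (F : {fset I}) (f : X -> R[i])
    (g : I -> X -> R[i]) (B : R) :
  lpmem m 2%:E f -> (forall i, lpmem m 2%:E (g i)) ->
  (forall F' : {fset X}, \sum_(x <- F') m x * (normc (f x) * \sum_(i <- F) normc (g i x)) <= B) ->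
  \sum_(i <- F) normc (ip m f (g i)) <= B.
Proof.
move=> lf lg hB.
have /choice[c hc] : forall i, exists c : R[i], normc c <= 1 /\
    conjc c * ip m f (g i) = (normc (ip m f (g i)))%:C.
  move=> i; set a := ip m f (g i); have [->|a0] := eqVneq a 0.
    by exists 0; rewrite normc0 mulr0.
  have n0 : normc a != 0 by rewrite normc_eq0.
  have n1 : 0 <= (normc a)^-1 by rewrite invr_ge0 normc_ge0.
  exists ((normc a)^-1%:C * a); split.
    by rewrite normcM normcR ger0_norm // mulVf.
  rewrite conjc_mul conjc_real -mulrA (mulrC (conjc a)) mulc_conj -rmorphM.
  by rewrite expr2 mulrA mulVf // mul1r.
pose h := \sum_(i <- F) c i ** g i.
have lcg i : lpmem m 2%:E (c i ** g i) by exact: l2Z.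
have E : ip m f h = (\sum_(i <- F) normc (ip m f (g i)))%:C.
  rewrite /h ip_sumr // rmorph_sum; apply: eq_bigr => i _.
  by rewrite (ipZr m_gt0) //; case: (hc i).
have S0 : 0 <= \sum_(i <- F) normc (ip m f (g i)).
  by apply: sumr_ge0 => i _; exact: normc_ge0.
rewrite -[leLHS](ger0_norm S0) -normcR -E; apply: normc_pairing_le => // F'.
apply: le_trans (hB F'); apply: ler_sum => x _; rewrite ler_wpM2l ?(ltW (m_gt0 x)) //.
rewrite ler_wpM2l ?normc_ge0 //.
rewrite /h fct_sumE; apply: le_trans (ler_normc_sum _ _ _) _; apply: ler_sum => i _.
by rewrite /cscale normcM ler_piMl ?normc_ge0 //; case: (hc i).
Qed.

Lemma esum_subfset (R : realType) (X : choiceType) (D : set X) (g : X -> R)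
    (F : {fset X}) (M : R) : (forall x, x \in F -> D x) ->
  (\esum_(x in D) (g x)%:E <= M%:E)%E -> \sum_(x <- F) g x <= M.
Proof.
move=> FD h; rewrite -lee_fin -sumEFin fsbig_seq; last exact: fset_uniq.
by apply: le_trans h; apply: ereal_sup_ubound => /=; exists [set` F].
Qed.

(** * Coboundary, boundary and form of a weighted complex *)

Section Complexes.
Variables (R : realType) (V : countType) (K : weightedComplex R V).
Hypothesis hsum : locally_summable K.
Variable theta : simplex K -> simplex K -> R[i].
Hypothesis htheta : coboundary_signs theta.
Local Notation X := (simplex K).
Local Notation m := (@mass R V K).
Local Notation ip := (ip m).
Local Notation L2 := (lpmem m 2%:E).
Local Notation N := (nrm m 2%:E).
Implicit Types (s t r : X) (w f g : X -> R[i]).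

Lemma mass_gt0 s : 0 < m s.
Proof.
apply: weight_gt0; have : faces K (verts s) by apply: set_mem; exact: (proj2_sig s).
rewrite /faces.
by case: ifP => // _ [].
Qed.
Local Notation m_gt0 := mass_gt0.

Lemma finite_faces s : finite_set [set t | prec t s].
Proof.
apply: (@sub_finite_set _ _ ((@verts R V K) @^-1` [set` fpowerset (verts s)])).
  by move=> t [sub _] /=; rewrite fpowersetE.
apply: finite_preimage; last exact: finite_fset.
by move=> t t' _ _; exact: val_inj.
Qed.

Lemma theta_conj t s : prec t s -> conjc (theta t s) = theta t s.
Proof.
move=> /(proj1 htheta)[->|->]; first exact: conjc1.
by rewrite conjc_opp conjc1.
Qed.

Lemma normc_theta t s : prec t s -> normc (theta t s) = 1.
Proof. by move=> /(proj1 htheta)[->|->]; rewrite ?normcN normc1. Qed.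

(** The factor 1 / m t cancels the weight of the pairing, which then gives the plain signed sum over
    faces. *)
Definition cob_kernel s : X -> R[i] := fun t =>
  if `[< prec t s >] then (m t)^-1%:C * theta t s else 0.

Definition bdy_kernel r : X -> R[i] := fun t =>
  if `[< prec r t >] then (m r)^-1%:C * theta r t else 0.

Lemma cob_kernel_fin s : finsupp_fun (cob_kernel s).
Proof.
apply: sub_finite_set (finite_faces s) => t /=; rewrite /cob_kernel.
by case: asboolP => //; rewrite eqxx.
Qed.

Lemma cob_kernel_l2 s : L2 (cob_kernel s).
Proof. by apply: (l2_fin m_gt0); exact: cob_kernel_fin. Qed.

Lemma upper_mass r : exists2 B : R, 0 <= B & forall F : {fset X},
  \sum_(t <- F) (if `[< prec r t >] then m t else 0) <= B.
Proof.
have := hsum r; set S := (\esum_(_ in _) _)%E => Sfin.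
have S0 : (0 <= S)%E by apply: esum_ge0 => t _; rewrite lee_fin ltW // m_gt0.
have SE : S = (fine S)%:E by rewrite fineK // ge0_fin_numE.
exists (fine S); first exact: fine_ge0.
move=> F; pose F1 := [fset t in F | `[< prec r t >]]%fset.
rewrite (big_fsetID _ (fun t => `[< prec r t >])) /=.
rewrite [X in _ + X]big_seq [X in _ + X]big1 ?addr0; last first.
  by move=> t; rewrite !inE /= => /andP[_ /negbTE ->].
have h : \sum_(t <- F1) m t <= fine S.
  apply: (@esum_subfset _ _ [set t | prec r t]); last by rewrite -SE.
  by move=> t; rewrite !inE /= => /andP[_ /asboolP].
apply: le_trans h; leq_eq.
rewrite big_seq [RHS]big_seq; apply: eq_bigr => t.
by rewrite !inE /= => /andP[_ ->].
Qed.

Lemma bdy_kernel_l2 r : L2 (bdy_kernel r).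
Proof.
have [B B0 hB] := upper_mass r.
have c0 : 0 <= (m r)^-1 by rewrite invr_ge0 ltW // m_gt0.
have BE : Num.sqrt B ^+ 2 = B by rewrite sqr_sqrtr.
apply: (proj1 (@l2_intro _ _ _ m_gt0 _ ((m r)^-1 * Num.sqrt B) _ _)).
  by rewrite mulr_ge0 ?sqrtr_ge0.
move=> F; rewrite exprMn BE.
apply: (@le_trans _ _ ((m r)^-1 ^+ 2 * \sum_(t <- F) (if `[< prec r t >] then m t else 0))).
  rewrite mulr_sumr; apply: ler_sum => t _; rewrite /bdy_kernel; case: asboolP => rt.
    by rewrite normcM normc_theta // normcR ger0_norm // mulr1 mulrC.
  by rewrite normc0 expr0n mulr0 mulr0.
by rewrite ler_wpM2l ?sqr_ge0.
Qed.

Lemma coboundaryE w : coboundary theta w = opD m cob_kernel w.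
Proof.
apply/funext => s; rewrite /coboundary /opD ipE /pairing.
pose F0 := fset_set [set t | prec t s].
have inF0 t : (t \in F0) = `[< prec t s >].
  rewrite /F0 in_fset_set; last exact: finite_faces.
  by apply/idP/asboolP => [/set_mem|/mem_set].
rewrite fsbig_finite; last exact: finite_faces.
rewrite (@csum_fin _ _ _ F0); last first.
  by move=> t; rewrite inF0 /cob_kernel => /negbTE ->; rewrite conjc0 mulr0.
rewrite -/F0 big_seq [RHS]big_seq; apply: eq_bigr => t; rewrite inF0 /cob_kernel => tF.
have /asboolP ts := tF; rewrite tF conjc_mul conjc_real theta_conj //.
have mt : (m t)%:C * (m t)^-1%:C = 1 :> R[i].
  by rewrite -rmorphM mulfV ?gt_eqF ?m_gt0.
by rewrite -[LHS]mul1r -mt; ring.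
Qed.

Lemma boundaryE w : L2 w -> boundary theta w = opD m bdy_kernel w.
Proof.
move=> lw; apply/funext => r; rewrite /boundary /opD ipE /pairing csum_mkcond.
have s : abs_summable (fun t => (m t)%:C * w t * conjc (bdy_kernel r t)).
  apply: (pairable_sum m_gt0); apply: l2_pairable => //; first exact: m_gt0.
  exact: bdy_kernel_l2.
have s0 : abs_summable (fun _ : X => 0 : R[i]).
  by apply: (@abs_summable_fin _ _ _ fset0).
have mr : (m r)%:C != 0 :> R[i] by rewrite eq_complex /= gt_eqF // m_gt0.
have := csum_linear ((m r)%:C) s s0.
rewrite (@csum_fin _ _ (fun=> 0) fset0) // big_seq_fset0 addr0 => E.
apply: (mulfI mr); rewrite -E mulrA -rmorphM mulfV ?gt_eqF ?m_gt0 // mul1r.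
congr csum; apply/funext => t; rewrite addr0 /bdy_kernel.
case: asboolP => rt; last first.
  rewrite conjc0 !mulr0 ifF //; apply/negP => /set_mem; exact: rt.
rewrite mem_set // conjc_mul conjc_real theta_conj //.
have mt : (m r)%:C * (m r)^-1%:C = 1 :> R[i].
  by rewrite -rmorphM mulfV ?gt_eqF ?m_gt0.
by rewrite -[LHS]mul1r -mt; ring.
Qed.

Variable o : laplacian_kind.

Definition lap_kernel s : X -> R[i] :=
  match o with
  | UpperLap => cob_kernel s
  | LowerLap => bdy_kernel s
  | HodgeLap => cob_kernel s + bdy_kernel s
  end.

Lemma lap_kernel_l2 s : L2 (lap_kernel s).
Proof.
rewrite /lap_kernel; case: o.
- exact: cob_kernel_l2.
- exact: bdy_kernel_l2.
- by apply: (l2D m_gt0); [exact: cob_kernel_l2|exact: bdy_kernel_l2].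
Qed.

Lemma form_mapE w : L2 w -> form_map theta o w = opD m lap_kernel w.
Proof.
move=> lw; rewrite /lap_kernel /form_map; case: o => //.
- exact: coboundaryE.
- exact: boundaryE.
rewrite coboundaryE boundaryE //; apply/funext => s; rewrite /opD.
by rewrite (ipDr m_gt0) //; [exact: cob_kernel_l2|exact: bdy_kernel_l2].
Qed.

Local Notation D := (opD m lap_kernel).
Local Notation Dcob := (opD m cob_kernel).
Local Notation Dbdy := (opD m bdy_kernel).

Lemma Dcob_ind1 t s : Dcob (ind1 R t) s = if `[< prec t s >] then theta t s else 0.
Proof.
rewrite /opD pairing_ind1l /cob_kernel; case: asboolP => ts; last by rewrite conjc0 mulr0.
rewrite conjc_mul conjc_real theta_conj // mulrA -rmorphM mulfV ?gt_eqF ?m_gt0 //.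
by rewrite mul1r.
Qed.

(** Adjointness of boundary and coboundary: pairing with the boundary of 1_t is m t times evaluation
    of the coboundary at t. *)
Lemma Dbdy_ind1 t : Dbdy (ind1 R t) = (m t)%:C ** cob_kernel t.
Proof.
apply/funext => s; rewrite /opD pairing_ind1l /cscale /bdy_kernel /cob_kernel.
case: asboolP => st; last by rewrite conjc0.
by rewrite conjc_mul conjc_real theta_conj.
Qed.

Lemma normc_Dcob_ind1 t s :
  normc (Dcob (ind1 R t) s) = if `[< prec t s >] then 1 else 0.
Proof.
by rewrite Dcob_ind1; case: asboolP => ts; rewrite ?normc_theta ?normc0.
Qed.

Lemma normc_Dbdy_ind1 t s :
  normc (Dbdy (ind1 R t) s) = if `[< prec s t >] then m t / m s else 0.
Proof.
rewrite Dbdy_ind1 /cscale /cob_kernel; case: asboolP => st; last first.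
  by rewrite mulr0 normc0.
rewrite !normcM normc_theta // !normcR mulr1 !ger0_norm ?invr_ge0 ?ltW ?m_gt0 //.
Qed.

Lemma Dcob_ind1_l2 t : L2 (Dcob (ind1 R t)).
Proof.
have [B B0 hB] := upper_mass t; have BE : Num.sqrt B ^+ 2 = B by rewrite sqr_sqrtr.
apply: (proj1 (@l2_intro _ _ _ m_gt0 _ (Num.sqrt B) (sqrtr_ge0 _) _)) => F.
rewrite BE; apply: le_trans (hB F); apply: ler_sum => s _; rewrite normc_Dcob_ind1.
by case: ifP => _; rewrite ?expr1n ?mulr1 // expr0n mulr0.
Qed.

Lemma Dbdy_ind1_l2 t : L2 (Dbdy (ind1 R t)).
Proof. by rewrite Dbdy_ind1; apply: (l2Z m_gt0); exact: cob_kernel_l2. Qed.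

Lemma D_hodge w : L2 w ->
  opD m (fun s => cob_kernel s + bdy_kernel s) w = Dcob w + Dbdy w.
Proof.
move=> lw; apply/funext => s; rewrite /opD (ipDr m_gt0) //.
  exact: cob_kernel_l2.
exact: bdy_kernel_l2.
Qed.

Lemma D_ind1_l2 t : L2 (D (ind1 R t)).
Proof.
rewrite /lap_kernel; case: o; [exact: Dcob_ind1_l2|exact: Dbdy_ind1_l2|].
rewrite D_hodge; last exact: (ind1_lp m_gt0 le12).
by apply: (l2D m_gt0); [exact: Dcob_ind1_l2|exact: Dbdy_ind1_l2].
Qed.

(** A coface of t has one vertex more than t, and its faces are among its subsets. The bound is
    crude but independent of the coface s. *)
Lemma count_faces t s (F : {fset X}) : prec t s ->
  \sum_(t' <- F) (if `[< prec t' s >] then 1 else 0) <= (2 ^ (#|` verts t|).+1)%:R :> R.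
Proof.
move=> [sub card1].
have -> : \sum_(t' <- F) (if `[< prec t' s >] then 1 else 0)
    = (#|` [fset t' in F | `[< prec t' s >]]%fset|)%:R :> R.
  rewrite (big_fsetID _ (fun t' => `[< prec t' s >])) /=.
  rewrite [X in _ + X]big_seq [X in _ + X]big1 ?addr0; last first.
    by move=> t'; rewrite !inE /= => /andP[_ /negbTE ->].
  rewrite big_seq (eq_bigr (fun=> 1)); last by move=> t'; rewrite !inE /= => /andP[_ ->].
  by rewrite -big_seq big_const_seq iter_addr_0 count_predT.
rewrite ler_nat.
have -> : (#|` verts t|).+1 = #|` verts s|.
  rewrite -(cardfsID (verts t) (verts s)) card1 addn1; congr (#|` _|).+1.
  by apply/esym/fsetIidPr.
rewrite -card_fpowerset.
have inj : injective (@verts R V K) by exact: val_inj.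
set G := [fset t' in F | _]%fset.
have -> : #|` G| = size [seq verts t' | t' <- enum_fset G] by rewrite size_map.
apply: uniq_leq_size; first by rewrite map_inj_uniq // fset_uniq.
move=> x /mapP[t']; rewrite !inE /= => /andP[_ /asboolP[sub' _]] ->.
by rewrite fpowersetE.
Qed.

(** Two simplices interact through a common coface s: the masses of the cofaces of t are summable,
    and each has boundedly many faces. *)
Lemma sum_cob_ip t : exists2 B : R, 0 <= B & forall F : {fset X},
  \sum_(t' <- F) normc (ip (Dcob (ind1 R t)) (Dcob (ind1 R t'))) <= B.
Proof.
have [B B0 hB] := upper_mass t.
exists (B * (2 ^ (#|` verts t|).+1)%:R); first by rewrite mulr_ge0.
move=> F; apply: (sum_normc_ip_le m_gt0 (Dcob_ind1_l2 t) Dcob_ind1_l2) => F'.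
apply: le_trans (ler_wpM2r (ler0n _ _) (hB F')); rewrite mulr_suml.
apply: ler_sum => s _; rewrite normc_Dcob_ind1; case: asboolP => ts; last first.
  by rewrite !mul0r mulr0.
rewrite mul1r ler_wpM2l ?(ltW (m_gt0 s)) //.
under eq_bigr do rewrite normc_Dcob_ind1.
exact: count_faces.
Qed.

(** Two simplices interact through a common face: t has finitely many faces, and the cofaces of each
    have finite total mass. *)
Lemma sum_bdy_ip t : exists2 B : R, 0 <= B & forall F : {fset X},
  \sum_(t' <- F) normc (ip (Dbdy (ind1 R t)) (Dbdy (ind1 R t'))) <= B.
Proof.
have /choice[B hB] : forall r, exists B : R, 0 <= B /\ forall F : {fset X},
    \sum_(t <- F) (if `[< prec r t >] then m t else 0) <= B.
  by move=> r; have [B B0 h] := upper_mass r; exists B.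
pose F0 := fset_set [set s | prec s t].
have inF0 s : (s \in F0) = `[< prec s t >].
  rewrite /F0 in_fset_set; last exact: finite_faces.
  by apply/idP/asboolP => [/set_mem|/mem_set].
pose c s := if `[< prec s t >] then m t * (B s / m s) else 0.
have c0 s : 0 <= c s.
  rewrite /c; case: ifP => // _; rewrite mulr_ge0 ?divr_ge0 ?(ltW (m_gt0 _)) //.
  by case: (hB s).
exists (\sum_(s <- F0) c s); first exact: sumr_ge0.
move=> F; apply: (sum_normc_ip_le m_gt0 (Dbdy_ind1_l2 t) Dbdy_ind1_l2) => F'.
apply: (@le_trans _ _ (\sum_(s <- F') c s)).
  apply: ler_sum => s _; rewrite normc_Dbdy_ind1 /c; case: asboolP => st; last first.
    by rewrite mul0r mulr0.
  set S := \sum_(_ <- F) _.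
  have -> : m s * (m t / m s * S) = m t * S by field; rewrite gt_eqF // m_gt0.
  rewrite /S ler_wpM2l ?(ltW (m_gt0 _)) //; have [_ hBs] := hB s.
  apply: (@le_trans _ _ ((m s)^-1 * \sum_(t' <- F) (if `[< prec s t' >] then m t' else 0))).
    rewrite mulr_sumr; apply: ler_sum => t' _; rewrite normc_Dbdy_ind1.
    by case: ifP => _; rewrite ?mulr0 // mulrC.
  by rewrite mulrC ler_wpM2r // invr_ge0 ltW // m_gt0.
apply: (@le_trans _ _ (\sum_(s <- (F' `|` F0)%fset) c s)).
  by apply: ler_sum_fsub => //; exact: fsubsetUl.
leq_eq; symmetry.
apply: big_fset_incl; first exact: fsubsetUr.
by move=> s _; rewrite inF0 /c => /negbTE ->.
Qed.

(** By adjointness the pairing is m t' times the value of delta delta 1_t at t'. *)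
Lemma ip_cob_bdy t t' : ip (Dcob (ind1 R t)) (Dbdy (ind1 R t')) = 0.
Proof.
rewrite Dbdy_ind1 (ipZr m_gt0); [|exact: cob_kernel_l2|exact: Dcob_ind1_l2].
have := congr1 (fun f => f t') (proj2 htheta (ind1 R t)).
by rewrite !coboundaryE /= {1}/opD => ->; rewrite mulr0.
Qed.

(** Finiteness of the degrees of b. It is needed because [potential] takes [fine] of the degree,
    which would be 0 if the degree were infinite. In the Hodge case the mixed terms vanish by
    [ip_cob_bdy]. *)
Lemma sum_D_ip t : exists2 B : R, 0 <= B & forall F : {fset X},
  \sum_(t' <- F) normc (ip (D (ind1 R t)) (D (ind1 R t'))) <= B.
Proof.
rewrite /lap_kernel; case: o; [exact: sum_cob_ip|exact: sum_bdy_ip|].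
have [B1 B10 h1] := sum_cob_ip t; have [B2 B20 h2] := sum_bdy_ip t.
exists (B1 + B2); first exact: addr_ge0.
move=> F; apply: le_trans (lerD (h1 F) (h2 F)); rewrite -big_split.
apply: ler_sum => t' _ /=.
have lc := Dcob_ind1_l2; have lb := Dbdy_ind1_l2.
rewrite !D_hodge; try exact: (ind1_lp m_gt0 le12).
rewrite (ipDl m_gt0) // ?(ipDr m_gt0) //; last exact: (l2D m_gt0).
rewrite ip_cob_bdy (ip_sym m_gt0 (lc t') (lb t)) ip_cob_bdy conjc0 addr0 add0r.
exact: ler_normcD.
Qed.

Lemma form_fin w : finsupp_fun w -> form_map theta o w = D w.
Proof. by move=> fw; apply: form_mapE; exact: (l2_fin m_gt0). Qed.

Lemma sesqformE w v : finsupp_fun w -> finsupp_fun v ->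
  sesqform theta o w v = ip (D w) (D v).
Proof. by move=> fw fv; rewrite /sesqform !form_fin // ipE. Qed.

Lemma qformE w : finsupp_fun w -> qform theta o w = (N (D w) ^+ 2)%:E.
Proof.
move=> fw; rewrite /qform form_fin // EFin_expe lpE //.
exact: (D_fin_l2 m_gt0 lap_kernel_l2 D_ind1_l2).
Qed.

Lemma finsuppB f g : finsupp_fun f -> finsupp_fun g -> finsupp_fun (f - g).
Proof.
move=> ff fg; have := finsupp_lin (-1) fg ff.
by rewrite cscaleN1 addrC.
Qed.

Lemma form_approxP w wn : L2 w -> form_approx theta o w wn <-> form_seq m lap_kernel w wn.
Proof.
move=> lw.
have near_l : (forall n, finsupp_fun (wn n)) -> \forall n \near \oo, L2 (wn n - w).
  move=> fw; exists 0%N => // n _; apply: (l2B m_gt0) => //; exact: (l2_fin m_gt0).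
have lD n : (forall n, finsupp_fun (wn n)) -> L2 (D (wn n)).
  by move=> fw; apply: (D_fin_l2 m_gt0 lap_kernel_l2 D_ind1_l2).
have DB n k : (forall n, finsupp_fun (wn n)) -> D (wn n - wn k) = D (wn n) - D (wn k).
  by move=> fw; apply: (D_B m_gt0 lap_kernel_l2); exact: (l2_fin m_gt0).
split.
  move=> [fw cw qw]; split => //.
    move=> e e0; apply/near_ooP; exact: ((lpnorm_cvg0P _ (near_l fw)).1 cw).
  move=> e e0; have [M hM] := qw _ (exprn_gt0 2 e0); exists M => n k Mn Mk.
  have := hM n k Mn Mk; rewrite qformE; last exact: finsuppB.
  rewrite lte_fin DB // => /ltW.
  by rewrite ler_pXn2r // nnegrE ?nrm_ge0 // ltW.
move=> [fw cw qw]; split => //.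
  by apply/(lpnorm_cvg0P _ (near_l fw)) => e e0; apply/near_ooP; exact: cw.
(* A norm below 1 dominates its square, and e / 2 makes the inequality strict. *)
move=> e e0; have e1 : 0 < Num.min 1 (e / 2) by rewrite lt_min ltr01 divr_gt0.
have [M hM] := qw _ e1; exists M => n k Mn Mk.
rewrite qformE; last exact: finsuppB.
rewrite lte_fin DB //; have := hM n k Mn Mk; rewrite le_min => /andP[h1 h2].
have h0 := nrm_ge0 m 2%:E (D (wn n) - D (wn k)).
apply: le_lt_trans (_ : N (D (wn n) - D (wn k)) * 1 < e).
  by rewrite expr2 ler_wpM2l.
by rewrite mulr1; lra.
Qed.

Lemma closure_domP w : closure_dom theta o w <-> formdom m lap_kernel w.
Proof.
have E : lp m 2%:E w = L2 w by rewrite lpmem.unlock.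
rewrite /closure_dom /formdom /= E; split=> -[lw [wn h]]; split => //; exists wn;
  exact/form_approxP.
Qed.

(** Approximating sequences exist on the form domain, so the universally quantified [closure_val] is
    not vacuous and determines its value. *)
Lemma closure_valP w v z : formdom m lap_kernel w -> formdom m lap_kernel v ->
  closure_val theta o w v z <-> ip (D w) (D v) = z.
Proof.
move=> dw dv; have lw := formdom_l2 dw; have lv := formdom_l2 dv.
have key wn vn : form_seq m lap_kernel w wn -> form_seq m lap_kernel v vn ->
    forall e, 0 < e -> exists M : nat, forall n, (M <= n)%N ->
      normc (sesqform theta o (wn n) (vn n) - ip (D w) (D v)) <= e.
  move=> sw sv; have [fw _ _] := sw; have [fv _ _] := sv.
  have [lDw cw] := form_seq_cvg m_gt0 lap_kernel_l2 D_ind1_l2 lw sw.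
  have [lDv cv] := form_seq_cvg m_gt0 lap_kernel_l2 D_ind1_l2 lv sv.
  have lD f : finsupp_fun f -> L2 (D f).
    exact: (D_fin_l2 m_gt0 lap_kernel_l2 D_ind1_l2).
  move=> e e0; have [M hM] := ip_cvg2 m_gt0 (fun n => lD _ (fw n)) (fun n => lD _ (fv n))
    lDw lDv cw cv e0.
  by exists M => n /hM; rewrite sesqformE.
split.
  move=> h; have [_ [wn sw]] := dw; have [_ [vn sv]] := dv.
  apply/eqP; rewrite -subr_eq0; apply/eqP; apply: normc_small => e e0.
  have e2 : 0 < e / 2 by lra.
  have [M1 h1] := key _ _ sw sv _ e2.
  have /cvgr0_norm_le /(_ _ e2) /near_ooP[M2 h2] := h wn vn
    ((form_approxP _ lw).2 sw) ((form_approxP _ lv).2 sv).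
  pose n := maxn M1 M2.
  have := h1 n (leq_maxl _ _); have := h2 n (leq_maxr _ _).
  rewrite ger0_norm ?normc_ge0 //; set q := sesqform _ _ _ _ => h3 h4.
  have -> : ip (D w) (D v) - z = (q - z) - (q - ip (D w) (D v)) by ring.
  have := ler_normcB (q - z) (q - ip (D w) (D v)); lra.
move=> <- wn vn /(form_approxP _ lw) sw /(form_approxP _ lv) sv.
apply/cvgrPdist_le => e e0; apply/near_ooP; have [M hM] := key _ _ sw sv _ e0.
by exists M => n /hM; rewrite sub0r normrN ger0_norm // normc_ge0.
Qed.

Lemma Delta2P w f : Delta2 theta o w f <-> lap m lap_kernel w f.
Proof.
have E : lp m 2%:E f = L2 f by rewrite lpmem.unlock.
split.
  move=> [/closure_domP dw lf h]; split => //; first by rewrite -E.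
  move=> v fv; have dv : formdom m lap_kernel v by apply: (formdom_fin m_gt0).
  have := h v ((closure_domP v).2 dv); rewrite -ipE => /(closure_valP _ dw dv); exact.
move=> lwf; have [dw lf _] := lwf; split; [exact/closure_domP|by rewrite E|].
move=> v /closure_domP dv; apply/(closure_valP _ dw dv); rewrite -ipE.
exact: (lap_weak m_gt0 lap_kernel_l2 D_ind1_l2 lwf dv).
Qed.

Let b t t' := edge_weight theta o t t'.
Let q t t' := ip (D (ind1 R t)) (D (ind1 R t')).

Lemma edge_weightE t t' : edge_weight theta o t t' = if t == t' then 0 else normc (q t t').
Proof.
rewrite /edge_weight; case: eqP => // _.
rewrite sesqformE; try exact: finsupp_ind1.
by rewrite (ip_sym m_gt0 (D_ind1_l2 t) (D_ind1_l2 t')) normc_conjc.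
Qed.

Lemma edge_weight_ge0 t t' : 0 <= edge_weight theta o t t'.
Proof. by rewrite edge_weightE; case: ifP => // _; exact: normc_ge0. Qed.

Lemma potential_le t (F : {fset X}) :
  potential theta o t <= N (D (ind1 R t)) ^+ 2 - \sum_(t' <- F) edge_weight theta o t t'.
Proof.
rewrite /potential qformE /=; last exact: finsupp_ind1.
rewrite lerD2l lerN2.
have [B B0 hB] := sum_D_ip t.
have hb (F' : {fset X}) : \sum_(t' <- F') edge_weight theta o t t' <= B.
  apply: le_trans (hB F'); apply: ler_sum => t' _; rewrite edge_weightE.
  by case: ifP => // _; exact: normc_ge0.
have le := (esum_le_fsetP B (edge_weight_ge0 t)).2 hb.
have ge0 : (0 <= \esum_(t' in [set: X]) (edge_weight theta o t t')%:E)%E.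
  by apply: esum_ge0 => t' _; rewrite lee_fin edge_weight_ge0.
have fin : (\esum_(t' in [set: X]) (edge_weight theta o t t')%:E)%E \is a fin_num.
  by rewrite ge0_fin_numE //; apply: le_lt_trans le _; exact: ltry.
apply: (esum_le_fsetP _ (edge_weight_ge0 t)).1; by rewrite fineK.
Qed.

Definition cneg t : R := - Num.min (potential theta o t) 0.

Lemma cneg_ge0 t : 0 <= cneg t.
Proof. by rewrite /cneg oppr_ge0 ge_min lexx orbT. Qed.

Lemma cneg_potential t (F : {fset X}) :
  - cneg t <= N (D (ind1 R t)) ^+ 2 - \sum_(t' <- F) edge_weight theta o t t'.
Proof.
rewrite /cneg opprK; apply: le_trans (potential_le t F).
by rewrite ge_min lexx.
Qed.

Lemma form_boundedP : form_bounded theta o -> exists M C : R, [/\ 0 <= M, 0 <= C &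
  forall w (F : {fset X}), finsupp_fun w ->
    \sum_(t <- F) cneg t * normc (w t) ^+ 2 <= M * N (D w) ^+ 2 + C * N w ^+ 2].
Proof.
move=> [M [C [M0 C0 h]]]; exists M, C; split => // w F fw.
have := h w fw; rewrite -/(cneg _) qformE //.
set f := fun t => _.
have ff : finsupp_fun f.
  apply: sub_finite_set fw => t /=; apply: contra_neq => w0.
  by rewrite /f w0 mulr0.
have lf := l2_fin m_gt0 ff; have lw := l2_fin m_gt0 fw.
rewrite (lpE lf) (lpE lw) -!EFin_expe -!EFinM -EFinD lee_fin.
apply: le_trans; apply: le_trans (l2_sum_le m_gt0 F lf).
apply: ler_sum => t _; rewrite /f normcM normcR ger0_norm ?sqrtr_ge0 //.
rewrite exprMn sqr_sqrtr; last by rewrite divr_ge0 ?cneg_ge0 // ltW // m_gt0.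
rewrite -/(cneg t); leq_eq.
by field; rewrite gt_eqF // m_gt0.
Qed.

End Complexes.

(** * Assembly for the Laplacians of a complex *)

Section MainTheorem.
Variables (R : realType) (V : countType) (K : weightedComplex R V).
Hypothesis hsum : locally_summable K.
Variable theta : simplex K -> simplex K -> R[i].
Hypothesis htheta : coboundary_signs theta.
Variables (o : laplacian_kind) (d : simplex K -> simplex K -> R).
Local Notation X := (simplex K).
Local Notation m := (@mass R V K).
Local Notation G := (lap_kernel theta o).
Local Notation m_gt0 := (@mass_gt0 R V K).

Hypothesis hd : intrinsic_metric m (edge_weight theta o) d.
Variable s : R.
Hypothesis hs : 0 < s.
Hypothesis hjump : jump_size (edge_weight theta o) d = s%:E.
Hypothesis hc : form_bounded theta o.
Hypothesis hvol : uniform_subexp_growth m d.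

Let lapA : graph R X := lap m G.
Let G_l2 := lap_kernel_l2 hsum htheta o.
Let D_l2 := D_ind1_l2 hsum htheta o.

Lemma growth_fset (e : R) : 0 < e -> exists2 C : R, 0 < C &
  forall x r (F : {fset X}), 0 < r -> (forall y, y \in F -> d x y <= r) ->
    \sum_(y <- F) m y <= C * expR (e * r) * m x.
Proof.
move=> e0; have [C C0 hC] := hvol e0; exists C => // x r F r0 hF.
by apply: (@esum_subfset _ _ [set y | d x y <= r]) => //; apply: ltW; exact: hC.
Qed.

Lemma intrinsic_fset x (F : {fset X}) :
  \sum_(y <- F) edge_weight theta o x y * d x y ^+ 2 <= m x.
Proof.
have [_ /(_ x)] := hd; rewrite lee_pdivrMl ?m_gt0 // mule1 => h.
by apply: (@esum_subfset _ _ setT).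
Qed.

Lemma jump_le x y : 0 < edge_weight theta o x y -> d x y <= s.
Proof.
move=> b0; rewrite -lee_fin -hjump; apply: ereal_sup_ubound.
by exists x, y.
Qed.

(** The geometry enters here: the intrinsic metric, jump size and form bound give kernel decay, and
    the growth condition turns it into row and column bounds. *)
Lemma laplacian_schur z T : resolvent_op m 2%:E lapA z T -> exists2 S : R, 0 <= S &
  (forall x (F : {fset X}), \sum_(y <- F) normc (T (ind1 R y) x) <= S) /\
  (forall y (F : {fset X}), \sum_(x <- F) m x * normc (T (ind1 R y) x) <= S * m y).
Proof.
move=> hT; have [[d_ge0 d_refl d_sym d_tri] _] := hd.
have [T' hT'] : exists T', resolvent_op m 2%:E lapA (conjc z) T'.
  apply: (@resolvent_conjc _ _ m lapA _ z); last by exists T.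
  exact: (lap_resolvent_nonreal m_gt0 G_l2 D_l2).
have [M [C [M0 C0 hMC]]] := form_boundedP hsum htheta hc.
have balls := @finite_ball _ _ _ _ m_gt0 d_ge0 d_sym growth_fset.
have tri x y t : d x t <= d x y + d y t by exact: d_tri.
have [eps eps0 [A A0 hA]] := resolvent_kernel_decay m_gt0 G_l2 D_l2
  (edge_weightE hsum htheta o) d_ge0 d_sym intrinsic_fset jump_le hs M0 C0
  (cneg_potential hsum htheta o) hMC hT hT' tri d_refl balls.
apply: (kernel_schur m_gt0 d_ge0 d_sym growth_fset eps0 A0 _ hA).
by move=> x y; exact: normc_ge0.
Qed.

Variable S : \bar R -> R -> (X -> R[i]) -> X -> R[i].
Hypothesis hS : heat_semigroups theta o S.

(** Finite p is [finite_resolvent]. For p = +oo the l^1 resolvent at conj z is dualised, so both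
    resolvents must exist; [resolvent_conjc] supplies the second. *)
Lemma Delta_resolvent (p : \bar R) z T : (1 <= p)%E -> resolvent_op m 2%:E lapA z T ->
  resolvent_op m p (Delta S p) z (extend T).
Proof.
have [S1 S2 S3] := hS.
have lt2y : (2%:E < +oo :> \bar R)%E by exact: ltry.
have lap_dom' u f : lapA u f -> lpmem m 2%:E u /\ lpmem m 2%:E f by exact: lap_dom.
have sym u f v g : lapA u f -> lapA v g -> ip m f v = ip m u g.
  exact: (lap_sym m_gt0 G_l2 D_l2).
have nonreal := lap_resolvent_nonreal m_gt0 G_l2 D_l2.
have sg p' (p'1 : (1 <= p')%E) (p'y : (p' < +oo)%E) : semigroup_on m p' (S p').
  exact/(C0_semigroupP m_gt0 p'1)/S1.
have genE f g : gen m 2%:E (S 2%:E) f g <-> lapA f (- g).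
  rewrite -(generatorP m_gt0 le12 f g (sg _ le12 lt2y)).
  by split=> [/S2 /(Delta2P hsum htheta)|/(Delta2P hsum htheta) ?]; last exact/S2.
have cons p' t f : (1 <= p')%E -> (p' < +oo)%E -> 0 <= t ->
    lpmem m 2%:E f -> lpmem m p' f -> S p' t f = S 2%:E t f.
  by rewrite !lpmem.unlock => h1 h2 h3; exact: S3.
have fin p' z' T1 : (1 <= p')%E -> (p' < +oo)%E -> resolvent_op m 2%:E lapA z' T1 ->
    resolvent_op m p' (fun f g => gen m p' (S p') f (- g)) z' (extend T1).
  move=> h1 h2 h3.
  exact: (finite_resolvent m_gt0 sym nonreal laplacian_schur sg genE cons h1 h2 h3).
have graphE p' f g : (1 <= p')%E -> (p' < +oo)%E ->
    gen m p' (S p') f (- g) <-> opp_graph (generator m p' (S p')) f g.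
  move=> h1 h2.
  by rewrite -(generatorP m_gt0 h1 f (- g) (sg _ h1 h2)).
move=> p1 hT; rewrite /Delta; case: eqVneq => [py|py]; last first.
  have pfin : (p < +oo)%E by rewrite ltey.
  apply: resolvent_op_iff (fin _ _ _ p1 pfin hT) => f g; exact: graphE.
rewrite py.
have le11 : (1 <= 1 :> \bar R)%E by exact: lexx.
have lt1y : (1 < +oo :> \bar R)%E by exact: ltry.
have [T' hT'] := @resolvent_conjc _ _ m lapA nonreal z (ex_intro _ T hT).
pose A1 : graph R X := fun f g => gen m 1%E (S 1%E) f (- g).
have dom1 u v : A1 u v -> lpmem m 1%E u /\ lpmem m 1%E v.
  by move=> [lu lv _]; split => //; rewrite -[v]opprK; exact: (lpN m_gt0 le11).
have res1 z' T1 : resolvent_op m 2%:E lapA z' T1 -> resolvent_op m 1%E A1 z' (extend T1).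
  exact: fin.
have h := dual_resolvent m_gt0 sym nonreal laplacian_schur dom1 res1 hT hT'.
apply: resolvent_op_iff h => f g; rewrite /dual_graph /adjoint_l1 !lpmem.unlock.
split=> -[lf lg fg]; split => // u v uv.
  by rewrite -!ipE; apply: fg; exact/graphE.
by rewrite !ipE; apply: fg; exact/graphE.
Qed.

Lemma spectrum_eq (p : \bar R) : (1 <= p)%E ->
  spectrum m 2%:E (Delta2 theta o) = spectrum m p (Delta S p).
Proof.
move=> p1; have D2 := Delta2P hsum htheta o.
have lap_dom' u f : lapA u f -> lpmem m 2%:E u /\ lpmem m 2%:E f by exact: lap_dom.
have lin := lap_lin m_gt0 G_l2 D_l2.
have sym u f v g : lapA u f -> lapA v g -> ip m f v = ip m u g.
  exact: (lap_sym m_gt0 G_l2 D_l2).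
have nonreal := lap_resolvent_nonreal m_gt0 G_l2 D_l2.
suff E z : (exists T, resolvent_op m 2%:E (Delta2 theta o) z T) <->
    (exists T, resolvent_op m p (Delta S p) z T).
  apply/seteqP; split=> z h [T /resolventP hT]; apply: h.
    by have [T' /resolventP hT'] := (E z).2 (ex_intro _ T hT); exists T'.
  by have [T' /resolventP hT'] := (E z).1 (ex_intro _ T hT); exists T'.
split=> [[T hT]|[T hT]].
  by exists (extend T); apply: Delta_resolvent => //; exact: resolvent_op_iff hT.
have [T' hT'] := resolvent_converse m_gt0 lap_dom' lin sym nonreal laplacian_schur p1
  (fun z T => Delta_resolvent p1) hT.
by exists T'; apply: resolvent_op_iff hT' => f g; apply: iff_sym.
Qed.

End MainTheorem.

Theorem theorem5p5 (R : realType) (V : countType) (K : weightedComplex R V)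
    (hsum : locally_summable K)
    (theta : simplex K -> simplex K -> R[i]) (htheta : coboundary_signs theta)
    (o : laplacian_kind)
    (d : simplex K -> simplex K -> R)
    (hd : intrinsic_metric (@mass R V K) (edge_weight theta o) d)
    (s : R) (hs : 0 < s) (hjump : jump_size (edge_weight theta o) d = s%:E)
    (hc : form_bounded theta o)
    (hvol : uniform_subexp_growth (@mass R V K) d)
    (S : \bar R -> R -> (simplex K -> R[i]) -> simplex K -> R[i])
    (hS : heat_semigroups theta o S)
    (p : \bar R) (hp : (1 <= p)%E) :
  spectrum (@mass R V K) (2%:E)%E (Delta2 theta o)
  = spectrum (@mass R V K) p (Delta S p).
Proof. exact: (spectrum_eq hsum htheta hd hs hjump hc hvol hS hp). Qed.
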